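(* Let $N\ge 1$, let $\mathcal{U},\mathcal{Y}$ be separable Hilbert spaces, and let $\theta$ be an arbitrary $L(\mathcal{U},\mathcal{Y})$-valued function that is holomorphic on some neighbourhood $\Gamma$ of $z=0$ in $\mathbb{C}^N$ and satisfies $\theta(0)=0$. Then there exist a separable Hilbert space $\dot{\mathcal{X}}$, a multiparametric linear system $\dot{\alpha}=(N;\dot{\mathbf{A}},\dot{\mathbf{B}},\dot{\mathbf{C}},\dot{\mathbf{D}};\dot{\mathcal{X}},\mathcal{U},\mathcal{Y})$ and a canonical symmetry $J\in L(\dot{\mathcal{X}})$ such that $\dot{\alpha}$ is a multiparametric $J$-conservative scattering linear system and $\theta(z)=\theta_{\dot{\alpha}}(z)$ for all $z$ in some neighbourhood (possibly smaller than $\Gamma$) of $z=0$, where $\theta_{\dot{\alpha}}$ is the transfer function of $\dot{\alpha}$.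
   Context: All Hilbert spaces are complex and separable; $L(\mathcal{H}_1,\mathcal{H}_2)$ denotes the Banach space of bounded linear operators from $\mathcal{H}_1$ to $\mathcal{H}_2$, and $L(\mathcal{H}):=L(\mathcal{H},\mathcal{H})$. For $z=(z_1,\ldots,z_N)\in\mathbb{C}^N$ and an $N$-tuple of operators $\mathbf{T}=(T_1,\ldots,T_N)$, write $z\mathbf{T}:=\sum_{k=1}^N z_kT_k$. A multiparametric discrete time-invariant linear system $\alpha=(N;\mathbf{A},\mathbf{B},\mathbf{C},\mathbf{D};\mathcal{X},\mathcal{U},\mathcal{Y})$ consists of separable Hilbert spaces $\mathcal{X}$ (states), $\mathcal{U}$ (inputs), $\mathcal{Y}$ (outputs) and $N$-tuples of bounded linear operators $\mathbf{A}=(A_k)$, $\mathbf{B}=(B_k)$, $\mathbf{C}=(C_k)$, $\mathbf{D}=(D_k)$, $k=1,\ldots,N$, with $A_k:\mathcal{X}\to\mathcal{X}$, $B_k:\mathcal{U}\to\mathcal{X}$, $C_k:\mathcal{X}\to\mathcal{Y}$, $D_k:\mathcal{U}\to\mathcal{Y}$; it represents the equations $x(t)=\sum_{k=1}^N(A_kx(t-e_k)+B_ku(t-e_k))$, $y(t)=\sum_{k=1}^N(C_kx(t-e_k)+D_ku(t-e_k))$ for $t\in\mathbb{Z}^N$, $|t|:=\sum_k t_k>0$, where $e_k$ is the $k$-th standard basis vector of $\mathbb{Z}^N$. Its system operators are $G_k=\begin{pmatrix}A_k&B_k\\ C_k&D_k\end{pmatrix}:\mathcal{X}\oplus\mathcal{U}\to\mathcal{X}\oplus\mathcal{Y}$,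 and $\mathbf{G}=(G_1,\ldots,G_N)$. Its transfer function is $\theta_\alpha(z)=z\mathbf{D}+z\mathbf{C}(I_{\mathcal{X}}-z\mathbf{A})^{-1}z\mathbf{B}$, defined in some neighbourhood of $z=0$ in $\mathbb{C}^N$. Canonical symmetry: an operator $J\in L(\mathcal{H})$ on a Hilbert space $\mathcal{H}$ with $J=J^*=J^{-1}$. $J$-conservativity: given a system $\alpha=(N;\mathbf{A},\mathbf{B},\mathbf{C},\mathbf{D};\mathcal{X},\mathcal{U},\mathcal{Y})$ and a canonical symmetry $J\in L(\mathcal{X})$, set $J_1:=J\oplus I_{\mathcal{U}}\in L(\mathcal{X}\oplus\mathcal{U})$ and $J_2:=J\oplus I_{\mathcal{Y}}\in L(\mathcal{X}\oplus\mathcal{Y})$. The system $\alpha$ is a multiparametric $J$-conservative scattering linear system if for every $\zeta\in\mathbb{T}^N:=\{\zeta\in\mathbb{C}^N:|\zeta_k|=1,\ k=1,\ldots,N\}$ one has $(\zeta\mathbf{G})^*J_2(\zeta\mathbf{G})=J_1$ and $(\zeta\mathbf{G})J_1(\zeta\mathbf{G})^*=J_2$. *)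

(* Defs.v *)
From HB Require Import structures.
From mathcomp Require Import all_boot all_order all_algebra.
From mathcomp Require Import all_classical all_reals topology normedtype derive.
From mathcomp Require Import complex sesquilinear ring lra.
Set Implicit Arguments.
Unset Strict Implicit.
Unset Printing Implicit Defensive.
Import Order.TTheory GRing.Theory Num.Theory.
Import numFieldNormedType.Exports.
Local Open Scope classical_set_scope.
Local Open Scope ring_scope.

(* Topology and norm of the complex field, as for any numFieldType. *)
HB.instance Definition _ (R : realType) := NormedModule.copy R[i] R[i]^o.

(* The scalars are R[i] with R an arbitrary realType; the inner product is linear
   in its first argument and conjugate-linear in its second one. *)
HB.mixin Record isHilbert (R : realType) (H : Type)
    & CompleteNormedModule R[i] H := {
  dotp : {dot H for (@Num.conj R[i])};
  sqr_norm_dotp : forall x : H, `|x| ^+ 2 = dotp x x }.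
#[short(type="hilbertType")]
HB.structure Definition Hilbert (R : realType) :=
  {H of isHilbert R H & CompleteNormedModule R[i] H}.

Definition separable (T : topologicalType) : Prop :=
  exists2 D : set T, countable D & dense D.

Section DotNorm.
Variables (C : numClosedFieldType) (V : lmodType C).
Variable dot : {dot V for (@Num.conj C)}.

Definition dotnorm (x : V) : C := sqrtC (dot x x).

Lemma dotnorm_ge0 x : 0 <= dotnorm x.
Proof. by rewrite sqrtC_ge0; apply: dnorm_ge0. Qed.

Lemma sqr_dotnorm x : dotnorm x ^+ 2 = dot x x.
Proof. by rewrite sqrtCK. Qed.

Lemma dot_CauchySchwarz x y : `|dot x y| <= dotnorm x * dotnorm y.
Proof.
have [->|y0] := eqVneq y 0.
  by rewrite linear0r normr0 mulr_ge0// dotnorm_ge0.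
have yy : 0 < dot y y by rewrite dnorm_gt0.
rewrite -ler_sqr ?nnegrE ?mulr_ge0 ?dotnorm_ge0 ?normr_ge0//.
rewrite exprMn !sqr_dotnorm.
have := dnorm_ge0 dot (dot y y *: x - dot x y *: y).
have dZ a b : dot (a *: x) (b *: y) = a * (Num.conj b * dot x y).
  by rewrite linearZl_LR linearZr_LR.
rewrite dnormB /= !dnormZ dZ.
rewrite (ger0_norm (ltW yy)).
have dJ : Num.conj (dot x y) = dot y x by rewrite [RHS]hermC expr0 mul1r.
rewrite dJ.
have yJ : Num.conj (dot y y) = dot y y by rewrite [RHS]hermC expr0 mul1r.
have -> : `|dot x y| ^+ 2 = dot x y * dot y x by rewrite normCK dJ.
rewrite !rmorphM /= yJ -dJ conjCK dJ.
have -> : dot y y ^+ 2 * dot x x + dot x y * dot y x * dot y y -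
  (dot y y * (dot y x * dot x y) + dot y y * (dot x y * dot y x)) =
  dot y y * (dot x x * dot y y - dot x y * dot y x).
  by ring.
by rewrite pmulr_rge0// subr_ge0.
Qed.

Lemma ler_dotnormD x y : dotnorm (x + y) <= dotnorm x + dotnorm y.
Proof.
rewrite -ler_sqr ?nnegrE ?addr_ge0 ?dotnorm_ge0//.
rewrite sqrrD !sqr_dotnorm dnormD /= [leRHS]addrAC lerD2l.
have -> : dot x y + (dot x y)^* = 2 * 'Re (dot x y).
  by rewrite ReE mulrC divfK// pnatr_eq0.
rewrite -[leRHS]mulr_natl ler_pM2l ?ltr0n//.
apply: le_trans (dot_CauchySchwarz x y).
apply: le_trans (real_ler_norm _) _; first exact: Creal_Re.
by case: (leif_normC_Re_Creal (dot x y)).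
Qed.

Lemma dotnormZ a x : dotnorm (a *: x) = `|a| * dotnorm x.
Proof.
rewrite /dotnorm dnormZ sqrtCM ?nnegrE ?exprn_ge0 ?normr_ge0//.
by rewrite sqrCK ?normr_ge0.
Qed.

Lemma dotnorm_eq0 x : dotnorm x = 0 -> x = 0.
Proof. by move/eqP; rewrite sqrtC_eq0 dnorm_eq0 => /eqP. Qed.

End DotNorm.

(* Hilbert spaces from an inner product alone: the norm is the induced one, and
   completeness is only required for sequences. *)
HB.factory Record Lmodule_isHilbert (R : realType) (H : Type)
    & GRing.Lmodule R[i] H := {
  dotp : {dot H for (@Num.conj R[i])};
  dotp_seq_complete : forall u : nat -> H,
    (forall e : R[i], 0 < e -> exists n0, forall m n, (n0 <= m)%N ->
       (n0 <= n)%N -> dotp (u m - u n) (u m - u n) < e) ->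
    exists l : H, forall e : R[i], 0 < e -> exists n0, forall n,
      (n0 <= n)%N -> dotp (u n - l) (u n - l) < e }.

HB.builders Context R H & Lmodule_isHilbert R H.

HB.instance Definition _ := Lmodule_isNormed.Build R[i] H
  (@ler_dotnormD _ _ dotp) (@dotnormZ _ _ dotp) (@dotnorm_eq0 _ _ dotp).

Lemma normE (x : H) : `|x| = dotnorm dotp x. Proof. by []. Qed.

Lemma sqr_norm (x : H) : `|x| ^+ 2 = dotp x x. Proof. exact: sqr_dotnorm. Qed.

Lemma invS_small (e : R[i]) : 0 < e -> exists n : nat, n.+1%:R^-1 < e.
Proof.
case: e => a b; rewrite ltcE /= => /andP[/eqP -> a0].
have [n na] : exists n : nat, n.+1%:R^-1 < a.
  exists (Num.truncn a^-1).
  rewrite invf_plt ?posrE ?ltr0Sn//.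
  exact: truncnS_gt.
exists n.
have -> : (n.+1%:R : R[i])^-1 = (n.+1%:R^-1 : R)%:C%C.
  by rewrite fmorphV rmorph_nat.
by rewrite ltcR.
Qed.

Lemma complete (F : set_system H) : ProperFilter F -> cauchy F -> cvg F.
Proof.
move=> FF /cauchyP Fc.
have e0 n : 0 < (n.+1%:R : R[i])^-1 by rewrite invr_gt0 ltr0Sn.
have /choice[c cP] : forall n : nat, exists x, F (ball x (n.+1%:R : R[i])^-1).
  by move=> n; exact: (Fc _ (e0 n)).
have cc n m : `|c n - c m| < (n.+1%:R : R[i])^-1 + (m.+1%:R : R[i])^-1.
  have [z [zn zm]] := filter_ex (filterI (cP n) (cP m)).
  rewrite -(subrK z (c n)) -addrA (le_lt_trans (ler_normD _ _))//.
  by apply: ltrD; [|rewrite distrC]; rewrite -ball_normE in zn zm *.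
have iS m n : (n <= m)%N -> (m.+1%:R : R[i])^-1 <= n.+1%:R^-1.
  by move=> nm; rewrite lef_pV2 ?posrE ?ltr0Sn// ler_nat ltnS.
have half e : 0 < e -> exists2 n : nat, 0 < e / 2 & (n.+1%:R : R[i])^-1 < e / 2.
  move=> ep; have e2 : 0 < e / 2 by rewrite divr_gt0.
  by have [n nP] := invS_small e2; exists n.
have [|l lP] := @dotp_seq_complete c.
  move=> e ep; have se : 0 < sqrtC e by rewrite sqrtC_gt0.
  have [n0 _ n0P] := half _ se.
  exists n0 => m n m0 nn0; rewrite -sqr_norm -[ltRHS]sqrtCK.
  rewrite ltr_sqr ?nnegrE ?normr_ge0// ?ltW//.
  apply: lt_le_trans (cc m n) _.
  apply: (@le_trans _ _ (sqrtC e / 2 + sqrtC e / 2)); last by rewrite -splitr.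
  by apply: lerD; apply: ltW; apply: le_lt_trans (iS _ _ _) n0P.
apply/cvg_ex; exists l; apply/cvg_ballP => e ep.
have [n1 e2 n1P] := half _ ep.
have [n2 n2P] := lP ((e / 2) ^+ 2) (exprn_gt0 _ e2).
pose n := maxn n1 n2.
have : F (ball (c n) (n.+1%:R : R[i])^-1) by [].
apply: filterS => z; rewrite -!ball_normE /ball_ /= => zc.
rewrite -(subrK (c n) l) -addrA (splitr e) (le_lt_trans (ler_normD _ _))//.
apply: ltrD.
  rewrite distrC -ltr_sqr ?nnegrE ?normr_ge0 ?(ltW e2)// sqr_norm.
  by apply: n2P; rewrite leq_maxr.
by apply: lt_trans zc _; apply: le_lt_trans (iS _ _ _) n1P; rewrite leq_maxl.
Qed.

HB.instance Definition _ := Uniform_isComplete.Build H complete.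
HB.instance Definition _ := isHilbert.Build R H sqr_norm.
HB.end.

Section BoundedOp.
Context {R : realType}.
Variables V W : normedModType R[i].

Definition bounded_linear : {pred V -> W} := fun f =>
  `[< linear f /\ exists M : R[i], forall x, `|f x| <= M * `|x| >].

Record boundedOp := BoundedOp {
  boundedOp_fun :> V -> W;
  boundedOpP : boundedOp_fun \in bounded_linear }.

HB.instance Definition _ := [isSub for boundedOp_fun].
HB.instance Definition _ := [Choice of boundedOp by <:].

Fact bounded_linear_submod_closed : submod_closed bounded_linear.
Proof.
split=> [|a f g].
  apply/asboolP; split; first by move=> k x y; rewrite scaler0 addr0.
  by exists 0 => x; rewrite normr0 mul0r.
move=> /asboolP[lf [M fM]] /asboolP[lg [K gK]]; apply/asboolP; split.
  move=> k x y; rewrite !fctE lf lg !scalerDr !scalerA mulrC.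
  by rewrite -!addrA; congr (_ + _); rewrite addrCA.
exists (`|a| * M + K) => x; rewrite (le_trans (ler_normD _ _))// mulrDl.
by rewrite lerD// normrZ -mulrA ler_wpM2l.
Qed.
HB.instance Definition _ :=
  GRing.isSubmodClosed.Build R[i] (V -> W) bounded_linear
    bounded_linear_submod_closed.
HB.instance Definition _ := [SubChoice_isSubLmodule of boundedOp by <:].

Lemma boundedOp_linear (T : boundedOp) : linear T.
Proof. by have /asboolP[] := boundedOpP T. Qed.

HB.instance Definition _ (T : boundedOp) :=
  GRing.isLinear.Build R[i] V W *:%R T (boundedOp_linear T).

Lemma boundedOp_eqP (S T : boundedOp) : S =1 T <-> S = T.
Proof. by split=> [ST|->//]; apply/val_inj/funext. Qed.

Lemma boundedOp_bounded (T : boundedOp) :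
  exists2 M : R, 0 <= M & forall x, `|T x| <= M%:C%C * `|x|.
Proof.
have /asboolP[_ [M TM]] := boundedOpP T.
exists (complex.Re `|M|).
  by move: (normr_ge0 M); rewrite lecE /= => /andP[].
move=> x; rewrite (RRe_real (normr_real M)).
apply: le_trans (TM x) _.
have [->|x0] := eqVneq x 0; first by rewrite normr0 !mulr0.
rewrite ler_pM2r ?normr_gt0//; apply: real_ler_norm.
have := le_trans (normr_ge0 _) (TM x).
by rewrite pmulr_lge0 ?normr_gt0// => /ger0_real.
Qed.

Definition mk_boundedOp (f : V -> W) (lf : linear f) (M : R[i])
    (fM : forall x, `|f x| <= M * `|x|) : boundedOp :=
  BoundedOp (introT (asboolP _) (conj lf (ex_intro _ M fM))).

(* Norms over R[i] take values in R[i], hence the embedding of the real supremum. *)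
Definition opnorm (T : boundedOp) : R[i] :=
  (sup [set complex.Re `|T x| | x in [set x | `|x| <= 1]])%:C%C.

Lemma opnorm_has_sup (T : boundedOp) :
  has_sup [set complex.Re `|T x| | x in [set x | `|x| <= 1]].
Proof.
have [M M0 TM] := boundedOp_bounded T; split.
  by exists (complex.Re `|T 0|), 0 => //=; rewrite normr0.
exists M => _ [x /= x1 <-].
rewrite -lecR (RRe_real (normr_real _)) (le_trans (TM x))//.
by rewrite ler_piMr// lecR.
Qed.

Lemma ler_opnorm (T : boundedOp) x : `|T x| <= opnorm T * `|x|.
Proof.
have [->|x0] := eqVneq x 0; first by rewrite linear0 !normr0 mulr0.
have px : 0 < `|x| by rewrite normr_gt0.
rewrite -ler_pdivrMr// mulrC -[`|x|^-1]ger0_norm ?invr_ge0// -normrZ.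
rewrite -linearZ -(RRe_real (normr_real _)) lecR.
apply: ub_le_sup; first by case: (opnorm_has_sup T).
by exists (`|x|^-1 *: x) => //=; rewrite normrZ normfV normr_id mulVf// gt_eqF.
Qed.

Lemma opnorm_le (T : boundedOp) (M : R) :
  (forall x, `|x| <= 1 -> `|T x| <= M%:C%C) -> opnorm T <= M%:C%C.
Proof.
move=> TM; rewrite lecR; apply: ge_sup; first by case: (opnorm_has_sup T).
by move=> _ [x /= x1 <-]; rewrite -lecR (RRe_real (normr_real _)) TM.
Qed.

Lemma opnorm_ge0 T : 0 <= opnorm T.
Proof.
rewrite lecR; apply: ub_le_sup; first by case: (opnorm_has_sup T).
by exists 0; rewrite /= ?linear0 ?normr0.
Qed.

Let opnormE T : opnorm T = (complex.Re (opnorm T))%:C%C. Proof. by []. Qed.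

Let ler_opnorm1 (T : boundedOp) x : `|x| <= 1 -> `|T x| <= opnorm T.
Proof. by move=> x1; rewrite (le_trans (ler_opnorm T x))// ler_piMr// opnorm_ge0. Qed.

Lemma ler_opnormD S T : opnorm (S + T) <= opnorm S + opnorm T.
Proof.
rewrite [in leRHS]opnormE [in leRHS](opnormE T) -rmorphD; apply: opnorm_le => x x1.
rewrite rmorphD; apply: le_trans (ler_normD _ _) _.
by apply: lerD; exact: ler_opnorm1.
Qed.

Lemma opnormZ a T : opnorm (a *: T) = `|a| * opnorm T.
Proof.
have le b S : opnorm (b *: S) <= `|b| * opnorm S.
  have bS : (complex.Re `|b| * complex.Re (opnorm S))%:C%C = `|b| * opnorm S.
    by rewrite [LHS]rmorphM; congr (_ * _); exact: RRe_real (normr_real b).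
  rewrite -bS; apply: opnorm_le => x x1; rewrite bS normrZ.
  by apply: ler_wpM2l => //; exact: ler_opnorm1.
apply/eqP; rewrite eq_le le /=.
have [->|a0] := eqVneq a 0; first by rewrite normr0 mul0r opnorm_ge0.
rewrite -ler_pdivlMl ?normr_gt0// -normfV.
by rewrite -[in leLHS](scalerK a0 T); exact: le.
Qed.

Lemma opnorm_eq0 T : opnorm T = 0 -> T = 0.
Proof.
move=> T0; apply/boundedOp_eqP => x; apply/eqP; rewrite -normr_le0.
by rewrite (le_trans (ler_opnorm T x))// T0 mul0r.
Qed.

HB.instance Definition _ :=
  Lmodule_isNormed.Build R[i] boundedOp ler_opnormD opnormZ opnorm_eq0.

End BoundedOp.

Notation "''L' ( V , W )" := (boundedOp V W)
  (at level 8, format "''L' ( V ,  W )") : type_scope.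

Section Algebra.
Context {R : realType}.
Implicit Types U V W : normedModType R[i].

Fact idop_linear V : linear (@id V). Proof. by []. Qed.
Fact idop_bounded V (x : V) : `|id x| <= 1 * `|x|. Proof. by rewrite mul1r. Qed.
Definition idop V : 'L(V, V) := mk_boundedOp (@idop_linear V) (@idop_bounded V).

Fact compop_linear U V W (S : 'L(V, W)) (T : 'L(U, V)) : linear (S \o T).
Proof. by move=> a x y; rewrite /= !linearP. Qed.
Fact compop_bounded U V W (S : 'L(V, W)) (T : 'L(U, V)) (x : U) :
  `|(S \o T) x| <= opnorm S * opnorm T * `|x|.
Proof.
apply: le_trans (ler_opnorm S _) _; rewrite -mulrA.
by apply: ler_wpM2l; [exact: opnorm_ge0|exact: ler_opnorm].
Qed.
Definition compop U V W (S : 'L(V, W)) (T : 'L(U, V)) : 'L(U, W) :=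
  mk_boundedOp (@compop_linear U V W S T) (@compop_bounded U V W S T).

Definition inverse_op V W (T : 'L(V, W)) (S : 'L(W, V)) :=
  compop S T = idop V /\ compop T S = idop W.
Definition invertible_op V W (T : 'L(V, W)) := exists S, inverse_op T S.
(* T^-1; it has the junk value 0 when T is not invertible. *)
Definition invop V W (T : 'L(V, W)) : 'L(W, V) := xget 0 (inverse_op T).

Lemma invopP V W (T : 'L(V, W)) : invertible_op T -> inverse_op T (invop T).
Proof. by move=> [S TS]; apply: (xgetPex 0 (P := inverse_op T)); exists S. Qed.

Lemma inverse_op_uniq V W (T : 'L(V, W)) S S' :
  inverse_op T S -> inverse_op T S' -> S = S'.
Proof.
move=> [ST TS] [ST' TS']; apply/boundedOp_eqP => x.
move/boundedOp_eqP/(_ (S x)) : ST' => /= <-.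
by move/boundedOp_eqP/(_ x) : TS => /= ->.
Qed.

End Algebra.

Notation "S *o T" := (compop S T) (at level 40, left associativity) : ring_scope.

Section Riesz.
Context {R : realType}.
Variable H : hilbertType R.
Implicit Types x y z : H.

Lemma dotpC x y : (dotp x y)^* = dotp y x.
Proof. by rewrite [RHS]hermC expr0 mul1r. Qed.

Lemma normr_dotp x : `|x| = sqrtC (dotp x x).
Proof. by rewrite -sqr_norm_dotp sqrCK. Qed.

Lemma dotp_CauchySchwarz x y : `|dotp x y| <= `|x| * `|y|.
Proof. by rewrite !normr_dotp; exact: dot_CauchySchwarz. Qed.

Let q x : R := complex.Re (dotp x x).

Let qE x : dotp x x = (q x)%:C%C.
Proof. by rewrite RRe_real// ger0_real// dnorm_ge0. Qed.

Let q_ge0 x : 0 <= q x.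
Proof. by rewrite -lecR -qE dnorm_ge0. Qed.

Let q_parallelogram x y : q (x - y) + q (x + y) = 2 * q x + 2 * q y.
Proof.
apply: complexI; rewrite !rmorphD !rmorphM rmorph_nat /= -!qE dnormB dnormD /=.
by ring.
Qed.

Let qZ (a : R) x : q (a%:C%C *: x) = a ^+ 2 * q x.
Proof.
apply: complexI; rewrite -qE dnormZ qE rmorphM rmorphXn /=; congr (_ * _).
by rewrite real_normK// complex_real.
Qed.

Let qz_arith (d a b c u v : R) : 4 * d <= c -> a < d + u -> b < d + v ->
  2 * a + 2 * b - c < 2 * u + 2 * v.
Proof. by move=> *; lra. Qed.

Let cauchy_arith (e u v w : R) : w < e / 4 -> u <= w -> v <= w ->
  2 * u + 2 * v < e.
Proof. by move=> *; lra. Qed.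

Theorem riesz (f : H -> R[i]) (M : R[i]) : scalar f ->
  (forall x, `|f x| <= M * `|x|) -> exists v, forall x, f x = dotp x v.
Proof.
move=> lf fM.
have fB x y : f (x - y) = f x - f y.
  by rewrite addrC -scaleN1r lf mulN1r addrC.
have fD x y : f (x + y) = f x + f y by rewrite -[x]scale1r lf mul1r scale1r.
have fZ a x : f (a *: x) = a * f x.
  by rewrite -[a *: x]addr0 lf -(subrr 0) fB subrr addr0.
have [f0|/existsNP[w fw]] := pselect (forall x, f x = 0).
  by exists 0 => x; rewrite f0 linear0r.
pose A := [set x | f x = 1].
have inf_A : has_inf (q @` A).
  split; last by exists 0 => _ [x _ <-]; exact: q_ge0.
  exists (q ((f w)^-1 *: w)), ((f w)^-1 *: w) => //=.
  by rewrite /A /= fZ mulVf//; apply/eqP.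
set d := inf (q @` A).
have dP x : A x -> d <= q x.
  by move=> Ax; apply: ge_inf; [case: inf_A|exists x].
have e_gt0 (n : nat) : 0 < (n.+1%:R : R)^-1 by rewrite invr_gt0 ltr0Sn.
have /choice[z zP] (n : nat) : exists x, A x /\ q x < d + n.+1%:R^-1.
  by have [_ [x Ax <-] xd] := inf_adherent (e_gt0 n) inf_A; exists x.
have zA n : f (z n) = 1 by case: (zP n).
have qz m n : q (z m - z n) < 2 * m.+1%:R^-1 + 2 * n.+1%:R^-1.
  have dq : 4 * d <= q (z m + z n).
    have := dP ((2^-1 : R)%:C%C *: (z m + z n)).
    rewrite qZ => /(_ _)/wrap[|dq].
      rewrite /A /= fZ fD !zA.
      by rewrite fmorphV rmorph_nat mulVf// pnatr_eq0.
    have -> : q (z m + z n) = 4 * (2^-1 ^+ 2 * q (z m + z n)) by field.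
    by rewrite ler_pM2l.
  have -> : q (z m - z n) = 2 * q (z m) + 2 * q (z n) - q (z m + z n).
    by rewrite -q_parallelogram addrK.
  by apply: qz_arith dq (zP m).2 (zP n).2.
have n_small (e : R) : 0 < e -> exists n : nat, n.+1%:R^-1 < e.
  move=> e0; exists (Num.truncn e^-1).
  by rewrite invf_plt ?posrE ?ltr0Sn//; exact: truncnS_gt.
have leV m n : (m <= n)%N -> (n.+1%:R : R)^-1 <= m.+1%:R^-1.
  by move=> mn; rewrite lef_pV2 ?posrE ?ltr0Sn// ler_nat ltnS.
have z_cauchy (e : R) : 0 < e -> exists n0, forall m n, (n0 <= m)%N ->
    (n0 <= n)%N -> `|z m - z n| < e%:C%C.
  move=> e0; have e2 : 0 < e ^+ 2 / 4 by rewrite divr_gt0 ?exprn_gt0.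
  have [n0 n0P] := n_small _ e2.
  exists n0 => m n m0 nn0.
  have e0C : 0 < e%:C%C by rewrite ltcR.
  rewrite -ltr_sqr ?nnegrE ?normr_ge0 ?ltW// sqr_norm_dotp qE -rmorphXn ltcR.
  by apply: lt_trans (qz m n) _; apply: cauchy_arith n0P (leV _ _ m0) (leV _ _ nn0).
have /cvg_ex[l /cvg_ballP zl] : cvg (z @ \oo).
  apply: cauchy_cvg; apply/cauchyP => e; rewrite ltcE => /andP[/eqP e_im e_re].
  have eE : e = (complex.Re e)%:C%C by case: e e_im {e_re} => ? ? /= ->.
  have [n0 n0P] := z_cauchy _ e_re.
  exists (z n0); exists n0 => // n /= n0n.
  by rewrite -ball_normE /ball_ /= eE n0P.
have w0 : 0 < `|w|.
  by rewrite normr_gt0; apply/eqP => w0; apply: fw; rewrite w0 -(subrr 0) fB subrr.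
have M_gt0 : 0 < M.
  have : 0 < M * `|w| by apply: lt_le_trans (fM w); rewrite normr_gt0; apply/eqP.
  by rewrite pmulr_lgt0.
have ME : M = (complex.Re M)%:C%C by rewrite RRe_real// gtr0_real.
have zlP (e : R) : 0 < e -> \forall n \near \oo, `|l - z n| < e%:C%C.
  move=> e0; have := zl e%:C%C; rewrite ltcR => /(_ e0).
  by apply: filterS => n; rewrite -ball_normE.
have small0 (c : R[i]) (K : R) : (forall e : R, 0 < e -> `|c| <= K%:C%C * e%:C%C) -> c = 0.
  move=> cK; apply: contrapT => /eqP c0.
  have cE : `|c| = (complex.Re `|c|)%:C%C by rewrite RRe_real// normr_real.
  have r0 : 0 < complex.Re `|c| by rewrite -ltcR -cE normr_gt0.
  have {}cK e : 0 < e -> complex.Re `|c| <= K * e.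
    by move=> /cK; rewrite cE -rmorphM lecR.
  have K0 : 0 < K by have := cK 1 ltr01; rewrite mulr1; exact: lt_le_trans.
  have := cK (complex.Re `|c| / (2 * K)).
  rewrite divr_gt0 ?mulr_gt0// => /(_ erefl).
  have -> : K * (complex.Re `|c| / (2 * K)) = complex.Re `|c| / 2.
    by field; rewrite gt_eqF.
  by rewrite leNgt ltr_pdivrMr// mulr_natr mulr2n ltrDl r0.
have fl : f l = 1.
  apply/eqP; rewrite -subr_eq0; apply/eqP; apply: (small0 _ (complex.Re M)) => e e0.
  have [n ln] := filter_ex (zlP _ e0).
  rewrite -(zA n) -fB (le_trans (fM _))// -ME.
  by apply: ler_wpM2l; exact: ltW.
have zk k n : f k = 0 -> `|dotp (z n) k| ^+ 2 <= dotp k k * (n.+1%:R^-1 : R)%:C%C.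
  move=> fk; have [->|k0] := eqVneq k 0.
    by rewrite !linear0r normr0 expr0n mul0r.
  have kk : 0 < dotp k k by rewrite dnorm_gt0.
  pose s := dotp (z n) k / dotp k k.
  have : d <= q (z n - s *: k) by apply: dP; rewrite /A /= fB fZ fk mulr0 subr0.
  rewrite -(lerD2r n.+1%:R^-1) => /(lt_le_trans (zP n).2).
  rewrite -ltcR rmorphD /= -!qE dnormB /= dnormZ linearZr_LR /= => dn.
  have zkE : (s^* * dotp (z n) k) = `|dotp (z n) k| ^+ 2 / dotp k k.
    by rewrite normCK /s rmorphM fmorphV /= !dotpC; ring.
  have skE : `|s| ^+ 2 * dotp k k = `|dotp (z n) k| ^+ 2 / dotp k k.
    rewrite normrM exprMn normfV (gtr0_norm kk) -mulrA; congr (_ * _).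
    by rewrite expr2 -mulrA mulVf ?mulr1// gt_eqF.
  have zkJ : (`|dotp (z n) k| ^+ 2 / dotp k k)^* = `|dotp (z n) k| ^+ 2 / dotp k k.
    by apply: conj_Creal; rewrite ger0_real// divr_ge0 ?exprn_ge0// ltW.
  move: dn; rewrite zkE skE zkJ -ler_pdivrMl// [_^-1 * _]mulrC.
  move: (_ / _) => t.
  have -> : dotp (z n) (z n) + t - (t + t) = dotp (z n) (z n) - t by ring.
  by rewrite addrAC -addrA ltrDl subr_gt0 => /ltW.
have l_orth k : f k = 0 -> dotp k l = 0.
  move=> fk; apply: (small0 _ (2 * complex.Re `|k|)) => e e0.
  have [n1 n1P] := n_small _ (exprn_gt0 2 e0).
  have : \forall n \near \oo, (n1 <= n)%N by exists n1.
  move=> /(filterI (zlP _ e0))/filter_ex[n [ln n1n]].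
  have -> : dotp k l = dotp k (l - z n) + dotp k (z n) by rewrite -linearDr subrK.
  rewrite (le_trans (ler_normD _ _))//.
  have -> : (2 * complex.Re `|k|)%:C%C * e%:C%C = `|k| * e%:C%C + `|k| * e%:C%C.
    by rewrite rmorphM rmorph_nat /= (RRe_real (normr_real k)); ring.
  apply: lerD.
    rewrite (le_trans (dotp_CauchySchwarz _ _))//.
    by apply: ler_wpM2l => //; exact: ltW.
  rewrite -(dotpC (z n) k) norm_conjC -ler_sqr ?nnegrE ?mulr_ge0 ?normr_ge0 ?lecR ?(ltW e0)//.
 apply: le_trans (zk _ _ fk) _; rewrite exprMn sqr_norm_dotp.
  apply: ler_wpM2l; first exact: dnorm_ge0.
  by rewrite -rmorphXn lecR (le_trans (leV _ _ n1n))// ltW.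
have l0 : dotp l l != 0.
  rewrite dnorm_eq0; apply/eqP => l0; move: fl.
  have -> : f l = 0 by rewrite l0 -(subrr 0) fB subrr.
  by move/eqP; rewrite eq_sym oner_eq0.
exists ((dotp l l)^-1 *: l) => x.
have := l_orth (x - f x *: l); rewrite fB fZ fl mulr1 subrr => /(_ erefl).
rewrite linearBl linearZl_LR /= => /eqP; rewrite subr_eq0 => /eqP xl.
rewrite linearZr_LR /= xl fmorphV /= dotpC mulrC mulfK//.
Qed.
End Riesz.

Section Adjoint.
Context {R : realType}.
Variables H K : hilbertType R.

Definition is_adjoint (T : 'L(H, K)) (S : 'L(K, H)) :=
  forall x y, dotp (T x) y = dotp x (S y).

(* Total by adjoint_exists, see adjointP. *)
Definition adjoint (T : 'L(H, K)) : 'L(K, H) := xget 0 (is_adjoint T).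

Lemma is_adjoint_uniq T S S' : is_adjoint T S -> is_adjoint T S' -> S = S'.
Proof.
move=> TS TS'; apply/boundedOp_eqP => y; apply/eqP; rewrite -subr_eq0.
rewrite -(dnorm_eq0 dotp); apply/eqP.
by rewrite linearBr /= -TS -TS' subrr.
Qed.

Lemma adjoint_exists T : exists S, is_adjoint T S.
Proof.
have /choice[s sP] y : exists v, forall x, dotp (T x) y = dotp x v.
  apply: (@riesz _ _ (fun x => dotp (T x) y) (opnorm T * `|y|)).
    by move=> a u v; rewrite linearP linearPl.
  move=> x; rewrite (le_trans (dotp_CauchySchwarz _ _))// mulrAC.
  by apply: ler_wpM2r => //; exact: ler_opnorm.
have sE y v : (forall x, dotp x v = dotp x (s y)) -> v = s y.
  move=> vy; apply/eqP; rewrite -subr_eq0 -(dnorm_eq0 dotp); apply/eqP.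
  by rewrite linearBr /= vy subrr.
have s_lin : linear s.
  move=> a y y'; apply/esym/sE => x.
  by rewrite linearPr /= -!sP linearPr.
have s_bnd y : `|s y| <= opnorm T * `|y|.
  have [->|sy] := eqVneq (s y) 0.
    by rewrite normr0 mulr_ge0// opnorm_ge0.
  have sy0 : 0 < `|s y| by rewrite normr_gt0.
  rewrite -(ler_pM2r sy0) -expr2 sqr_norm_dotp -sP.
  rewrite -[leLHS]ger0_norm; last by rewrite sP dnorm_ge0.
  rewrite (le_trans (dotp_CauchySchwarz _ _))// mulrAC.
  by apply: ler_wpM2r => //; exact: ler_opnorm.
by exists (mk_boundedOp s_lin s_bnd) => x y; exact: sP.
Qed.

Lemma adjointP (T : 'L(H, K)) x y : dotp (T x) y = dotp x (adjoint T y).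
Proof.
have : is_adjoint T (adjoint T) by apply: xgetPex; exact: adjoint_exists.
exact.
Qed.

End Adjoint.

Lemma hilbert_seq_complete {R : realType} (H : hilbertType R) (u : nat -> H) :
  (forall e : R[i], 0 < e -> exists n0, forall m n, (n0 <= m)%N ->
     (n0 <= n)%N -> dotp (u m - u n) (u m - u n) < e) ->
  exists l : H, forall e : R[i], 0 < e -> exists n0, forall n,
    (n0 <= n)%N -> dotp (u n - l) (u n - l) < e.
Proof.
move=> uc; have /cvg_ex[l /cvg_ballP ul] : cvg (u @ \oo).
  apply: cauchy_cvg; apply/cauchyP => e e0.
  have [n0 n0P] := uc _ (exprn_gt0 2 e0).
  exists (u n0); exists n0 => // n /= n0n.
  rewrite -ball_normE /ball_ /= -ltr_sqr ?nnegrE ?normr_ge0 ?(ltW e0)//.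
  by rewrite sqr_norm_dotp n0P.
exists l => e e0; have se : 0 < sqrtC e by rewrite sqrtC_gt0.
have [n0 _ n0P] := ul _ se; exists n0 => n /n0P.
rewrite -ball_normE /ball_ /= distrC -sqr_norm_dotp -[e in X in _ -> X]sqrtCK.
by rewrite ltr_sqr ?nnegrE ?normr_ge0 ?(ltW se).
Qed.

(* The Hilbert direct sum needs its own type: V * W already carries the max norm. *)
Definition hsum (V W : Type) : Type := (V * W)%type.

Section DirectSum.
Context {R : realType}.
Variables H K : hilbertType R.

HB.instance Definition _ := GRing.Lmodule.copy (hsum H K) (H * K)%type.

Definition hsum_dot (x y : hsum H K) : R[i] := dotp x.1 y.1 + dotp x.2 y.2.

Fact hsum_dot_bilinear :
  bilinear_for *%R (Num.conj \; *%R) hsum_dot.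
Proof.
split=> y a u v.
  by rewrite /hsum_dot /= !linearPl /=; ring.
by rewrite /hsum_dot /= !linearPr /=; ring.
Qed.

HB.instance Definition _ := bilinear_isBilinear.Build R[i] (hsum H K) (hsum H K)
  R[i] *%R (Num.conj \; *%R) hsum_dot hsum_dot_bilinear.

Fact hsum_dotC (x y : hsum H K) :
  hsum_dot x y = (-1) ^+ false * Num.conj (hsum_dot y x).
Proof. by rewrite expr0 mul1r rmorphD /= !dotpC. Qed.

HB.instance Definition _ := isHermitianSesquilinear.Build R[i] (hsum H K)
  false Num.conj hsum_dot hsum_dotC.

Fact hsum_dot_gt0 (x : hsum H K) : x != 0 -> 0 < hsum_dot x x.
Proof.
move=> x0; rewrite lt_def addr_ge0 ?dnorm_ge0// andbT.
rewrite paddr_eq0 ?dnorm_ge0// !dnorm_eq0; apply: contra x0.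
by case: x => a b /= /andP[/eqP -> /eqP ->].
Qed.

HB.instance Definition _ := isDotProduct.Build R[i] (hsum H K)
  hsum_dot hsum_dot_gt0.

Fact hsum_complete (u : nat -> hsum H K) :
  (forall e : R[i], 0 < e -> exists n0, forall m n, (n0 <= m)%N ->
     (n0 <= n)%N -> hsum_dot (u m - u n) (u m - u n) < e) ->
  exists l : hsum H K, forall e : R[i], 0 < e -> exists n0, forall n,
    (n0 <= n)%N -> hsum_dot (u n - l) (u n - l) < e.
Proof.
move=> uc.
have uB m n : hsum_dot (u m - u n) (u m - u n) =
    dotp ((u m).1 - (u n).1) ((u m).1 - (u n).1) +
    dotp ((u m).2 - (u n).2) ((u m).2 - (u n).2) by [].
have [l1 l1P] : exists l : H, forall e : R[i], 0 < e -> exists n0, forall n,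
    (n0 <= n)%N -> dotp ((u n).1 - l) ((u n).1 - l) < e.
  apply: hilbert_seq_complete => e /uc[n0 n0P]; exists n0 => m n m0 nn0.
  by apply: le_lt_trans (n0P m n m0 nn0); rewrite uB lerDl dnorm_ge0.
have [l2 l2P] : exists l : K, forall e : R[i], 0 < e -> exists n0, forall n,
    (n0 <= n)%N -> dotp ((u n).2 - l) ((u n).2 - l) < e.
  apply: hilbert_seq_complete => e /uc[n0 n0P]; exists n0 => m n m0 nn0.
  by apply: le_lt_trans (n0P m n m0 nn0); rewrite uB lerDr dnorm_ge0.
exists (l1, l2) => e e0; have e2 : 0 < e / 2 by rewrite divr_gt0.
have [n1 n1P] := l1P _ e2; have [n2 n2P] := l2P _ e2.
exists (maxn n1 n2) => n; rewrite geq_max => /andP[n1n n2n].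
by rewrite [ltRHS]splitr /hsum_dot ltrD ?n1P ?n2P.
Qed.

HB.instance Definition _ := Lmodule_isHilbert.Build R (hsum H K) hsum_complete.
End DirectSum.

Section Block.
Context {R : realType}.

Lemma ler_hsum1 (X U : hilbertType R) (x : hsum X U) : `|x.1| <= `|x|.
Proof.
by rewrite -ler_sqr ?nnegrE ?normr_ge0// !sqr_norm_dotp lerDl dnorm_ge0.
Qed.

Lemma ler_hsum2 (X U : hilbertType R) (x : hsum X U) : `|x.2| <= `|x|.
Proof.
by rewrite -ler_sqr ?nnegrE ?normr_ge0// !sqr_norm_dotp lerDr dnorm_ge0.
Qed.

Lemma ler_hsumD (X U : hilbertType R) (x : hsum X U) : `|x| <= `|x.1| + `|x.2|.
Proof.
rewrite -ler_sqr ?nnegrE ?addr_ge0 ?normr_ge0// sqrrD.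
by rewrite addrAC !sqr_norm_dotp lerDl mulrn_wge0// mulr_ge0.
Qed.

Variables X U X' Y : hilbertType R.
Variables (A : 'L(X, X')) (B : 'L(U, X')) (C : 'L(X, Y)) (D : 'L(U, Y)).

Definition block_fun (x : hsum X U) : hsum X' Y :=
  (A x.1 + B x.2, C x.1 + D x.2).

Fact block_linear : linear block_fun.
Proof.
by move=> a x y; congr pair; rewrite /= !linearP /= scalerDr addrACA.
Qed.

Fact block_bounded (x : hsum X U) : `|block_fun x| <=
  (opnorm A + opnorm B + (opnorm C + opnorm D)) * `|x|.
Proof.
have le1 Z (T : 'L(X, Z)) : `|T x.1| <= opnorm T * `|x|.
  apply: le_trans (ler_opnorm T _) _.
  by apply: ler_wpM2l; [exact: opnorm_ge0|exact: ler_hsum1].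
have le2 Z (T : 'L(U, Z)) : `|T x.2| <= opnorm T * `|x|.
  apply: le_trans (ler_opnorm T _) _.
  by apply: ler_wpM2l; [exact: opnorm_ge0|exact: ler_hsum2].
apply: le_trans (ler_hsumD _) _; rewrite !mulrDl.
by apply: lerD; apply: le_trans (ler_normD _ _) _; apply: lerD; rewrite ?le1 ?le2.
Qed.

(* / A B \
   \ C D /  *)
Definition block_op : 'L(hsum X U, hsum X' Y) :=
  mk_boundedOp block_linear block_bounded.

End Block.

Section Systems.
Context {R : realType} {N : nat}.

Definition pencil (V W : normedModType R[i]) (z : 'rV[R[i]]_N)
    (T : 'I_N -> 'L(V, W)) : 'L(V, W) :=
  \sum_(k < N) z 0 k *: T k.

Record lin_system (X U Y : hilbertType R) := LinSystem {
  sysA : 'I_N -> 'L(X, X);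
  sysB : 'I_N -> 'L(U, X);
  sysC : 'I_N -> 'L(X, Y);
  sysD : 'I_N -> 'L(U, Y) }.

Variables X U Y : hilbertType R.
Implicit Type alpha : lin_system X U Y.

Definition sysG alpha (k : 'I_N) : 'L(hsum X U, hsum X Y) :=
  block_op (sysA alpha k) (sysB alpha k) (sysC alpha k) (sysD alpha k).

Definition transfer_defined alpha (z : 'rV[R[i]]_N) : Prop :=
  invertible_op (idop X - pencil z (sysA alpha)).

Definition transfer alpha (z : 'rV[R[i]]_N) : 'L(U, Y) :=
  pencil z (sysD alpha) +
  pencil z (sysC alpha) *o invop (idop X - pencil z (sysA alpha))
    *o pencil z (sysB alpha).

Definition canonical_symmetry (H : hilbertType R) (J : 'L(H, H)) : Prop :=
  J = adjoint J /\ inverse_op J J.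

Definition J_conservative alpha (J : 'L(X, X)) : Prop :=
  let J1 : 'L(hsum X U, hsum X U) := block_op J 0 0 (idop U) in
  let J2 : 'L(hsum X Y, hsum X Y) := block_op J 0 0 (idop Y) in
  forall zeta : 'rV[R[i]]_N, (forall k, `|zeta 0 k| = 1) ->
    let G := pencil zeta (sysG alpha) in
    adjoint G *o J2 *o G = J1 /\ G *o J1 *o adjoint G = J2.

(* Complex (R[i]-linear) Frechet differentiability, for the operator norm. *)
Definition holomorphic_on (Gamma : set 'rV[R[i]]_N)
    (theta : 'rV[R[i]]_N -> 'L(U, Y)) : Prop :=
  forall z, Gamma z -> differentiable theta z.

End Systems.

Arguments lin_system {R} N X U Y.

(* Main.v *)
Require Import Defs.
From HB Require Import structures.
From mathcomp Require Import all_boot all_order all_algebra.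
From mathcomp Require Import all_classical all_reals all_analysis.
From mathcomp Require Import complex sesquilinear ring lra.
Set Implicit Arguments.
Unset Strict Implicit.
Unset Printing Implicit Defensive.
Import Order.TTheory GRing.Theory Num.Theory.
Import numFieldNormedType.Exports.
Import Normc.
Local Open Scope classical_set_scope.
Local Open Scope ring_scope.

(** Why the theorem holds. Two constructions are composed: [theta] is first
realized near 0 by some system, without any conservativity, and an arbitrary
system is then dilated to a J-conservative one with the same transfer function.

Realization. For a bounded holomorphic scalar f on the unit polydisc, setting
the coordinates to 0 one after the other telescopes f into Gleason's identity
  f z = f 0 + \sum_k z_k * shift k f z
([gleason]), where [shift k f] is a difference quotient in the k-th variable.
It is again holomorphic, and its sup norm is at most L times that of f, with L
universal ([shift_hol]). Iterating along words v in the N letters gives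
functions F_v with
  F_v z = F_v 0 + \sum_k z_k * F_(vk) z   and   |F_v| <= L ^ |v| |f|.
For s = 2NL the vector x_v = s ^ -|v| (F_v z - F_v 0) u is square summable over
all words, and the identity says precisely that x solves the state equation
of a system whose A_k are weighted backward shifts along words, whose B_k and
D_k consist of the values F_(vk) 0, and whose C_k read the one-letter
coordinates; its output is theta z u ([realization_solution]). The operator case
follows entry by entry, by Riesz representation.

The analysis behind [shift_hol] is Cauchy's formula on a square, obtained from
Goursat's theorem for functions that are merely continuous at one point
([goursat]); it shows that the difference quotient at 0 is differentiable at 0,
bounds it, and gives the stability of holomorphy under uniform limits.

Dilation. The pencil zG of any system factors as S2 P(z) S1, where S1 copies
the input N times, P(z) multiplies the k-th copy by z_k, and S2 applies G_k to
the k-th copy and sums. On the torus P(z) is unitary, but S1 and S2 are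
arbitrary. Write S' for the adjoint of S. The Eichler transvection
  (x, p, m) |-> (x - S' (p - m), p + s, m + s),
  s = S x - 1/2 S S' (p - m),
is bijective, preserves |x|^2 + |p|^2 - |m|^2, and maps (x, 0, 0) to
(x, S x, S x). Replacing S1 and S2 by their transvections, and P(z) by its
direct sum with multiplication by one coordinate z_(k0) on all the remaining
channels, produces a homogeneous pencil that is unitary for indefinite forms on the torus
and that has zG as a corner ([core_iso], [core_surj], [core_zero]).

The additional inputs and outputs are then moved into the state: the inputs
are read off a backward shift on l2, the outputs are stored by a forward shift
on l2, and the indefinite forms, repeated on every coordinate, become J
([feedback_conservative]). If the backward shift starts at 0 then nothing that
is stored ever acts on the original system, so solutions of its state equation
extend ([feedback_solution]). For small z the operator I - zA is invertible,
and such solutions determine the transfer function ([transfer_eq]). *)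

(** * Integrals of complex functions over segments *)

Section SegmentIntegral.
Variable R : realType.
Local Notation C := R[i].
Implicit Types (z w : C) (phi psi : R -> C).
Local Notation Re := (@complex.Re R).
Local Notation Im := (@complex.Im R).

Lemma normCE z : `|z| = (normc z)%:C%C.
Proof. by []. Qed.

Lemma normc_ge0 z : 0 <= normc z.
Proof. by case: z => a b; exact: sqrtr_ge0. Qed.

Lemma normr_Re z : `|Re z| <= normc z.
Proof.
by case: z => a b /=; rewrite -sqrtr_sqr ler_wsqrtr// lerDl sqr_ge0.
Qed.

Lemma normr_Im z : `|Im z| <= normc z.
Proof.
by case: z => a b /=; rewrite -sqrtr_sqr ler_wsqrtr// lerDr sqr_ge0.
Qed.

Lemma normc_le z : normc z <= `|Re z| + `|Im z|.
Proof.
case: z => a b /=; rewrite -[leRHS]ger0_norm ?addr_ge0// -sqrtr_sqr.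
rewrite ler_wsqrtr// sqrrD !real_normK ?num_real// addrAC lerDl.
by rewrite mulrn_wge0// mulr_ge0.
Qed.

Lemma normcB z w : normc (z - w) = normc (w - z).
Proof. by rewrite -normcN opprB. Qed.

Lemma normcR (a : R) : normc a%:C%C = `|a|.
Proof. by rewrite /= expr0n addr0 sqrtr_sqr. Qed.

Lemma normc_real (a : R) : 0 <= a -> normc a%:C%C = a.
Proof. by move=> a0; rewrite normcR ger0_norm. Qed.

Lemma normc_gt0 z : (0 < normc z) = (z != 0).
Proof. by rewrite -ltcR -normCE normr_gt0. Qed.

Lemma ler_normcB z w : normc (z - w) <= normc z + normc w.
Proof. by rewrite -(normcN w) le_normcD. Qed.

Lemma normcX z n : normc (z ^+ n) = normc z ^+ n.
Proof.
elim: n => [|n IH]; first by rewrite !expr0 normc1.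
by rewrite !exprS normcM IH.
Qed.

Definition cint phi (a b : R) : C :=
  ((\int[lebesgue_measure]_(x in `[a, b]) Re (phi x))%R +i*
   (\int[lebesgue_measure]_(x in `[a, b]) Im (phi x))%R)%C.

Definition cts_on phi (a b : R) := forall x, a <= x <= b ->
  {for x, continuous (Re \o phi)} /\ {for x, continuous (Im \o phi)}.

Lemma cts_integrable (f : R -> R) a b :
  (forall x, a <= x <= b -> {for x, continuous f}) ->
  lebesgue_measure.-integrable `[a, b] (EFin \o f).
Proof.
move=> cf; apply: continuous_compact_integrable; first exact: segment_compact.
apply: continuous_in_subspaceT => x; rewrite inE/= in_itv/=; exact: cf.
Qed.

Lemma cts_Re phi a b : cts_on phi a b ->
  lebesgue_measure.-integrable `[a, b] (EFin \o (Re \o phi)).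
Proof. by move=> h; apply: cts_integrable => x /h[]. Qed.

Lemma cts_Im phi a b : cts_on phi a b ->
  lebesgue_measure.-integrable `[a, b] (EFin \o (Im \o phi)).
Proof. by move=> h; apply: cts_integrable => x /h[]. Qed.

Lemma eq_cint phi psi a b : (forall x, a <= x <= b -> phi x = psi x) ->
  cint phi a b = cint psi a b.
Proof.
move=> e; rewrite /cint; congr (_ +i* _)%C; apply: eq_Rintegral => x;
  by rewrite inE/= in_itv/= => /e ->.
Qed.

Lemma cintD phi psi a b : cts_on phi a b -> cts_on psi a b ->
  cint (fun x => phi x + psi x) a b = cint phi a b + cint psi a b.
Proof.
move=> h k; rewrite /cint; simpc; congr (_ +i* _)%C.
  rewrite -RintegralD//; [|exact: cts_Re|exact: cts_Re].
  by apply: eq_Rintegral => x _; case: (phi x) (psi x) => ? ? [].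
rewrite -RintegralD//; [|exact: cts_Im|exact: cts_Im].
by apply: eq_Rintegral => x _; case: (phi x) (psi x) => ? ? [].
Qed.

Lemma cintZ k phi a b : cts_on phi a b ->
  cint (fun x => k * phi x) a b = k * cint phi a b.
Proof.
move=> h; have h1 := cts_Re h; have h2 := cts_Im h.
have iZ (f : R -> R) r : (forall x, a <= x <= b -> {for x, continuous f}) ->
    lebesgue_measure.-integrable `[a, b] (EFin \o (fun x => r * f x)).
  by move=> cf; apply: cts_integrable => x /cf fx; exact: cvgMl_tmp.
have iR r := iZ (Re \o phi) r (fun x xab => (h x xab).1).
have iI r := iZ (Im \o phi) r (fun x xab => (h x xab).2).
case: k => k1 k2; rewrite /cint; simpc; congr (_ +i* _)%C.
  rewrite -!RintegralZl// -RintegralB//.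
  by apply: eq_Rintegral => x _; case: (phi x).
rewrite -!RintegralZl// -RintegralD//.
by apply: eq_Rintegral => x _; case: (phi x) => u v /=; rewrite addrC.
Qed.

Lemma cint_split phi a c b : a <= c <= b -> cts_on phi a b ->
  cint phi a b = cint phi a c + cint phi c b.
Proof.
move=> /andP[ac cb] h; have h1 := cts_Re h; have h2 := cts_Im h.
have key (f : R -> R) : lebesgue_measure.-integrable `[a, b] (EFin \o f) ->
   (\int[lebesgue_measure]_(x in `[a, b]) f x)%R =
   (\int[lebesgue_measure]_(x in `[a, c]) f x)%R +
   (\int[lebesgue_measure]_(x in `[c, b]) f x)%R.
  move=> fi; rewrite -(@Rintegral_itv_obnd_cbnd _ c); last first.
    apply: integrableS fi => //; apply: subset_itv => //; by rewrite bnd_simp.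
  rewrite -(@Rintegral_itvB _ _ (BLeft a) (BRight b) c)//; first by rewrite addrC subrK.
by rewrite /cint; simpc; rewrite !key.
Qed.

(** The factor 2 comes from estimating the real and the imaginary part
separately. *)
Lemma cint_bound phi (a b K : R) : a <= b -> cts_on phi a b ->
  (forall x, a <= x <= b -> normc (phi x) <= K) ->
  normc (cint phi a b) <= 2 * K * (b - a).
Proof.
move=> ab h hK; have h1 := cts_Re h; have h2 := cts_Im h.
have key (f : R -> R) : lebesgue_measure.-integrable `[a, b] (EFin \o f) ->
    (forall x, a <= x <= b -> `|f x| <= K) ->
   `|(\int[lebesgue_measure]_(x in `[a, b]) f x)%R| <= K * (b - a).
  move=> fi fK; apply: le_trans (le_normr_Rintegral _ fi) _ => //.
  have st : \int[lebesgue_measure]_(x in `[a, b]) `|f x| <=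
      \int[lebesgue_measure]_(x in `[a, b]) (fun=> K) x.
    apply: le_Rintegral => //=.
    - exact: (integrable_norm fi).
    - by apply: cts_integrable => x _; exact: cst_continuous.
  suff <- : \int[lebesgue_measure]_(x in `[a, b]) (fun=> K) x = K * (b - a) by exact: st.
  rewrite Rintegral_cst//= lebesgue_measure_itv/= lte_fin.
  by case: ltgtP ab => // <-; rewrite ?subrr ?mulr0.
apply: le_trans (normc_le _) _; rewrite /=.
have -> : 2 * K * (b - a) = K * (b - a) + K * (b - a) by ring.
apply: lerD; apply: key => // x /hK; apply: le_trans.
  exact: normr_Re.
exact: normr_Im.
Qed.

Lemma cts_cst k a b : cts_on (fun=> k) a b.
Proof. by move=> x _; split; exact: cst_continuous. Qed.

Lemma cint_cst k a b : a <= b -> cint (fun=> k) a b = k * (b - a)%:C%C.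
Proof.
move=> ab; rewrite /cint !Rintegral_cst//= lebesgue_measure_itv/= lte_fin.
have -> : fine (if (a < b)%R then b%:E - a%:E else 0)%E = b - a.
  by case: ltgtP ab => // <-; rewrite ?subrr.
by case: k => u v /=; simpc.
Qed.

Lemma cts_id a b : cts_on (fun x => x%:C%C) a b.
Proof.
move=> x _; split; last exact: cst_continuous.
exact: cvg_id.
Qed.

Lemma cint_id a b : a <= b ->
  cint (fun x => x%:C%C) a b = ((b ^+ 2 - a ^+ 2) / 2)%:C%C.
Proof.
move=> ab; rewrite /cint /= Rintegral_cst// mul0r.
congr (_ +i* _)%C.
move: ab; rewrite le_eqVlt => /predU1P[->|ab].
  by rewrite subrr mul0r set_itv1 Rintegral_set1.
have d (x : R) : is_derive x 1 (fun t => t ^+ 2 / 2) x.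
  by apply: is_derive_eq; rewrite /GRing.scale/=; field.
have dc : continuous (fun t : R => t ^+ 2 / 2).
  move=> x; apply: differentiable_continuous; apply/derivable1_diffP.
  by have [] := d x.
rewrite /Rintegral (@continuous_FTC2 _ _ (fun t => t ^+ 2 / 2)) //.
- by rewrite -EFinB /= mulrBl.
- by apply: continuous_subspaceT => x; exact: cvg_id.
- split; first by move=> x _; have [] := d x.
  + exact/cvg_at_right_filter/dc.
  + exact/cvg_at_left_filter/dc.
- by move=> x _; rewrite derive1E (@derive_val _ _ _ _ _ _ _ (d x)).
Qed.

End SegmentIntegral.

(** * Complex differentiability and difference quotients *)

Section ComplexCalculus.
Variable R : realType.
Local Notation C := R[i].
Implicit Types (f g : C -> C) (a z w : C).

Definition ccont f a := {for a, continuous f}.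

Lemma ccontP f a : ccont f a <-> forall e : R, 0 < e ->
  exists2 d : R, 0 < d & forall w, normc (w - a) < d -> normc (f w - f a) < e.
Proof.
have FF := nbhs_filter a; split=> [/cvgrPdist_lt fa e e0|fa].
  have /fa : 0 < e%:C%C by rewrite ltcR.
  move=> /nbhs_ballP[[d1 d2] /= ]; rewrite ltcE/= => /andP[/eqP -> d0] ba.
  exists d1 => // w wd; have := ba w; rewrite -?ball_normE /= => /(_ _)/wrap[].
    by rewrite distrC normCE ltcR.
  by rewrite distrC normCE ltcR.
apply/cvgrPdist_lt => -[e1 e2]; rewrite ltcE/= => /andP[/eqP -> e0].
have [d d0 dP] := fa _ e0; apply/nbhs_ballP; exists d%:C%C; first by rewrite /= ltcR.
move=> w; rewrite -?ball_normE /= distrC normCE ltcR => /dP.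
by rewrite distrC normCE ltcR.
Qed.

Lemma ccontM f g a : ccont f a -> ccont g a -> ccont (fun x => f x * g x) a.
Proof. by move=> h k; exact: (@cvgM C _ _ (nbhs_filter a) _ _ _ _ h k). Qed.

Lemma ccontD f g a : ccont f a -> ccont g a -> ccont (fun x => f x + g x) a.
Proof. by move=> h k; exact: (@cvgD C _ _ _ (nbhs_filter a) _ _ _ _ h k). Qed.

Lemma ccontV f a : f a != 0 -> ccont f a -> ccont (fun x => (f x)^-1) a.
Proof. by move=> h k; exact: (@cvgV C _ _ (nbhs_filter a) _ _ h k). Qed.

Lemma ccont_cst k a : ccont (fun=> k) a.
Proof. exact: cst_continuous. Qed.

Lemma ccont_id a : ccont id a.
Proof. exact: cvg_id. Qed.

Arguments ccont_cst k a : clear implicits.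
Arguments ccont_id a : clear implicits.
#[global] Opaque ccont.

Lemma ccontN f a : ccont f a -> ccont (fun x => - f x) a.
Proof.
move=> h; have := ccontM (ccont_cst (-1) a) h.
by congr ccont; apply/funext => x; rewrite mulN1r.
Qed.

Lemma ccontB f g a : ccont f a -> ccont g a -> ccont (fun x => f x - g x) a.
Proof. by move=> h k; exact: ccontD h (ccontN k). Qed.

Lemma ccont_eq f g a (d : R) : 0 < d ->
  (forall w, normc (w - a) < d -> f w = g w) -> ccont f a -> ccont g a.
Proof.
move=> d0 fg /ccontP fa; apply/ccontP => e /fa[d1 d10 d1P].
exists (Num.min d d1); first by rewrite lt_min d0.
by move=> w; rewrite lt_min => /andP[wd /d1P]; rewrite !fg// subrr normc0.
Qed.

Lemma ccont_uniq f g a (d : R) : 0 < d -> ccont f a -> ccont g a ->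
  (forall w, w != a -> normc (w - a) < d -> f w = g w) -> f a = g a.
Proof.
move=> d0 fa ga fg; have /ccontP h := ccontB fa ga.
apply/eqP; rewrite -subr_eq0; apply/negPn/negP; rewrite -normc_gt0 => p0.
have [d1 d10 d1P] := h _ p0.
pose r := Num.min d d1 / 2; have r0 : 0 < r by rewrite divr_gt0// lt_min d0.
have rr : r < Num.min d d1 by rewrite ltr_pdivrMr// ltr_pMr ?lt_min ?d0// ltr1n.
have n : normc (a + r%:C%C - a) = r by rewrite addrAC subrr add0r normc_real// ltW.
have := d1P (a + r%:C%C); rewrite n fg ?n; last 2 first.
- by rewrite -subr_eq0 addrAC subrr add0r -normc_gt0 normc_real// ltW.
- by move: rr; rewrite lt_min => /andP[].
rewrite subrr sub0r normcN => /(_ _)/wrap[|]; last by rewrite ltxx.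
by move: rr; rewrite lt_min => /andP[].
Qed.

(** Complex differentiability in Caratheodory's form: [phi] is the difference
quotient, extended by the derivative at [a]. This makes [dquot] below a
continuous function and turns the product rule into algebra. *)
Definition cdiff f a :=
  exists2 phi, ccont phi a & forall w, f w = f a + phi w * (w - a).

Lemma cdiff_ccont f a : cdiff f a -> ccont f a.
Proof.
move=> [phi pc fE]; rewrite (_ : f = fun w => f a + phi w * (w - a)); last exact/funext.
have := ccontD (ccont_cst (f a) a) (ccontM pc (ccontB (ccont_id a) (ccont_cst a a))).
by [].
Qed.

Lemma cdiff_eq f g a (d : R) : 0 < d ->
  (forall w, normc (w - a) < d -> f w = g w) -> cdiff f a -> cdiff g a.
Proof.
move=> d0 fg [phi pc fE].
have fga : f a = g a by apply: fg; rewrite subrr normc0.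
exists (fun w => if w == a then phi a else (g w - g a) / (w - a)).
  apply: (ccont_eq d0) pc => w wd; case: eqVneq => [->//|wa].
  by rewrite -fg// -fga fE [f a + _]addrC addrK mulfK// subr_eq0.
move=> w; case: eqVneq => [->|wa]; first by rewrite subrr mulr0 addr0.
by rewrite divfK ?subr_eq0// addrC subrK.
Qed.

Lemma cdiff_cst k a : cdiff (fun=> k) a.
Proof. by exists (fun=> 0) => [|w]; [exact: ccont_cst|rewrite mul0r addr0]. Qed.

Lemma cdiff_id a : cdiff id a.
Proof. by exists (fun=> 1) => [|w]; [exact: ccont_cst|rewrite mul1r addrC subrK]. Qed.

Lemma cdiffD f g a : cdiff f a -> cdiff g a -> cdiff (fun w => f w + g w) a.
Proof.
move=> [p pc fE] [q qc gE]; exists (fun w => p w + q w); first exact: ccontD.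
by move=> w; rewrite (fE w) (gE w); ring.
Qed.

Lemma cdiffM f g a : cdiff f a -> cdiff g a -> cdiff (fun w => f w * g w) a.
Proof.
move=> df dg; have gc := cdiff_ccont dg; move: df dg => [p pc fE] [q qc gE].
exists (fun w => p w * g w + f a * q w).
  exact: ccontD (ccontM pc gc) (ccontM (ccont_cst (f a) a) qc).
by move=> w; rewrite (fE w) (gE w); ring.
Qed.

Lemma cdiffN f a : cdiff f a -> cdiff (fun w => - f w) a.
Proof.
move=> h; have := cdiffM (cdiff_cst (-1) a) h.
by congr cdiff; apply/funext => x; rewrite mulN1r.
Qed.

Lemma cdiffB f g a : cdiff f a -> cdiff g a -> cdiff (fun w => f w - g w) a.
Proof. by move=> h k; exact: cdiffD h (cdiffN k). Qed.

Lemma cdiffV f a : f a != 0 -> cdiff f a -> cdiff (fun w => (f w)^-1) a.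
Proof.
move=> fa df; have fc := cdiff_ccont df; have [p pc fE] := df.
have /ccontP/(_ (normc (f a))) := fc; rewrite normc_gt0 => /(_ fa)[d d0 dP].
have fw w : normc (w - a) < d -> f w != 0.
  by move=> /dP; apply: contraTN => /eqP ->; rewrite sub0r normcN ltxx.
exists (fun w => if f w == 0 then ((f w)^-1 - (f a)^-1) / (w - a)
                 else - p w * ((f w)^-1 * (f a)^-1)).
  have h := ccontM (ccontN pc) (ccontM (ccontV fa fc) (ccont_cst (f a)^-1 a)).
  apply: (ccont_eq d0 _ h) => w wd.
  by rewrite (negbTE (fw _ wd)).
move=> w; case: eqVneq => [fw0|fw0].
  rewrite divfK ?subr_eq0; first by rewrite addrC subrK.
  by apply: contraNneq fa => <-; exact/eqP.
have pw : p w * (w - a) = f w - f a by rewrite (fE w) addrAC subrr add0r.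
have -> : - p w * ((f w)^-1 * (f a)^-1) * (w - a) =
  - (p w * (w - a)) / (f w * f a) by rewrite invfM; ring.
by rewrite pw; field; rewrite fw0 fa.
Qed.

Lemma cdiff_affine f (b k : C) a : cdiff f (b + k * a) ->
  cdiff (fun w => f (b + k * w)) a.
Proof.
move=> [p pc fE]; exists (fun w => p (b + k * w) * k); last first.
  by move=> w; rewrite (fE (b + k * w)); ring.
apply: ccontM; last exact: ccont_cst.
have h : ccont (fun w => b + k * w) a.
  by apply: ccontD; [exact: ccont_cst|apply: ccontM; [exact: ccont_cst|exact: ccont_id]].
exact: continuous_comp h pc.
Qed.

(** The difference quotient of [f] at 0, whose value at 0 is the derivative:
the continuous [phi] is unique by [ccont_uniq]. *)
Definition dquot f : C -> C :=
  xget (fun=> 0) [set phi | ccont phi 0 /\ forall w, f w = f 0 + phi w * w].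

Lemma dquotP f : cdiff f 0 ->
  ccont (dquot f) 0 /\ forall w, f w = f 0 + dquot f w * w.
Proof.
move=> [phi pc fE]; apply: (xgetPex (fun=> 0)
  (P := [set phi | ccont phi 0 /\ forall w, f w = f 0 + phi w * w])).
by exists phi; split=> // w; rewrite (fE w) subr0.
Qed.

Lemma dquot_uniq f p : cdiff f 0 -> ccont p 0 ->
  (forall w, f w = f 0 + p w * w) -> p = dquot f.
Proof.
move=> df pc fE; have [qc fE'] := dquotP df.
have pq w : w != 0 -> p w = dquot f w.
  move=> w0; apply: (mulIf w0); apply: (addrI (f 0)); by rewrite -fE -fE'.
apply/funext => w; have [->|/pq//] := eqVneq w 0.
by apply: (ccont_uniq ltr01 pc qc) => w' /pq.
Qed.

Lemma dquot_off f w : cdiff f 0 -> w != 0 -> dquot f w = (f w - f 0) / w.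
Proof.
move=> df w0; have [_ fE] := dquotP df.
by rewrite (fE w) [f 0 + _]addrC addrK mulfK.
Qed.

Lemma dquotD f g : cdiff f 0 -> cdiff g 0 -> forall k,
  dquot (fun w => k * f w + g w) = fun w => k * dquot f w + dquot g w.
Proof.
move=> df dg k; have [fc fE] := dquotP df; have [gc gE] := dquotP dg.
apply/esym/dquot_uniq.
- by apply: cdiffD => //; apply: cdiffM => //; exact: cdiff_cst.
- exact: ccontD (ccontM (ccont_cst k 0) fc) gc.
- by move=> w; rewrite (fE w) (gE w); ring.
Qed.

Lemma cdiff_dquot_off f a : cdiff f 0 -> a != 0 -> cdiff f a -> cdiff (dquot f) a.
Proof.
move=> df a0 dfa.
apply: (@cdiff_eq (fun w => (f w - f 0) * w^-1) _ _ (normc a)).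
- by rewrite normc_gt0.
- move=> w wa; rewrite dquot_off//; apply: contraTneq wa => ->.
  by rewrite sub0r normcN ltxx.
- apply: cdiffM; first by apply: cdiffB => //; exact: cdiff_cst.
  by apply: cdiffV => //; exact: cdiff_id.
Qed.

End ComplexCalculus.

Arguments ccont_cst {R} k a.
Arguments ccont_id {R} a.

(** * Contour integrals over squares *)

Section Contour.
Variable R : realType.
Local Notation C := R[i].
Local Notation Re := (@complex.Re R).
Local Notation Im := (@complex.Im R).
Local Notation ii := (0 +i* 1)%C.
Implicit Types (f g : C -> C) (z w : C) (x y s : R).

Definition hseg f y := fun t : R => f (t +i* y)%C.
Definition vseg f x := fun t : R => f (x +i* t)%C.

Definition in_sq x y s z := (x <= Re z <= x + s) && (y <= Im z <= y + s).
Definition bd_sq x y s z := in_sq x y s z &&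
  [|| Re z == x, Re z == x + s, Im z == y | Im z == y + s].

(** The counterclockwise integral: bottom, right, top and left side, where
[dz] is [dt] on horizontal sides and [i dt] on vertical ones. *)
Definition contour f x y s : C :=
  cint (hseg f y) x (x + s) + ii * cint (vseg f (x + s)) y (y + s)
  - cint (hseg f (y + s)) x (x + s) - ii * cint (vseg f x) y (y + s).

Lemma normc_ii : normc (ii : C) = 1.
Proof. by rewrite /= expr0n add0r expr1n sqrtr1. Qed.

Lemma cts_comp f (p : R -> C) (a b : R) :
  (forall t u, normc (p t - p u) = `|t - u|) ->
  (forall t, a <= t <= b -> ccont f (p t)) -> cts_on (fun t => f (p t)) a b.
Proof.
move=> pE fc t tab; have /ccontP h := fc t tab.
by split; apply/cvgrPdist_lt => e e0; have [d d0 dP] := h _ e0;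
  apply/nbhs_ballP; exists d => // u; rewrite /ball/= => tu;
  (apply: le_lt_trans; last by apply: (dP (p u)); rewrite pE distrC);
  rewrite distrC; case: (f (p u)) (f (p t)) => a1 b1 [a2 b2];
  [exact: (normr_Re ((a1 +i* b1) - (a2 +i* b2))%C)
  |exact: (normr_Im ((a1 +i* b1) - (a2 +i* b2))%C)].
Qed.

Lemma cts_hseg f y (a b : R) :
  (forall t, a <= t <= b -> ccont f (t +i* y)%C) -> cts_on (hseg f y) a b.
Proof.
apply: (@cts_comp f (fun t => t +i* y)%C) => t u.
rewrite [X in normc X](_ : _ = (t - u)%:C%C) ?normcR//.
by apply/eqP; rewrite eq_complex /= subrr !eqxx.
Qed.

Lemma cts_vseg f x (a b : R) :
  (forall t, a <= t <= b -> ccont f (x +i* t)%C) -> cts_on (vseg f x) a b.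
Proof.
apply: (@cts_comp f (fun t => x +i* t)%C) => t u.
rewrite [X in normc X](_ : _ = ii * (t - u)%:C%C) ?normcM ?normc_ii ?mul1r ?normcR//.
by apply/eqP; rewrite eq_complex /= !(mul0r, mul1r, mulr0, subrr, oppr0, add0r, addr0) !eqxx.
Qed.

Lemma bd_sqP x y s (t : R) : 0 <= s ->
  [/\ x <= t <= x + s -> bd_sq x y s (t +i* y)%C,
      x <= t <= x + s -> bd_sq x y s (t +i* (y + s))%C,
      y <= t <= y + s -> bd_sq x y s (x +i* t)%C &
      y <= t <= y + s -> bd_sq x y s ((x + s) +i* t)%C].
Proof.
by move=> s0; split=> h; rewrite /bd_sq /in_sq /= ?eqxx ?orbT ?lexx ?lerDl ?s0 ?h.
Qed.

Lemma contour_cts f x y s : 0 <= s -> (forall z, bd_sq x y s z -> ccont f z) ->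
  [/\ cts_on (hseg f y) x (x + s), cts_on (hseg f (y + s)) x (x + s),
      cts_on (vseg f x) y (y + s) & cts_on (vseg f (x + s)) y (y + s)].
Proof.
move=> s0 fc; split.
- by apply: cts_hseg => t; have [h _ _ _] := bd_sqP x y t s0; move=> /h/fc.
- by apply: cts_hseg => t; have [_ h _ _] := bd_sqP x y t s0; move=> /h/fc.
- by apply: cts_vseg => t; have [_ _ h _] := bd_sqP x y t s0; move=> /h/fc.
- by apply: cts_vseg => t; have [_ _ _ h] := bd_sqP x y t s0; move=> /h/fc.
Qed.

Lemma eq_contour f g x y s : 0 <= s -> (forall z, bd_sq x y s z -> f z = g z) ->
  contour f x y s = contour g x y s.
Proof.
move=> s0 fg; rewrite /contour; congr (_ + _ * _ - _ - _ * _); apply: eq_cint => t.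
- by have [h _ _ _] := bd_sqP x y t s0; move=> /h/fg.
- by have [_ _ _ h] := bd_sqP x y t s0; move=> /h/fg.
- by have [_ h _ _] := bd_sqP x y t s0; move=> /h/fg.
- by have [_ _ h _] := bd_sqP x y t s0; move=> /h/fg.
Qed.

Lemma contourD f g x y s : 0 <= s ->
  (forall z, bd_sq x y s z -> ccont f z) ->
  (forall z, bd_sq x y s z -> ccont g z) ->
  contour (fun z => f z + g z) x y s = contour f x y s + contour g x y s.
Proof.
move=> s0 fc gc; have [f1 f2 f3 f4] := contour_cts s0 fc.
have [g1 g2 g3 g4] := contour_cts s0 gc.
have hD y' : hseg (fun z => f z + g z) y' = fun t => hseg f y' t + hseg g y' t by [].
have vD x' : vseg (fun z => f z + g z) x' = fun t => vseg f x' t + vseg g x' t by [].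
by rewrite /contour !hD !vD !cintD//; ring.
Qed.

Lemma contourZ k f x y s : 0 <= s ->
  (forall z, bd_sq x y s z -> ccont f z) ->
  contour (fun z => k * f z) x y s = k * contour f x y s.
Proof.
move=> s0 fc; have [f1 f2 f3 f4] := contour_cts s0 fc.
have hZ y' : hseg (fun z => k * f z) y' = fun t => k * hseg f y' t by [].
have vZ x' : vseg (fun z => k * f z) x' = fun t => k * vseg f x' t by [].
by rewrite /contour !hZ !vZ !cintZ//; ring.
Qed.

Lemma contour_bound f x y s (K : R) : 0 <= s ->
  (forall z, bd_sq x y s z -> ccont f z) ->
  (forall z, bd_sq x y s z -> normc (f z) <= K) ->
  normc (contour f x y s) <= 8 * K * s.
Proof.
move=> s0 fc fK; have [f1 f2 f3 f4] := contour_cts s0 fc.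
have sE (x' : R) : x' + s - x' = s by rewrite addrAC subrr add0r.
have le1 (x' : R) : x' <= x' + s by rewrite lerDl.
have b1 : normc (cint (hseg f y) x (x + s)) <= 2 * K * s.
  rewrite -[in leRHS](sE x); apply: cint_bound => // t.
  by have [h _ _ _] := bd_sqP x y t s0; move=> /h/fK.
have b2 : normc (cint (hseg f (y + s)) x (x + s)) <= 2 * K * s.
  rewrite -[in leRHS](sE x); apply: cint_bound => // t.
  by have [_ h _ _] := bd_sqP x y t s0; move=> /h/fK.
have b3 : normc (cint (vseg f x) y (y + s)) <= 2 * K * s.
  rewrite -[in leRHS](sE y); apply: cint_bound => // t.
  by have [_ _ h _] := bd_sqP x y t s0; move=> /h/fK.
have b4 : normc (cint (vseg f (x + s)) y (y + s)) <= 2 * K * s.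
  rewrite -[in leRHS](sE y); apply: cint_bound => // t.
  by have [_ _ _ h] := bd_sqP x y t s0; move=> /h/fK.
rewrite /contour; have -> : 8 * K * s = 2 * K * s + 2 * K * s + 2 * K * s + 2 * K * s by ring.
apply: le_trans (ler_normcB _ _) _; apply: lerD; last by rewrite normcM normc_ii mul1r.
apply: le_trans (ler_normcB _ _) _; apply: lerD => //.
apply: le_trans (le_normcD _ _) _; apply: lerD => //.
by rewrite normcM normc_ii mul1r.
Qed.

Lemma ccont_affine (k b : C) z : ccont (fun w => k * w + b) z.
Proof.
apply: ccontD; last exact: ccont_cst.
by apply: ccontM; [exact: ccont_cst|exact: ccont_id].
Qed.

(** Computed directly from the integrals of 1 and t. *)
Lemma contour_affine (k b : C) x y s : 0 <= s ->
  contour (fun z => k * z + b) x y s = 0.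
Proof.
move=> s0; rewrite /contour.
have hA y' : hseg (fun z => k * z + b) y' = fun t => k * t%:C%C + (k * (0 +i* y')%C + b).
  by apply/funext => t; rewrite /hseg addrA -mulrDr; simpc.
have vA x' : vseg (fun z => k * z + b) x' = fun t => (k * ii) * t%:C%C + (k * x'%:C%C + b).
  apply/funext => t; rewrite /vseg addrA; congr (_ + _).
  by rewrite -mulrA -mulrDr; congr (_ * _); simpc.
have cA (k' b' : C) (u v : R) : u <= v ->
   cint (fun t => k' * t%:C%C + b') u v =
   k' * ((v ^+ 2 - u ^+ 2) / 2)%:C%C + b' * (v - u)%:C%C.
  move=> uv; have h : cts_on (fun t : R => k' * t%:C%C) u v.
    apply: (@cts_comp (fun z => k' * z) (fun t => t%:C%C)) => t.
      by move=> t'; rewrite -normcR rmorphB.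
    by move=> _; apply: ccontM; [exact: ccont_cst|exact: ccont_id].
  rewrite cintD//; last exact: cts_cst.
  by rewrite cintZ ?cint_id ?cint_cst//; exact: cts_id.
have le1 (x' : R) : x' <= x' + s by rewrite lerDl.
rewrite !hA !vA !cA//.
have iE (u : R) : (0 +i* u)%C = ii * u%:C%C :> C by simpc.
rewrite (iE y) (iE (y + s)).
have i2 : ii * ii = -1 :> C by simpc.
rewrite !rmorphM /= !rmorphB /= !rmorphXn /= !rmorphD /=.
move: (x%:C%C) (y%:C%C) (s%:C%C) (2^-1)%:C%C => X Y S h.
have -> : ii * (k * ii * (((Y + S) ^+ 2 - Y ^+ 2) * h) + (k * (X + S) + b) * (Y + S - Y)) =
   (ii * ii) * (k * (((Y + S) ^+ 2 - Y ^+ 2) * h)) + ii * ((k * (X + S) + b) * (Y + S - Y)).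
  by ring.
have -> : ii * (k * ii * (((Y + S) ^+ 2 - Y ^+ 2) * h) + (k * X + b) * (Y + S - Y)) =
   (ii * ii) * (k * (((Y + S) ^+ 2 - Y ^+ 2) * h)) + ii * ((k * X + b) * (Y + S - Y)).
  by ring.
by ring.
Qed.

Lemma halfD (u s : R) : u + s / 2 + s / 2 = u + s.
Proof. by rewrite -addrA -splitr. Qed.

Lemma in_sq_sub x y s (i j : bool) z : 0 <= s ->
  in_sq (x + i%:R * (s / 2)) (y + j%:R * (s / 2)) (s / 2) z -> in_sq x y s z.
Proof.
move=> s0 /andP[/andP[h1 h2] /andP[h3 h4]].
have hs : 0 <= s / 2 by rewrite divr_ge0.
have e : s = s / 2 + s / 2 := splitr s.
by move: h1 h2 h3 h4 hs e; rewrite /in_sq; move: (s / 2) => h;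
  case: i; case: j; rewrite /= ?mul0r ?mul1r ?addr0 => *; apply/andP; split;
  apply/andP; split; lra.
Qed.

Lemma contour_split f x y s : 0 <= s ->
  (forall z, in_sq x y s z -> ccont f z) ->
  contour f x y s = contour f x y (s / 2) + contour f (x + s / 2) y (s / 2)
   + (contour f x (y + s / 2) (s / 2) + contour f (x + s / 2) (y + s / 2) (s / 2)).
Proof.
move=> s0 fc; have hs : 0 <= s / 2 by rewrite divr_ge0.
have cH y' : y <= y' <= y + s -> cts_on (hseg f y') x (x + s).
  by move=> yy; apply: cts_hseg => t tx; apply: fc; rewrite /in_sq /= tx.
have cV x' : x <= x' <= x + s -> cts_on (vseg f x') y (y + s).
  by move=> xx; apply: cts_vseg => t ty; apply: fc; rewrite /in_sq /= ty xx.
have m (u : R) : u <= u + s / 2 <= u + s by rewrite -(halfD u s) !lerDl hs.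
have b1 (u : R) : u <= u <= u + s by rewrite lexx lerDl.
have b2 (u : R) : u <= u + s <= u + s by rewrite lexx lerDl s0.
have sH y' : y <= y' <= y + s -> cint (hseg f y') x (x + s) =
   cint (hseg f y') x (x + s / 2) + cint (hseg f y') (x + s / 2) (x + s).
  by move=> yy; apply: cint_split => //; exact: cH.
have sV x' : x <= x' <= x + s -> cint (vseg f x') y (y + s) =
   cint (vseg f x') y (y + s / 2) + cint (vseg f x') (y + s / 2) (y + s).
  by move=> xx; apply: cint_split => //; exact: cV.
rewrite /contour !halfD sH// sH// sV// sV//.
by ring.
Qed.

End Contour.

Arguments ccont_affine {R} k b z.

(** * Goursat's theorem with an exceptional point *)

Section Bisection.
Variable R : realType.
Implicit Types (x y s : R).

Lemma geometric_small (s d : R) : 0 < d -> exists n : nat, s / 2 ^+ n < d.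
Proof.
move=> d0; exists (Num.truncn (s / d)).+1.
rewrite ltr_pdivrMr ?exprn_gt0// mulrC -ltr_pdivrMr//.
apply: lt_trans (truncnS_gt _) _.
by rewrite -natrX ltr_nat ltn_expl.
Qed.

(** A property that passes from a square to one of its four quarters holds for
arbitrarily small squares around one common point. *)
Lemma bisection (Bad : R -> R -> R -> Prop) x0 y0 s0 : 0 < s0 -> Bad x0 y0 s0 ->
  (forall x y s, 0 < s -> Bad x y s -> exists i j : bool,
     Bad (x + i%:R * (s / 2)) (y + j%:R * (s / 2)) (s / 2)) ->
  exists z : R[i], in_sq x0 y0 s0 z /\ forall d, 0 < d ->
    exists x y s, [/\ 0 < s, s < d, in_sq x y s z & Bad x y s].
Proof.
move=> s00 B0 step.
pose ok (p : R * R * R) := 0 < p.2 /\ Bad p.1.1 p.1.2 p.2.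
pose child (p q : R * R * R) := exists i j : bool,
  q = (p.1.1 + i%:R * (p.2 / 2), p.1.2 + j%:R * (p.2 / 2), p.2 / 2).
have /choice[nx nxP] : forall p, exists q, ok p -> ok q /\ child p q.
  move=> p; have [[p0 pB]|np] := pselect (ok p); last by exists p.
  have [i [j ijB]] := step _ _ _ p0 pB.
  exists (p.1.1 + i%:R * (p.2 / 2), p.1.2 + j%:R * (p.2 / 2), p.2 / 2) => _.
  split; last by exists i, j.
  by split=> //=; rewrite divr_gt0.
pose u n := iter n nx (x0, y0, s0).
have uok n : ok (u n) by elim: n => [|n /nxP[]].
have us n : (u n).2 = s0 / 2 ^+ n.
  elim: n => [|n IH]; first by rewrite expr0 divr1.
  have [_ [i [j e]]] := nxP _ (uok n).
  by rewrite [u n.+1]e /= IH exprS invfM mulrA mulrAC.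
(* c is either corner coordinate; its supremum is the limit *)
have nest (c : R * R * R -> R) : (forall p q, ok p -> child p q ->
      c p <= c q /\ c q + q.2 <= c p + p.2) ->
    exists X, forall n, c (u n) <= X <= c (u n) + (u n).2.
  move=> cP.
  have mono n m : (n <= m)%N -> c (u n) <= c (u m) /\ c (u m) + (u m).2 <= c (u n) + (u n).2.
    elim: m => [|m IH]; first by rewrite leqn0 => /eqP ->.
    rewrite leq_eqVlt => /predU1P[->//|/IH[h1 h2]].
    have [_ /(cP _ _ (uok m))[h3 h4]] := nxP _ (uok m).
    by split; [exact: le_trans h3|exact: le_trans h2].
  have le2 n m : c (u n) <= c (u m) + (u m).2.
    have [nm|/ltnW mn] := leqP n m.
      by apply: le_trans (mono _ _ nm).1 _; rewrite lerDl; have [/ltW] := uok m.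
    by apply: le_trans (mono _ _ mn).2; rewrite lerDl; have [/ltW] := uok n.
  have hs : has_sup (range (c \o u)).
    split; first by exists (c (u 0%N)), 0%N.
    by exists (c (u 0%N) + (u 0%N).2) => _ [n _ <-]; exact: le2.
  exists (sup (range (c \o u))) => n; apply/andP; split.
    by apply: ub_le_sup; [case: hs|exists n].
  by apply: ge_sup; [case: hs|move=> _ [m _ <-]; exact: le2].
have half (a s : R) (i : bool) : 0 < s ->
    a <= a + i%:R * (s / 2) /\ a + i%:R * (s / 2) + s / 2 <= a + s.
  move=> sp; have hs : 0 < s / 2 by rewrite divr_gt0.
  have e : s = s / 2 + s / 2 := splitr s.
  by move: hs e; move: (s / 2) => h; case: i; rewrite /= ?mul0r ?mul1r => *; split; lra.
have [X XP] : exists X, forall n, (u n).1.1 <= X <= (u n).1.1 + (u n).2.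
  by apply: (nest (fun p => p.1.1)) => p q [p0 _] [i [j ->]] /=; exact: half.
have [Y YP] : exists Y, forall n, (u n).1.2 <= Y <= (u n).1.2 + (u n).2.
  by apply: (nest (fun p => p.1.2)) => p q [p0 _] [i [j ->]] /=; exact: half.
exists (X +i* Y)%C; split; first by rewrite /in_sq /= (XP 0%N) (YP 0%N).
move=> d d0; have [n nd] := geometric_small s0 d0.
have [n0 nB] := uok n.
exists (u n).1.1, (u n).1.2, (u n).2; split=> //; first by rewrite us.
by rewrite /in_sq /= XP YP.
Qed.

End Bisection.

Section Goursat.
Variable R : realType.
Local Notation C := R[i].
Local Notation Re := (@complex.Re R).
Local Notation Im := (@complex.Im R).
Implicit Types (f g : C -> C) (z w p : C) (x y s : R).

(** Half the antiderivative of [|t| ^ -1/2]. *)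
Definition sgsqrt (t : R) := Num.sg t * Num.sqrt `|t|.

Lemma sgsqrt_nneg t : 0 <= t -> sgsqrt t = Num.sqrt t.
Proof.
rewrite le_eqVlt /sgsqrt => /predU1P[<-|t0]; first by rewrite sgr0 mul0r sqrtr0.
by rewrite gtr0_sg// mul1r gtr0_norm.
Qed.

Lemma sgsqrtN t : sgsqrt (- t) = - sgsqrt t.
Proof. by rewrite /sgsqrt sgrN normrN mulNr. Qed.

Lemma sgsqrt_mono t u : t <= u -> sgsqrt t <= sgsqrt u.
Proof.
move=> tu; have [t0|t0] := leP 0 t.
  by rewrite !sgsqrt_nneg ?ler_wsqrtr// (le_trans t0).
rewrite -[t]opprK sgsqrtN; have [u0|u0] := leP 0 u.
  rewrite !sgsqrt_nneg ?oppr_ge0 ?(ltW t0)//.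
  by apply: (@le_trans _ _ 0); rewrite ?oppr_le0 sqrtr_ge0.
rewrite -[u]opprK [in leRHS]sgsqrtN lerN2 !sgsqrt_nneg ?oppr_ge0 ?(ltW t0) ?(ltW u0)//.
by rewrite ler_wsqrtr// lerN2.
Qed.

Lemma sgsqrt_gap t s : t <= 0 <= t + s -> Num.sqrt s <= sgsqrt (t + s) - sgsqrt t.
Proof.
move=> /andP[t0 ts]; rewrite -sgsqrtN !sgsqrt_nneg ?oppr_ge0//.
rewrite -[leRHS]ger0_norm ?addr_ge0 ?sqrtr_ge0// -sqrtr_sqr ler_wsqrtr//.
rewrite sqrrD !sqr_sqrtr ?oppr_ge0// addrAC [t + s]addrC addrK lerDl mulrn_wge0// mulr_ge0 ?sqrtr_ge0.
Qed.

(** Up to the factor 1/4, the integral over the square of the density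
[|u - Re p| ^ -1/2 * |v - Im p| ^ -1/2]: an additive set function that is as
large as the side, not merely the area, for squares that contain [p]. *)
Definition sqmass p x y s :=
  (sgsqrt (x + s - Re p) - sgsqrt (x - Re p)) *
  (sgsqrt (y + s - Im p) - sgsqrt (y - Im p)).

Lemma sqmass_ge0 p x y s : 0 <= s -> 0 <= sqmass p x y s.
Proof.
by move=> s0; rewrite mulr_ge0// subr_ge0 sgsqrt_mono// lerD2r lerDl.
Qed.

Lemma sqmass_center p x y s : 0 <= s -> in_sq x y s p -> s <= sqmass p x y s.
Proof.
move=> s0 /andP[/andP[h1 h2] /andP[h3 h4]].
rewrite -[leLHS]sqr_sqrtr// expr2; apply: ler_pM; rewrite ?sqrtr_ge0//.
  by rewrite addrAC sgsqrt_gap// subr_le0 h1 addrAC subr_ge0.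
by rewrite addrAC sgsqrt_gap// subr_le0 h3 addrAC subr_ge0.
Qed.

Lemma in_sq_dist x y s z w : in_sq x y s z -> in_sq x y s w -> normc (w - z) <= 2 * s.
Proof.
move=> /andP[/andP[h1 h2] /andP[h3 h4]] /andP[/andP[k1 k2] /andP[k3 k4]].
apply: le_trans (normc_le _) _; rewrite mulr_natl mulr2n.
case: z w h1 h2 h3 h4 k1 k2 k3 k4 => a b [c d] /= *.
by apply: lerD; rewrite ler_norml; apply/andP; split; lra.
Qed.

Lemma bd_in x y s z : bd_sq x y s z -> in_sq x y s z.
Proof. by case/andP. Qed.

(** The affine part integrates to 0, so only the deviation counts. *)
Lemma contour_near_affine f (k b : C) x y s (e : R) : 0 <= s ->
  (forall z, in_sq x y s z -> ccont f z) ->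
  (forall z, in_sq x y s z -> normc (f z - (k * z + b)) <= e) ->
  normc (contour f x y s) <= 8 * e * s.
Proof.
move=> s0 fc fe.
have -> : contour f x y s = contour (fun z => f z - (k * z + b)) x y s.
  rewrite -[RHS]addr0 -(contour_affine k b x y s0) -contourD//.
  - by apply: eq_contour => // z _; rewrite subrK.
  - by move=> z /bd_in/fc fz; exact: ccontB fz (ccont_affine k b z).
  - by move=> z _; exact: ccont_affine.
apply: contour_bound => //.
- by move=> z /bd_in/fc fz; exact: ccontB fz (ccont_affine k b z).
- by move=> z /bd_in/fe.
Qed.

(** The classical bisection, with |contour integral| > e * (area + mass) as the
property that is inherited by a quarter. In the limit the squares shrink to a
point z. If z is not [p], differentiability bounds the integral by e * area. At
[p] continuity only bounds it by e * side, and this is what [sqmass] absorbs. *)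
Theorem goursat f p x y s : 0 < s ->
  (forall z, in_sq x y s z -> ccont f z) ->
  (forall z, in_sq x y s z -> z != p -> cdiff f z) ->
  contour f x y s = 0.
Proof.
move=> s0 fc fd; apply/eqP/negPn/negP; rewrite -normc_gt0 => c0.
pose W x' y' s' := s' ^+ 2 + sqmass p x' y' s'.
have W0 : 0 < W x y s by rewrite ltr_wpDr ?sqmass_ge0 ?exprn_gt0 ?ltW.
(* half of the ratio attained by the given square, so that it qualifies *)
pose e := normc (contour f x y s) / (2 * W x y s).
have e0 : 0 < e by rewrite divr_gt0// mulr_gt0.
pose Bad x' y' s' := (forall z, in_sq x' y' s' z -> in_sq x y s z) /\
  e * W x' y' s' < normc (contour f x' y' s').
have B0 : Bad x y s.
  split=> //; rewrite /e -mulrA invfM -mulrA mulVf ?gt_eqF// mulr1.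
  by rewrite ltr_pdivrMr// mulr_natr mulr2n ltrDl.
have [|z [zin zP]] := bisection s0 B0.
  move=> x' y' s' s'0 [sub big]; apply: contrapT => nB.
  have small (i j : bool) : normc (contour f (x' + i%:R * (s' / 2)) (y' + j%:R * (s' / 2)) (s' / 2))
      <= e * W (x' + i%:R * (s' / 2)) (y' + j%:R * (s' / 2)) (s' / 2).
    rewrite leNgt; apply/negP => lt; apply: nB; exists i, j; split=> // z.
    by move/(in_sq_sub (ltW s'0))/sub.
  move: big; rewrite contour_split ?ltW//; last by move=> z /sub/fc.
  have := small false false; have := small false true.
  have := small true false; have := small true true.
  rewrite !mul0r !mul1r !addr0 => h11 h10 h01 h00; apply/negP; rewrite -leNgt.
  have -> : W x' y' s' = W x' y' (s' / 2) + W (x' + s' / 2) y' (s' / 2) +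
      (W x' (y' + s' / 2) (s' / 2) + W (x' + s' / 2) (y' + s' / 2) (s' / 2)).
    rewrite /W /sqmass !halfD.
    have -> : s' ^+ 2 = 4 * (s' / 2) ^+ 2 by field.
    by ring.
  rewrite [leRHS]mulrDr; apply: le_trans (le_normcD _ _) _.
  by apply: lerD; rewrite [leRHS]mulrDr;
    apply: le_trans (le_normcD _ _) _; apply: lerD.
have [zp|zp] := eqVneq z p.
  have /ccontP/(_ (e / 8))[|d d0 dP] := fc _ zin; first by rewrite divr_gt0.
  have [|x' [y' [s' [s'0 s'd zin' [sub]]]]] := zP (d / 2); first by rewrite divr_gt0.
  apply/negP; rewrite -leNgt.
  apply: (@le_trans _ _ (8 * (e / 8) * s')).
    apply: (@contour_near_affine f 0 (f z) _ _ _ _ (ltW s'0)) => w win.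
      exact: (fc _ (sub _ win)).
    rewrite mul0r add0r ltW//; apply: dP.
    apply: le_lt_trans (in_sq_dist zin' win) _.
    by rewrite mulrC -ltr_pdivlMr.
  have -> : 8 * (e / 8) * s' = e * s' by field.
  rewrite ler_pM2l//; rewrite zp in zin'.
  apply: le_trans (sqmass_center (ltW s'0) zin') _.
  by rewrite lerDr exprn_ge0// ltW.
have [phi pc fE] := fd _ zin zp.
have /ccontP/(_ (e / 16))[|d d0 dP] := pc; first by rewrite divr_gt0.
have [|x' [y' [s' [s'0 s'd zin' [sub]]]]] := zP (d / 2); first by rewrite divr_gt0.
apply/negP; rewrite -leNgt.
apply: (@le_trans _ _ (8 * (e / 16 * (2 * s')) * s')).
  apply: (@contour_near_affine f (phi z) (f z - phi z * z) _ _ _ _ (ltW s'0)) => w win.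
    exact: (fc _ (sub _ win)).
  have -> : f w - (phi z * w + (f z - phi z * z)) = (phi w - phi z) * (w - z).
    by rewrite (fE w); ring.
  have wz := in_sq_dist zin' win.
  rewrite normcM ler_pM ?normc_ge0// ltW//; apply: dP.
  by apply: le_lt_trans wz _; rewrite mulrC -ltr_pdivlMr.
have -> : 8 * (e / 16 * (2 * s')) * s' = e * s' ^+ 2 by field.
by rewrite ler_pM2l// lerDl sqmass_ge0// ltW.
Qed.

End Goursat.

(** * Cauchy transforms on the unit square *)

Section Cauchy.
Variable R : realType.
Local Notation C := R[i].
Local Notation Re := (@complex.Re R).
Local Notation Im := (@complex.Im R).
Local Notation ii := (0 +i* 1)%C.
Implicit Types (f g : C -> C) (a b z w : C).

Lemma cdiff_local f a phi (d : R) : 0 < d -> ccont phi a ->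
  (forall w, normc (w - a) < d -> f w = f a + phi w * (w - a)) -> cdiff f a.
Proof.
move=> d0 pc fE; apply: (@cdiff_eq _ (fun w => f a + phi w * (w - a)) _ _ d) => //.
  by move=> w /fE.
by exists phi => // w; rewrite subrr mulr0 addr0.
Qed.

Lemma cint_Re_ge phi (a b K : R) : a <= b -> cts_on phi a b ->
  (forall x, a <= x <= b -> K <= Re (phi x)) -> K * (b - a) <= Re (cint phi a b).
Proof.
move=> ab h hK; have h1 := cts_Re h; rewrite /cint /=.
have st : \int[lebesgue_measure]_(x in `[a, b]) (fun=> K) x <=
    \int[lebesgue_measure]_(x in `[a, b]) Re (phi x).
  apply: le_Rintegral => //=.
  by apply: cts_integrable => x _; exact: cst_continuous.
suff <- : \int[lebesgue_measure]_(x in `[a, b]) (fun=> K) x = K * (b - a) by exact: st.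
rewrite Rintegral_cst//= lebesgue_measure_itv/= lte_fin.
by case: ltgtP ab => // <-; rewrite ?subrr ?mulr0.
Qed.

Local Notation hf := (2^-1 : R).
Definition unit_sq z := in_sq (- hf) (- hf) 1 z.
Definition unit_bd z := bd_sq (- hf) (- hf) 1 z.

Lemma unit_sqP z : unit_sq z = (- hf <= Re z <= hf) && (- hf <= Im z <= hf).
Proof. by rewrite /unit_sq /in_sq (_ : - hf + 1 = hf)//; field. Qed.

Lemma unit_sq_disc z : unit_sq z -> normc z < 1.
Proof.
rewrite unit_sqP; case: z => u v /= /andP[/andP[h1 h2] /andP[h3 h4]].
rewrite -(@sqrtr1 R) ltr_sqrt//.
have e : hf = 1 / 2 by field.
rewrite e in h1 h2 h3 h4.
have uu : 0 <= (1 / 2 - u) * (1 / 2 + u) by apply: mulr_ge0; lra.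
have vv : 0 <= (1 / 2 - v) * (1 / 2 + v) by apply: mulr_ge0; lra.
by nra.
Qed.

Lemma unit_bd_sq z : unit_bd z -> unit_sq z.
Proof. exact: bd_in. Qed.

Lemma unit_bd_disc z : unit_bd z -> normc z < 1.
Proof. by move/unit_bd_sq/unit_sq_disc. Qed.

Lemma unit_bd_norm z : unit_bd z -> hf <= normc z.
Proof.
move=> /andP[_]; rewrite (_ : - hf + 1 = hf); last by field.
have n0 : 0 <= hf by rewrite invr_ge0.
case/or4P => /eqP e.
- by apply: le_trans (normr_Re _); rewrite e normrN ger0_norm.
- by apply: le_trans (normr_Re _); rewrite e ger0_norm.
- by apply: le_trans (normr_Im _); rewrite e normrN ger0_norm.
- by apply: le_trans (normr_Im _); rewrite e ger0_norm.
Qed.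

Local Notation qt := (4^-1 : R).

Lemma unit_bd_dist a z : normc a < qt -> unit_bd z -> qt <= normc (z - a).
Proof.
move=> aq /unit_bd_norm zh; have := le_normcD (z - a) a; rewrite subrK.
have : hf = qt + qt by field.
by move: zh aq; move: (normc _) (normc _) (normc _) hf qt => u v w h q; lra.
Qed.

Lemma unit_bd_neq a z : normc a < qt -> unit_bd z -> z - a != 0.
Proof.
by move=> aq /(unit_bd_dist aq) h; rewrite -normc_gt0 (lt_le_trans _ h)// invr_gt0.
Qed.

Definition bnice f (K : R) :=
  (forall z, unit_bd z -> ccont f z) /\ (forall z, unit_bd z -> normc (f z) <= K).

(** The Cauchy transform without the factor 1 / (2 i pi); normalization is by
[winding], which does not vanish by [winding_ge]. *)
Definition cauchyN f a := contour (fun z => f z * (z - a)^-1) (- hf) (- hf) 1.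

Lemma bnice_div f K a : normc a < qt -> bnice f K ->
  bnice (fun z => f z * (z - a)^-1) (K * 4).
Proof.
move=> aq [fc fK]; split=> z zb; have z0 := unit_bd_neq aq zb.
  apply: ccontM; first exact: fc.
  have h : ccont (fun w => w - a) z := ccontB (ccont_id z) (ccont_cst a z).
  exact: (@ccontV _ (fun w => w - a) z z0 h).
rewrite normcM normcV; apply: ler_pM; rewrite ?invr_ge0 ?normc_ge0 ?fK//.
rewrite -[leRHS]invrK lef_pV2 ?posrE ?invr_gt0 ?normc_gt0//.
exact: unit_bd_dist.
Qed.

Lemma bnice_cst (k : C) : bnice (fun=> k) (normc k).
Proof. by split=> z _ //; exact: ccont_cst. Qed.

Lemma cauchyN_bound f K a : normc a < qt -> bnice f K ->
  normc (cauchyN f a) <= 32 * K.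
Proof.
move=> aq fn; have [gc gK] := bnice_div aq fn.
have := contour_bound ler01 gc gK.
by rewrite mulr1 (_ : 8 * (K * 4) = 32 * K)//; ring.
Qed.

Lemma cauchyN_lin f g K K' k a : normc a < qt -> bnice f K -> bnice g K' ->
  cauchyN (fun z => k * f z + g z) a = k * cauchyN f a + cauchyN g a.
Proof.
move=> aq fn gn; have [fc _] := bnice_div aq fn; have [gc _] := bnice_div aq gn.
have kfc z : unit_bd z -> ccont (fun z => k * (f z * (z - a)^-1)) z.
  by move=> /fc h; exact: (ccontM (ccont_cst k z) h).
rewrite /cauchyN -(contourZ k ler01 fc) -(contourD ler01 kfc gc).
by apply: (eq_contour ler01) => z _; ring.
Qed.

(** The resolvent identity for the kernel. By [cauchyN_bound] the last factor is
bounded, so transforms are continuous; being itself a transform, that factor is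
then continuous, so transforms are differentiable. *)
Lemma cauchyN_diff f K a b : normc a < qt -> normc b < qt -> bnice f K ->
  cauchyN f a = cauchyN f b + (a - b) * cauchyN (fun z => f z * (z - b)^-1) a.
Proof.
move=> aq bq fn; have [fbc _] := bnice_div bq fn.
have [gc _] := bnice_div aq (bnice_div bq fn).
have kgc z : unit_bd z -> ccont (fun z => (a - b) * (f z * (z - b)^-1 * (z - a)^-1)) z.
  by move=> /gc h; exact: (ccontM (ccont_cst (a - b) z) h).
rewrite /cauchyN -(contourZ (a - b) ler01 gc) -(contourD ler01 fbc kgc).
apply: (eq_contour ler01) => z zb.
have za := unit_bd_neq aq zb; have zb' := unit_bd_neq bq zb.
by field; rewrite za zb'.
Qed.

Lemma cauchyN_ccont f K b : normc b < qt -> bnice f K -> ccont (cauchyN f) b.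
Proof.
move=> bq fn; apply/ccontP => e e0.
have K0 : 0 <= K.
  have [_ fK] := fn; have zb : unit_bd (hf +i* hf)%C.
    rewrite /unit_bd /bd_sq -/(unit_sq _) unit_sqP /= (_ : - hf + 1 = hf); last by field.
    by rewrite eqxx !orbT lexx; have : - hf <= hf; [|move=> ->]; rewrite ?ge0_cp ?invr_ge0.
  by apply: le_trans (fK _ zb); exact: normc_ge0.
exists (Num.min (qt - normc b) (e / (128 * K + 1))).
  by rewrite lt_min subr_gt0 bq divr_gt0// ltr_wpDl// mulr_ge0.
move=> a; rewrite lt_min => /andP[h1 h2].
have aq : normc a < qt.
  have := le_normcD (a - b) b; rewrite subrK => h.
  by apply: le_lt_trans h _; rewrite -ltrBrDr.
rewrite (cauchyN_diff aq bq fn) addrAC subrr add0r normcM.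
have := cauchyN_bound aq (bnice_div bq fn).
move: h2; rewrite ltr_pdivlMr ?ltr_wpDl ?mulr_ge0//.
move: (normc (a - b)) (normc (cauchyN _ _)) (normc_ge0 (a - b)) => u v u0 ue v0.
have : u * v <= u * (32 * (K * 4)) by rewrite ler_wpM2l.
by move: K0 u0 ue; nra.
Qed.

Lemma cauchyN_cdiff f K b : normc b < qt -> bnice f K -> cdiff (cauchyN f) b.
Proof.
move=> bq fn; apply: (@cdiff_local _ _ (cauchyN (fun z => f z * (z - b)^-1)) (qt - normc b)).
- by rewrite subr_gt0.
- exact: cauchyN_ccont bq (bnice_div bq fn).
- move=> a h; have aq : normc a < qt.
    have := le_normcD (a - b) b; rewrite subrK => h'.
    by apply: le_lt_trans h' _; rewrite -ltrBrDr.
  by rewrite (cauchyN_diff aq bq fn) mulrC.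
Qed.

Definition winding := cauchyN (fun=> 1).

(** [Re (k / w)] is the scalar product of [k] and [w] over [|w| ^ 2]. *)
Lemma Re_div_ge (k w : C) :
  qt <= Re k * Re w + Im k * Im w -> Re w ^+ 2 + Im w ^+ 2 <= 2 ->
  8^-1 <= Re (k * w^-1).
Proof.
case: w => u v; rewrite [Re (u +i* v)%C]/= [Im (u +i* v)%C]/= => kuv uv2; case: k kuv => k1 k2 /= kuv.
have uv0 : 0 < u ^+ 2 + v ^+ 2.
  rewrite lt_def addr_ge0 ?sqr_ge0// andbT paddr_eq0 ?sqr_ge0// !sqrf_eq0.
  apply/negP => /andP[/eqP u0 /eqP v0]; move: kuv; rewrite u0 v0 !mulr0 addr0.
  by rewrite leNgt invr_gt0 ltr0n.
have -> : k1 * (u / (u ^+ 2 + v ^+ 2)) - k2 * (- (v / (u ^+ 2 + v ^+ 2))) =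
  (k1 * u + k2 * v) / (u ^+ 2 + v ^+ 2) by field; rewrite gt_eqF.
rewrite ler_pdivlMr//; apply: le_trans kuv.
by rewrite -ler_pdivlMl ?invr_gt0// invrK (_ : 8 / 4 = 2 :> R)//; field.
Qed.

(** On each side, [Im (dz / (z - a))] is [Re (k / (z - a))] with [k] the outer
normal. As [a] keeps distance 1/4 from the side and [|z - a| ^ 2 <= 2], each
side contributes at least 1/8 to the imaginary part. *)
Lemma winding_ge a : normc a < qt -> hf <= normc (winding a).
Proof.
move=> aq; apply: le_trans (normr_Im _); apply: le_trans (ler_norm _).
have [gc _] := bnice_div aq (bnice_cst 1).
have [c1 c3 c4 c2] := contour_cts ler01 gc.
rewrite /winding /cauchyN /contour.
set I1 := cint _ _ _; set I2 := cint _ _ _; set I3 := cint _ _ _; set I4 := cint _ _ _.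
have -> : Im (I1 + ii * I2 - I3 - ii * I4) =
    Re (- ii * I1) + Re (1 * I2) + Re (ii * I3) + Re (-1 * I4).
  by case: I1 I2 I3 I4 => ? ? [? ?] [? ?] [? ?] /=; ring.
have e1 : - hf + 1 = hf by field.
rewrite /I1 /I2 /I3 /I4 e1.
have key (k : C) (phi : R -> C) : cts_on phi (- hf) hf ->
   cts_on (fun t => k * phi t) (- hf) hf ->
   (forall t, - hf <= t <= hf -> 8^-1 <= Re (k * phi t)) ->
   8^-1 <= Re (k * cint phi (- hf) hf).
  move=> pc kpc pk; rewrite -cintZ//.
  have -> : 8^-1 = 8^-1 * (hf - - hf) :> R by field.
  by apply: cint_Re_ge => //; rewrite ge0_cp ?invr_ge0.
have kc k z : unit_bd z -> ccont (fun z => k * (1 * (z - a)^-1)) z.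
  by move=> /gc h; exact: (ccontM (ccont_cst k z) h).
move: c1 c2 c3 c4; rewrite e1 => c1 c2 c3 c4.
have aRe := le_lt_trans (normr_Re a) aq; have aIm := le_lt_trans (normr_Im a) aq.
have e4 : hf = 8^-1 + 8^-1 + 8^-1 + 8^-1 by field.
have hq : hf = qt + qt by field.
rewrite ltr_norml in aRe; rewrite ltr_norml in aIm.
have q4 : qt = 1 / 4 by field.
have sq2 (u v : R) : - 1 <= u <= 1 -> - 1 <= v <= 1 -> u ^+ 2 + v ^+ 2 <= 2.
  have sq1 (w : R) : - 1 <= w <= 1 -> w ^+ 2 <= 1.
    move=> w1; have : 0 <= (1 - w) * (1 + w) by apply: mulr_ge0; lra.
    by nra.
  by move=> /sq1 ? /sq1 ?; lra.
rewrite [leLHS]e4; apply: lerD; [apply: lerD; [apply: lerD|]|]; apply: key => //.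
- by have [] := contour_cts ler01 (kc (- ii)); rewrite e1.
- move=> t tt; rewrite /hseg mul1r; apply: Re_div_ge; move: tt aRe aIm {aq gc I1 I2 I3 I4 c1 c2 c3 c4 kc}; case: a => x y /= *; [lra|apply: sq2; lra].
- by have [] := contour_cts ler01 (kc (1)); rewrite e1.
- move=> t tt; rewrite /vseg mul1r; apply: Re_div_ge; move: tt aRe aIm {aq gc I1 I2 I3 I4 c1 c2 c3 c4 kc}; case: a => x y /= *; [lra|apply: sq2; lra].
- by have [] := contour_cts ler01 (kc (ii)); rewrite e1.
- move=> t tt; rewrite /hseg mul1r; apply: Re_div_ge; move: tt aRe aIm {aq gc I1 I2 I3 I4 c1 c2 c3 c4 kc}; case: a => x y /= *; [lra|apply: sq2; lra].
- by have [] := contour_cts ler01 (kc (-1)); rewrite e1.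
- move=> t tt; rewrite /vseg mul1r; apply: Re_div_ge; move: tt aRe aIm {aq gc I1 I2 I3 I4 c1 c2 c3 c4 kc}; case: a => x y /= *; [lra|apply: sq2; lra].
Qed.

End Cauchy.

(** * Cauchy's formula and its consequences *)

Section CauchyConsequences.
Variable R : realType.
Local Notation C := R[i].
Local Notation hf := (2^-1 : R).
Local Notation qt := (4^-1 : R).
Implicit Types (f g : C -> C) (a b z w : C).

Definition hol_disc f := forall z, normc z < 1 -> cdiff f z.

Lemma qt_lt1 a : normc a < qt -> normc a < 1.
Proof. by move=> h; apply: lt_trans h _; rewrite invf_lt1 ?ltr1n. Qed.

Lemma qt_gt0 : normc (0 : C) < qt.
Proof. by rewrite normc0 invr_gt0. Qed.

(** The difference quotient of [f] at [a] is differentiable off [a] and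
continuous at [a], so its contour integral vanishes by [goursat]. *)
Lemma cauchy_formula f (M : R) a : hol_disc f -> bnice f M -> normc a < qt ->
  winding a * f a = cauchyN f a.
Proof.
move=> fh fn aq; have [phi pc fE] := fh _ (qt_lt1 aq).
have phiE w : w != a -> phi w = (f w - f a) * (w - a)^-1.
  by move=> wa; rewrite (fE w) addrAC subrr add0r mulfK// subr_eq0.
have pd w : unit_sq w -> w != a -> cdiff phi w.
  move=> wQ wa.
  have wa0 : 0 < normc (w - a) by rewrite normc_gt0 subr_eq0.
  have h1 : cdiff (fun w => f w - f a) w.
    exact: (cdiffB (fh _ (unit_sq_disc wQ)) (cdiff_cst (f a) w)).
  have h2 : cdiff (fun w => w - a) w := cdiffB (cdiff_id w) (cdiff_cst a w).
  have wa' : w - a != 0 by rewrite subr_eq0.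
  apply: (cdiff_eq wa0 _ (cdiffM h1 (@cdiffV _ (fun w => w - a) w wa' h2))) => v vw.
  rewrite phiE//; apply: contraTneq vw => ->.
  by rewrite normcB ltxx.
have pcc w : unit_sq w -> ccont phi w.
  by move=> wQ; have [->//|wa] := eqVneq w a; apply: cdiff_ccont; exact: pd.
have h0 := goursat ltr01 pcc pd.
have e1 := cauchyN_lin (- f a) aq (bnice_cst 1) fn.
have e2 : cauchyN (fun z => - f a * 1 + f z) a = contour phi (- hf) (- hf) 1.
  apply: (eq_contour ler01) => z zb.
  by rewrite phiE ?mulr1 1?addrC// -subr_eq0; exact: unit_bd_neq aq zb.
move: e1; rewrite e2 h0 => /esym/eqP.
by rewrite mulNr addrC subr_eq0 mulrC => /eqP ->.
Qed.

Lemma winding_neq0 a : normc a < qt -> winding a != 0.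
Proof.
by move=> /winding_ge h; rewrite -normc_gt0 (lt_le_trans _ h)// invr_gt0.
Qed.

Lemma bnice_hol f (M : R) : hol_disc f -> (forall z, normc z < 1 -> normc (f z) <= M) ->
  bnice f M.
Proof.
by move=> fh fM; split=> z /unit_bd_disc z1; [apply: cdiff_ccont; exact: fh|exact: fM].
Qed.

(** At least 2 * 32 * 32 * 4 * 4, where 32 comes from [cauchyN_bound], and each 4
bounds a kernel or the inverse of the product of two winding integrals. *)
Definition dquot_const : R := 256 * 256.

Lemma dquot_const_gt0 : 0 < dquot_const.
Proof. by rewrite mulr_gt0. Qed.

(** [(f a - f 0) / a] after substituting Cauchy's formula for [f a] and [f 0] and
cancelling [a] with [cauchyN_diff]; it makes sense, and is differentiable, at
[a = 0]. *)
Definition quot_formula f a :=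
  (winding 0 * cauchyN (fun z => f z * (z - 0)^-1) a -
   cauchyN f 0 * cauchyN (fun z => 1 * (z - 0)^-1) a) * (winding a * winding 0)^-1.

Lemma quot_formulaP f (M : R) a : hol_disc f -> bnice f M -> normc a < qt ->
  f a = f 0 + quot_formula f a * a.
Proof.
move=> fh fn aq; have a0 := winding_neq0 aq; have w0 := winding_neq0 qt_gt0.
have q0 := qt_gt0.
have fa : f a = cauchyN f a / winding a.
  by rewrite -(cauchy_formula fh fn aq) mulrC mulKf.
have f0 : f 0 = cauchyN f 0 / winding 0.
  by rewrite -(cauchy_formula fh fn q0) mulrC mulKf.
rewrite fa f0 /quot_formula (cauchyN_diff aq q0 fn).
have wE := cauchyN_diff aq q0 (bnice_cst 1).
rewrite subr0 -/(winding a) -/(winding 0) in wE *.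
by move: a0; rewrite wE => a0; field; rewrite a0 w0.
Qed.

Lemma quot_formula_cdiff f (M : R) a : bnice f M -> normc a < qt ->
  cdiff (quot_formula f) a.
Proof.
move=> fn aq; have q0 := qt_gt0.
have h1 := cauchyN_cdiff aq (bnice_div q0 fn).
have h2 := cauchyN_cdiff aq (bnice_div q0 (bnice_cst 1)).
have h3 : cdiff (@winding R) a := cauchyN_cdiff aq (bnice_cst 1).
have h4 := cdiffM (cdiff_cst (winding 0) a) h1.
have h5 := cdiffM (cdiff_cst (cauchyN f 0) a) h2.
have h6 := cdiffM h3 (cdiff_cst (winding 0) a).
have n0 : winding a * winding 0 != 0 by rewrite mulf_neq0 ?winding_neq0.
have h7 := @cdiffV _ (fun w => winding w * winding 0) a n0 h6.
exact: cdiffM (cdiffB h4 h5) h7.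
Qed.

Lemma quot_formula_bound f (M : R) a : 0 <= M -> bnice f M -> normc a < qt ->
  normc (quot_formula f a) <= dquot_const * M.
Proof.
move=> M0 fn aq; have q0 := qt_gt0.
have b1 := cauchyN_bound aq (bnice_div q0 fn).
have := cauchyN_bound aq (bnice_div q0 (bnice_cst 1)).
have := cauchyN_bound q0 (bnice_cst 1); rewrite normc1 -/(winding 0) => b2 b3.
have b4 := cauchyN_bound q0 fn.
have w1 := winding_ge aq; have w2 := winding_ge q0.
rewrite normcM normcV normcM.
have num : normc (winding 0 * cauchyN (fun z => f z * (z - 0)^-1) a -
   cauchyN f 0 * cauchyN (fun z => 1 * (z - 0)^-1) a) <=
   32 * 1 * (32 * (M * 4)) + 32 * M * (32 * (1 * 4)).
  apply: le_trans (ler_normcB _ _) _; rewrite !normcM.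
  by apply: lerD; apply: ler_pM; rewrite ?normc_ge0.
have den : (normc (winding a) * normc (@winding R 0))^-1 <= 4.
  rewrite -[leRHS]invrK lef_pV2 ?posrE ?invr_gt0 ?mulr_gt0 ?normc_gt0 ?winding_neq0//.
  by rewrite (_ : qt = hf * hf) ?ler_pM ?invr_ge0//; field.
have d0 : 0 <= (normc (winding a) * normc (@winding R 0))^-1.
  by rewrite invr_ge0 mulr_ge0 ?normc_ge0.
have := ler_pM (normc_ge0 _) d0 num den; move=> h; apply: (le_trans h); rewrite /dquot_const; lra.
Qed.

Lemma dquot_formula f (M : R) a : hol_disc f -> bnice f M -> normc a < qt ->
  dquot f a = quot_formula f a.
Proof.
move=> fh fn aq; have f0 : cdiff f 0 by apply: fh; rewrite normc0.
have [dc dE] := dquotP f0.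
have off w : normc w < qt -> w != 0 -> dquot f w = quot_formula f w.
  move=> wq w0; apply: (mulIf w0); apply: (addrI (f 0)).
  by rewrite -dE (quot_formulaP fh fn wq).
have [->|a0] := eqVneq a 0; last exact: off.
have q0 : 0 < qt by rewrite invr_gt0.
apply: (ccont_uniq q0 dc (cdiff_ccont (quot_formula_cdiff fn qt_gt0))) => w w0.
by rewrite subr0 => wq; exact: off.
Qed.

(** Near 0 by [quot_formula], elsewhere as a quotient. *)
Theorem hol_dquot f (M : R) : hol_disc f -> (forall z, normc z < 1 -> normc (f z) <= M) ->
  hol_disc (dquot f).
Proof.
move=> fh fM z z1; have f0 : cdiff f 0 by apply: fh; rewrite normc0.
have [->|z0] := eqVneq z 0; last by apply: cdiff_dquot_off => //; exact: fh.
have fn := bnice_hol fh fM.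
have q0 : 0 < qt by rewrite invr_gt0.
apply: (cdiff_eq q0 _ (quot_formula_cdiff fn qt_gt0)) => w.
by rewrite subr0 => wq; rewrite (dquot_formula fh fn wq).
Qed.

(** For [|z| >= 1/4] the quotient is at most [2 M * 4]; nearer to 0 the bound comes
from [quot_formula]. *)
Theorem dquot_bound f (M : R) z : hol_disc f ->
  (forall z, normc z < 1 -> normc (f z) <= M) -> normc z < 1 ->
  normc (dquot f z) <= dquot_const * M.
Proof.
move=> fh fM z1; have f0 : cdiff f 0 by apply: fh; rewrite normc0.
have n01 : normc (0 : C) < 1 by rewrite normc0.
have M0 : 0 <= M by apply: le_trans (fM _ n01); exact: normc_ge0.
have fn := bnice_hol fh fM.
have [zq|qz] := ltP (normc z) qt.
  by rewrite (dquot_formula fh fn zq); exact: quot_formula_bound.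
have z0 : z != 0 by rewrite -normc_gt0 (lt_le_trans _ qz)// invr_gt0.
rewrite dquot_off// normcM normcV.
have h1 : normc (f z - f 0) <= M + M.
  by apply: le_trans (ler_normcB _ _) _; apply: lerD; exact: fM.
have h2 : (normc z)^-1 <= 4.
  by rewrite -[leRHS]invrK lef_pV2 ?posrE ?invr_gt0 ?normc_gt0.
have h3 : 0 <= (normc z)^-1 by rewrite invr_ge0 normc_ge0.
have h4 := ler_pM (normc_ge0 _) h3 h1 h2; apply: (le_trans h4); rewrite /dquot_const; lra.
Qed.

Lemma eq_of_small (u v : C) (K : R) : (forall e : R, 0 < e -> normc (u - v) <= K * e) -> u = v.
Proof.
move=> h; apply/eqP; rewrite -subr_eq0 -[_ == 0]negbK -normc_gt0; apply/negP => p.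
have K0 : 0 < K by have := h 1 ltr01; rewrite mulr1; exact: lt_le_trans.
have := h (normc (u - v) / (2 * K)); rewrite divr_gt0 ?mulr_gt0// => /(_ erefl).
rewrite (_ : K * _ = normc (u - v) / 2); last by field; rewrite gt_eqF.
by rewrite leNgt ltr_pdivrMr// mulr_natr mulr2n ltrDl p.
Qed.

(** Uniform limits on the disc of holomorphic functions bounded by [M]. *)
Definition hol_approx f (M : R) := forall e : R, 0 < e ->
  exists g, [/\ hol_disc g, (forall z, normc z < 1 -> normc (g z) <= M) &
     forall z, normc z < 1 -> normc (f z - g z) <= e].

Lemma hol_approx_ccont f (M : R) z : hol_approx f M -> normc z < 1 -> ccont f z.
Proof.
move=> fa z1; apply/ccontP => e e0.
have [|g [gh gM fg]] := fa (e / 4); first by rewrite divr_gt0.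
have /ccontP/(_ (e / 4)) := cdiff_ccont (gh _ z1).
rewrite divr_gt0// => /(_ erefl)[d d0 dP].
exists (Num.min d (1 - normc z)); first by rewrite lt_min d0 subr_gt0.
move=> w; rewrite lt_min => /andP[/dP h1 h2].
have w1 : normc w < 1.
  by have := le_normcD (w - z) z; rewrite subrK => h; apply: le_lt_trans h _; rewrite -ltrBrDr.
have -> : f w - f z = (f w - g w) + ((g w - g z) - (f z - g z)) by ring.
apply: le_lt_trans (le_normcD _ _) _.
have h3 := ler_normcB (g w - g z) (f z - g z); have h4 := fg _ w1; have h5 := fg _ z1.
have e4 : e = e / 4 + e / 4 + e / 4 + e / 4 by field.
by move: e4 h1 h3 h4 h5; move: (e / 4) => q; lra.
Qed.

(** Cauchy's formula passes to the limit, and its right-hand side is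
differentiable. *)
Lemma hol_approx_cdiff0 f (M : R) : hol_approx f M -> cdiff f 0.
Proof.
move=> fa; have q0 := qt_gt0.
have fn : bnice f (M + 1).
  split=> z /unit_bd_disc z1; first exact: hol_approx_ccont fa z1.
  have [g [gh gM fg]] := fa 1 ltr01; rewrite -[f z](subrK (g z)) addrC.
  by apply: le_trans (le_normcD _ _) _; apply: lerD; [exact: gM|exact: fg].
have form a : normc a < qt -> winding a * f a = cauchyN f a.
  move=> aq; apply: (@eq_of_small _ _ 64) => e e0.
  have [g [gh gM fg]] := fa e e0; have gn := bnice_hol gh gM.
  have dn : bnice (fun z => -1 * g z + f z) e.
    split=> z /unit_bd_disc z1; last by rewrite mulN1r addrC; exact: fg.
    exact: (ccontD (ccontM (ccont_cst (-1) z) (cdiff_ccont (gh _ z1))) (hol_approx_ccont fa z1)).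
  have -> : winding a * f a - cauchyN f a =
     winding a * (f a - g a) - cauchyN (fun z => -1 * g z + f z) a.
    rewrite (cauchyN_lin (-1) aq gn fn) -(cauchy_formula gh gn aq); ring.
  apply: le_trans (ler_normcB _ _) _.
  rewrite (_ : 64 * e = 32 * 1 * e + 32 * e); last by ring.
  apply: lerD; last exact: cauchyN_bound.
  rewrite normcM; apply: ler_pM; rewrite ?normc_ge0 ?fg ?qt_lt1//.
  by have := cauchyN_bound aq (bnice_cst 1); rewrite normc1.
have h1 := cauchyN_cdiff q0 fn.
have h2 : cdiff (@winding R) 0 := cauchyN_cdiff q0 (bnice_cst 1).
have h3 := @cdiffV _ _ _ (winding_neq0 q0) h2.
have p0 : 0 < qt by rewrite invr_gt0.
apply: (cdiff_eq p0 _ (cdiffM h1 h3)) => w; rewrite subr0 => wq.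
by rewrite -form// mulrC mulKf// winding_neq0.
Qed.

(** Differentiability at any [b] reduces to the centre, by rescaling the disc of
radius [1 - |b|] around [b]. *)
Theorem hol_approx_hol f (M : R) : hol_approx f M -> hol_disc f.
Proof.
move=> fa b b1; pose r := (1 - normc b)%:C%C : C.
have r0 : 0 < 1 - normc b by rewrite subr_gt0.
have rn : normc r = 1 - normc b by rewrite normc_real// ltW.
have rz : r != 0 by rewrite -normc_gt0 rn.
have inD w : normc w < 1 -> normc (b + r * w) < 1.
  move=> w1; apply: le_lt_trans (le_normcD _ _) _; rewrite normcM rn.
  by rewrite -ltrBrDl gtr_pMr.
have h : cdiff (fun w => f (b + r * w)) 0.
  apply: (@hol_approx_cdiff0 _ M) => e e0; have [g [gh gM fg]] := fa e e0.
  exists (fun w => g (b + r * w)); split.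
  - by move=> z z1; apply: cdiff_affine; apply: gh; exact: inD.
  - by move=> z z1; apply: gM; exact: inD.
  - by move=> z z1; apply: fg; exact: inD.
have e0 : - (b / r) + r^-1 * b = 0 by rewrite mulrC addNr.
rewrite -e0 in h.
have h2 := @cdiff_affine _ (fun w => f (b + r * w)) (- (b / r)) r^-1 b h.
apply: (cdiff_eq ltr01 _ h2) => w _; congr f.
by rewrite mulrDr mulrN mulrC divfK// addrA subrr add0r mulVKf.
Qed.

End CauchyConsequences.

#[global] Opaque dquot_const.
Arguments dquot_const {R}.

(** * Gleason's identity on the polydisc *)

Section Gleason.
Variables (R : realType) (N : nat).
Local Notation C := R[i].
Local Notation pt := ('I_N -> C).
Implicit Types (f g : pt -> C) (z : pt) (k j : 'I_N) (M : R).

Definition upd z k (l : C) : pt := fun i => if i == k then l else z i.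
(** The path from [z] to the origin that kills the coordinates one by one. *)
Definition trunc (m : nat) z : pt := fun i => if (i < m)%N then 0 else z i.
Definition polydisc z := forall i, normc (z i) < 1.

Lemma upd_polydisc z k l : polydisc z -> normc l < 1 -> polydisc (upd z k l).
Proof. by move=> zD l1 i; rewrite /upd; case: eqP. Qed.

Lemma trunc_polydisc m z : polydisc z -> polydisc (trunc m z).
Proof. by move=> zD i; rewrite /trunc; case: ifP; rewrite ?normc0. Qed.

(** Separate holomorphy, together with a bound, because both must survive the
shifts. *)
Definition hol_poly f M := (forall z, polydisc z -> normc (f z) <= M) /\
  forall z, polydisc z -> forall k, hol_disc (fun l => f (upd z k l)).

Definition slice f k z := fun l : C => f (upd (trunc k z) k l).
(** The variables before [k] are set to 0 so that the increments of [f] telescope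
in [gleason]. *)
Definition shift k f : pt -> C := fun z => dquot (slice f k z) (z k).

Lemma slice_hol f M k z : hol_poly f M -> polydisc z -> hol_disc (slice f k z).
Proof. by move=> [_ fh] zD; apply: fh; exact: trunc_polydisc. Qed.

Lemma slice_bound f M k z l : hol_poly f M -> polydisc z -> normc l < 1 ->
  normc (slice f k z l) <= M.
Proof.
by move=> [fM _] zD l1; apply: fM; apply: upd_polydisc => //; exact: trunc_polydisc.
Qed.

Lemma hol_disc0 (s : C -> C) : hol_disc s -> cdiff s 0.
Proof. by move=> h; apply: h; rewrite normc0 ltr01. Qed.

Lemma hol_disc_eq (s t : C -> C) : (forall l, normc l < 1 -> s l = t l) ->
  hol_disc s -> hol_disc t.
Proof.
move=> st sh l l1; have d0 : 0 < 1 - normc l by rewrite subr_gt0.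
apply: (cdiff_eq d0 _ (sh _ l1)) => w h; apply: st.
by have := le_normcD (w - l) l; rewrite subrK => h'; apply: le_lt_trans h' _; rewrite -ltrBrDr.
Qed.

(** The second difference quotient is bounded, so the first one is Lipschitz at
0 with a constant that depends on the bound of [s] only. *)
Lemma dquot_step (s : C -> C) M (l : C) : hol_disc s ->
  (forall w : C, normc w < 1 -> normc (s w) <= M) -> normc l < 1 ->
  normc (dquot s 0 - dquot s l) <= dquot_const * (dquot_const * M) * normc l.
Proof.
move=> sh sM l1; have qh := hol_dquot sh sM.
have qb (w : C) := @dquot_bound _ _ _ w sh sM.
have [_ e] := dquotP (hol_disc0 qh).
rewrite (e l) opprD addrA subrr sub0r normcN normcM.
apply: ler_wpM2r; first exact: normc_ge0.
exact: dquot_bound.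
Qed.

(** In a variable j < k the shift is constant, and for j = k it is a difference
quotient. For j > k it is a combination of slices of [f] divided by [z k]; when
[z k = 0] it is the limit of such combinations with [z k] replaced by a small
[a], and by [dquot_step] this limit is uniform. *)
Lemma shift_hol k f M : hol_poly f M -> hol_poly (shift k f) (dquot_const * M).
Proof.
move=> fH; split=> [z zD|z zD j].
  by apply: dquot_bound => //; [exact: slice_hol fH zD|move=> l; exact: slice_bound fH zD].
have [jk|kj|/val_inj jk] := ltngtP j k.
- apply: (@hol_disc_eq (fun=> shift k f z)); last by move=> l _; exact: cdiff_cst.
  move=> l l1; rewrite /shift; congr dquot; last first.
    by rewrite /upd; case: eqP jk => // ->; rewrite ltnn.
  apply/funext => m; rewrite /slice; congr f; apply/funext => i.
  rewrite /upd /trunc; case: eqP => // _; case: ifP => // ik.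
  by case: eqP => // ij; rewrite ij jk in ik.
- pose S l m := f (upd (upd (trunc k z) k m) j l).
  have SE l : slice f k (upd z j l) = S l.
    apply/funext => m; rewrite /slice /S; congr f; apply/funext => i.
    rewrite /upd /trunc; case: eqP => [->|ik].
      by case: eqP => // e; rewrite e ltnn in kj.
    by case: eqP => // ->; rewrite ltnNge ltnW.
  have zk l : (upd z j l) k = z k.
    by rewrite /upd; case: eqP => // e; rewrite e ltnn in kj.
  apply: (@hol_disc_eq (fun l => dquot (S l) (z k))).
    by move=> l _; rewrite /shift SE zk.
  have Sh l : normc l < 1 -> hol_disc (S l).
    by move=> l1; rewrite -SE; apply: slice_hol fH _; exact: upd_polydisc.
  have SM l : normc l < 1 -> forall m, normc m < 1 -> normc (S l m) <= M.
    by move=> l1 m m1; rewrite -SE; apply: slice_bound fH _ m1; exact: upd_polydisc.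
  (* for a fixed nonzero argument the quotient is a combination of two slices *)
  have off a : normc a < 1 -> a != 0 -> hol_disc (fun l => dquot (S l) a).
    move=> a1 a0; apply: (@hol_disc_eq (fun l => (S l a - S l 0) * a^-1)).
      by move=> l l1; rewrite dquot_off//; exact/hol_disc0/Sh.
    have [_ fh] := fH; have tD := trunc_polydisc k zD.
    have n0 : normc (0 : C) < 1 by rewrite normc0 ltr01.
    have h1 := fh _ (upd_polydisc k tD a1) j; have h2 := fh _ (upd_polydisc k tD n0) j.
    move=> l l1; exact: cdiffM (cdiffB (h1 _ l1) (h2 _ l1)) (cdiff_cst _ _).
  have [zk0|zk0] := eqVneq (z k) 0; last exact: off.
  rewrite zk0; apply: (@hol_approx_hol _ _ (dquot_const * M)) => e e0.
  pose K := dquot_const * (dquot_const * M).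
  have M0 : 0 <= M by have [fM _] := fH; exact: le_trans (normc_ge0 _) (fM _ zD).
  have K0 : 0 <= K by rewrite !mulr_ge0// ltW// dquot_const_gt0.
  (* small enough for the Lipschitz bound of dquot_step to give e *)
  pose a := Num.min (2^-1) (e / (K + 1)).
  have a0 : 0 < a by rewrite lt_min invr_gt0 ltr0n divr_gt0// ltr_wpDl.
  have a1 : a < 1 by rewrite gt_min invf_lt1 ?ltr1n.
  have ae : K * a <= e.
    apply: (@le_trans _ _ ((K + 1) * (e / (K + 1)))); last first.
      by rewrite mulrC divfK// gt_eqF// ltr_wpDl.
    by apply: ler_pM; rewrite ?(ltW a0) ?lerDl// ge_min lexx orbT.
  have an : normc a%:C%C = a by rewrite normc_real// ltW.
  have an1 : normc a%:C%C < 1 by rewrite an.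
  exists (fun l => dquot (S l) a%:C%C); split.
  - by apply: off; rewrite // -normc_gt0 an.
  - by move=> l l1; apply: dquot_bound an1; [exact: Sh|exact: SM].
  - move=> l l1; apply: le_trans (dquot_step (Sh _ l1) (SM _ l1) an1) _.
    by rewrite an.
- rewrite jk; apply: (@hol_disc_eq (dquot (slice f k z))).
    move=> l l1; rewrite /shift; congr dquot; last by rewrite /upd eqxx.
    apply/funext => m; rewrite /slice; congr f; apply/funext => i.
    by rewrite /upd /trunc; case: eqP.
  by apply: hol_dquot; [exact: slice_hol fH zD|move=> l; exact: slice_bound fH zD].
Qed.

Lemma shift_lin k f g M M' (c : C) z : hol_poly f M -> hol_poly g M' -> polydisc z ->
  shift k (fun z => c * f z + g z) z = c * shift k f z + shift k g z.
Proof.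
move=> fH gH zD; rewrite /shift.
have e := dquotD (hol_disc0 (slice_hol k fH zD)) (hol_disc0 (slice_hol k gH zD)) c.
exact: (congr1 (fun h => h (z k)) e).
Qed.

(** [z k * shift k f z] is the increment of [f] between consecutive truncations of
[z], so the sum telescopes. *)
Lemma gleason f M z : hol_poly f M -> polydisc z ->
  f z = f (fun=> 0) + \sum_(k < N) z k * shift k f z.
Proof.
move=> fH zD.
have step k : z k * shift k f z = f (trunc k z) - f (trunc k.+1 z).
  have [_ e] := dquotP (hol_disc0 (slice_hol k fH zD)).
  rewrite mulrC; apply: (addrI (slice f k z 0)); rewrite -e /slice.
  have -> : upd (trunc k z) k (z k) = trunc k z.
    by apply/funext => i; rewrite /upd /trunc; case: eqP => // ->; rewrite ltnn.
  have -> : upd (trunc k z) k 0 = trunc k.+1 z.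
    apply/funext => i; rewrite /upd /trunc ltnS [in RHS]leq_eqVlt.
    rewrite (_ : (nat_of_ord i == nat_of_ord k) = (i == k))//.
    by case: eqP.
  by rewrite addrC subrK.
rewrite (eq_bigr (fun k : 'I_N => - (f (trunc k.+1 z) - f (trunc k z)))); last first.
  by move=> k _; rewrite step opprB.
rewrite sumrN -(big_mkord xpredT (fun m : nat => f (trunc m.+1 z) - f (trunc m z))).
rewrite telescope_sumr//.
have -> : trunc 0 z = z by apply/funext => i; rewrite /trunc ltn0.
have -> : trunc N z = fun=> 0 by apply/funext => i; rewrite /trunc ltn_ord.
by rewrite opprB addrC subrK.
Qed.

Definition shifts (v : seq 'I_N) f : pt -> C := foldl (fun f k => shift k f) f v.

Lemma shifts_rcons v k f : shifts (rcons v k) f = shift k (shifts v f).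
Proof. by rewrite /shifts foldl_rcons. Qed.

Lemma shifts_hol v f M : hol_poly f M -> hol_poly (shifts v f) ((dquot_const) ^+ size v * M).
Proof.
move=> fH; elim/last_ind: v => [|v k IH]; first by rewrite expr0 mul1r.
by rewrite shifts_rcons size_rcons exprS -mulrA; exact: shift_hol.
Qed.

Lemma hol_poly_lin f g M M' (c : C) : hol_poly f M -> hol_poly g M' ->
  hol_poly (fun z => c * f z + g z) (normc c * M + M').
Proof.
move=> [fM fh] [gM gh]; split=> [z zD|z zD k l l1].
  apply: le_trans (le_normcD _ _) _; rewrite normcM; apply: lerD; last exact: gM.
  by apply: ler_wpM2l; [exact: normc_ge0|exact: fM].
exact: cdiffD (cdiffM (cdiff_cst c l) (fh _ zD k _ l1)) (gh _ zD k _ l1).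
Qed.

Lemma hol_poly_ext f g M : (forall z, polydisc z -> f z = g z) ->
  hol_poly f M -> hol_poly g M.
Proof.
move=> fg [fM fh]; split=> [z zD|z zD k]; first by rewrite -fg//; exact: fM.
by apply: (hol_disc_eq _ (fh _ zD k)) => l l1; apply: fg; exact: upd_polydisc.
Qed.

Lemma shift_ext k f g M z : hol_poly f M -> polydisc z ->
  (forall z, polydisc z -> f z = g z) -> shift k f z = shift k g z.
Proof.
move=> fH zD fg; have gH := hol_poly_ext fg fH.
have sE l : normc l < 1 -> slice f k z l = slice g k z l.
  by move=> l1; apply: fg; apply: upd_polydisc => //; exact: trunc_polydisc.
have f0 := hol_disc0 (slice_hol k fH zD); have g0 := hol_disc0 (slice_hol k gH zD).
have off l : l != 0 -> normc l < 1 -> dquot (slice f k z) l = dquot (slice g k z) l.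
  by move=> l0 l1; rewrite !dquot_off// !sE// normc0 ltr01.
rewrite /shift; have [->|zk] := eqVneq (z k) 0; last exact: off.
have [fc _] := dquotP f0; have [gc _] := dquotP g0.
by apply: (ccont_uniq ltr01 fc gc) => w w0; rewrite subr0; exact: off.
Qed.

Lemma shifts_lin v f g M M' (c : C) z : hol_poly f M -> hol_poly g M' -> polydisc z ->
  shifts v (fun z => c * f z + g z) z = c * shifts v f z + shifts v g z.
Proof.
move=> fH gH; elim/last_ind: v z => [//|v k IH] z zD; rewrite !shifts_rcons.
rewrite -(shift_lin k c (shifts_hol v fH) (shifts_hol v gH) zD).
by apply: (shift_ext _ (shifts_hol v (hol_poly_lin c fH gH))) => // w; exact: IH.
Qed.

Lemma shifts_gleason v f M z : hol_poly f M -> polydisc z ->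
  shifts v f z = shifts v f (fun=> 0) + \sum_(k < N) z k * shifts (rcons v k) f z.
Proof.
move=> fH zD; rewrite (gleason (shifts_hol v fH) zD); congr (_ + _).
by apply: eq_bigr => k _; rewrite shifts_rcons.
Qed.

End Gleason.

(** * The Hilbert space of square-summable sequences *)

Section SqNorm.
Variables (R : realType) (H : hilbertType R).
Implicit Types x y : H.
Local Notation Re := (@complex.Re R).
Local Notation Im := (@complex.Im R).

Definition sqn x : R := Re (dotp x x).

Lemma sqnE x : dotp x x = (sqn x)%:C%C.
Proof. by rewrite /sqn RRe_real// ger0_real// dnorm_ge0. Qed.

Lemma sqn_ge0 x : 0 <= sqn x.
Proof. by rewrite -lecR -sqnE dnorm_ge0. Qed.

Lemma sqn_eq0 x : sqn x = 0 -> x = 0.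
Proof. by move=> h; apply/eqP; rewrite -(dnorm_eq0 dotp) sqnE h. Qed.

Lemma sqn0 : sqn 0 = 0.
Proof. by rewrite /sqn linear0l. Qed.

Lemma norm_sqn x : `|x| ^+ 2 = (sqn x)%:C%C.
Proof. by rewrite sqr_norm_dotp sqnE. Qed.

Lemma sqnD x y : sqn (x + y) = sqn x + sqn y + 2 * Re (dotp x y).
Proof.
rewrite /sqn linearDl !linearDr /= -(dotpC x y).
by case: (dotp x x) (dotp y y) (dotp x y) => ? ? [? ?] [? ?] /=; ring.
Qed.

Lemma sqnZ (a : R[i]) x : sqn (a *: x) = normc a ^+ 2 * sqn x.
Proof.
apply: complexI; rewrite -sqnE dnormZ sqnE rmorphM rmorphXn /=; congr (_ * _).
Qed.

Lemma dotp_suml (I : Type) (r : seq I) (f : I -> H) y :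
  dotp (\sum_(i <- r) f i) y = \sum_(i <- r) dotp (f i) y.
Proof.
by elim: r => [|i r IH]; rewrite ?big_nil ?linear0l// !big_cons linearDl /= IH.
Qed.

Lemma sqnN x : sqn (- x) = sqn x.
Proof. by rewrite -scaleN1r sqnZ normcN normc1 expr1n mul1r. Qed.

(** Expand the squared norms of [x + y] and [x - y]. *)
Lemma Re_dotp_le x y : 2 * `|Re (dotp x y)| <= sqn x + sqn y.
Proof.
have h1 := sqn_ge0 (x + y); have h2 := sqn_ge0 (x - y).
rewrite sqnD in h1; rewrite sqnD sqnN linearNr /= in h2.
have e : Re (- dotp x y) = - Re (dotp x y) by case: (dotp x y).
rewrite e in h2; case: ger0P => _; lra.
Qed.

Lemma Im_dotp_le x y : 2 * `|Im (dotp x y)| <= sqn x + sqn y.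
Proof.
have := Re_dotp_le x ((0 +i* 1)%C *: y); rewrite sqnZ.
have -> : normc (0 +i* 1 : R[i])%C = 1 by rewrite /= expr0n add0r expr1n sqrtr1.
have -> : Re (dotp x ((0 +i* 1)%C *: y)) = Im (dotp x y).
  by rewrite linearZr_LR /=; case: (dotp x y) => a b /=; ring.
by rewrite expr1n mul1r.
Qed.

Lemma sqnD_le x y : sqn (x + y) <= 2 * sqn x + 2 * sqn y.
Proof.
have h := Re_dotp_le x y; have h' := ler_norm (Re (dotp x y)).
rewrite sqnD; lra.
Qed.

End SqNorm.

Section L2.
Variables (R : realType) (H : hilbertType R).
Local Notation C := R[i].
Local Notation Re := (@complex.Re R).
Local Notation Im := (@complex.Im R).
Implicit Types x y : nat -> H.

Definition sqsummable : {pred nat -> H} := fun x =>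
  `[< exists B : R, forall n, \sum_(i < n) sqn (x i) <= B >].

Record l2 := L2 { l2_fun :> nat -> H; l2P : l2_fun \in sqsummable }.

HB.instance Definition _ := [isSub for l2_fun].
HB.instance Definition _ := [Choice of l2 by <:].

Fact sqsummable_submod_closed : submod_closed sqsummable.
Proof.
split=> [|a x y].
  by apply/asboolP; exists 0 => n; rewrite big1// => i _; rewrite sqn0.
move=> /asboolP[A xA] /asboolP[B yB]; apply/asboolP.
exists (2 * (normc a ^+ 2 * A) + 2 * B) => n.
apply: (@le_trans _ _ (\sum_(i < n) (2 * (normc a ^+ 2 * sqn (x i)) + 2 * sqn (y i)))).
  by apply: ler_sum => i _; rewrite -sqnZ; exact: sqnD_le.
rewrite big_split /= -!mulr_sumr; apply: lerD; apply: ler_wpM2l => //.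
  by apply: ler_wpM2l (xA n); exact: exprn_ge0 (normc_ge0 a).
exact: yB.
Qed.
HB.instance Definition _ :=
  GRing.isSubmodClosed.Build R[i] (nat -> H) sqsummable sqsummable_submod_closed.
HB.instance Definition _ := [SubChoice_isSubLmodule of l2 by <:].

Lemma l2_bound (x : l2) : exists B : R, forall n, \sum_(i < n) sqn (x i) <= B.
Proof. by have /asboolP := l2P x. Qed.

Lemma l2_eqP (x y : l2) : x =1 y <-> x = y.
Proof. by split=> [xy|->//]; apply/val_inj/funext. Qed.

Definition mk_l2 x (B : R) (xB : forall n, \sum_(i < n) sqn (x i) <= B) : l2 :=
  L2 (introT (asboolP _) (ex_intro _ B xB)).

Definition pdot x y (n : nat) : C := \sum_(i < n) dotp (x i) (y i).

Definition is_lim (u : nat -> C) (l : C) := forall e : R, 0 < e ->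
  exists n0, forall n, (n0 <= n)%N -> normc (u n - l) < e.

Lemma is_lim_uniq u l l' : is_lim u l -> is_lim u l' -> l = l'.
Proof.
move=> ul ul'; apply/eqP; rewrite -subr_eq0 -[_ == 0]negbK -normc_gt0.
apply/negP => p; have p2 : 0 < normc (l - l') / 2 by rewrite divr_gt0.
have [n n1] := ul _ p2; have [m m1] := ul' _ p2.
have h1 := n1 (maxn n m) (leq_maxl _ _); have h2 := m1 (maxn n m) (leq_maxr _ _).
have e : l - l' = (u (maxn n m) - l') - (u (maxn n m) - l) by ring.
have := ler_normcB (u (maxn n m) - l') (u (maxn n m) - l); rewrite -e; lra.
Qed.

Lemma is_lim_lin u v l m (a : C) : is_lim u l -> is_lim v m ->
  is_lim (fun n => a * u n + v n) (a * l + m).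
Proof.
move=> ul vm e e0.
have K0 : 0 < 2 * (normc a + 1) by rewrite mulr_gt0// ltr_wpDl// normc_ge0.
have e1 : 0 < e / (2 * (normc a + 1)) by rewrite divr_gt0.
have [n nP] := ul _ e1; have [k kP] := vm (e / 2) (divr_gt0 e0 (ltr0Sn _ 1)).
exists (maxn n k) => i; rewrite geq_max => /andP[/nP h1 /kP h2].
have -> : a * u i + v i - (a * l + m) = a * (u i - l) + (v i - m) by ring.
apply: le_lt_trans (le_normcD _ _) _; rewrite normcM.
have h3 : normc a * normc (u i - l) <= e / 2.
  apply: (@le_trans _ _ (normc a * (e / (2 * (normc a + 1))))).
    by apply: ler_wpM2l; [exact: normc_ge0|exact: ltW].
  rewrite (_ : e / 2 = (normc a + 1) * (e / (2 * (normc a + 1)))).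
    by apply: ler_wpM2r; [exact: ltW|rewrite lerDl].
  by field; rewrite gt_eqF// ltr_wpDl// normc_ge0.
lra.
Qed.

Lemma normc_conj (z : C) : normc z^* = normc z.
Proof. by apply: complexI; rewrite -!normCE norm_conjC. Qed.

Lemma is_lim_conj u l : is_lim u l -> is_lim (fun n => (u n)^*) l^*.
Proof.
by move=> ul e /ul[n nP]; exists n => i /nP; rewrite -rmorphB normc_conj.
Qed.

Lemma sum_series (u : nat -> R) n : \sum_(i < n) u i = series u n.
Proof. by rewrite /series/= big_mkord. Qed.

Lemma pdot_cvg (x y : l2) : exists l, is_lim (pdot x y) l.
Proof.
have [A xA] := l2_bound x; have [B yB] := l2_bound y.
have key (g : C -> R) : {morph g : a b / a + b} -> g 0 = 0 ->
   (forall i, 2 * `|g (dotp (x i) (y i))| <= sqn (x i) + sqn (y i)) ->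
   exists l : R, forall e, 0 < e -> exists n0, forall n, (n0 <= n)%N ->
     `|g (pdot x y n) - l| < e.
  move=> gD g0 gb; pose t i := g (dotp (x i) (y i)).
  have gs n : g (pdot x y n) = series t n.
    by rewrite /pdot -sum_series /t; elim/big_ind2 : _ => // a b c d <- <-.
  have : cvgn (series t).
    apply: normed_cvg; apply: nondecreasing_is_cvgn.
      by apply: nondecreasing_series => n _ _; exact: normr_ge0.
    exists (A + B) => _ [n _ <-]; rewrite -[leLHS]/(series (fun i => `|t i|) n) -sum_series.
    apply: (@le_trans _ _ (\sum_(i < n) (sqn (x i) + sqn (y i)))).
      apply: ler_sum => i _; have := gb i; have := normr_ge0 (t i); rewrite /t; lra.
    rewrite big_split /=; exact: lerD (xA n) (yB n).
  move=> /cvg_ex[l /cvgrPdist_lt h]; exists l => e /h[n0 _ n0P]; exists n0 => n /n0P /=.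
  by rewrite distrC gs.
have [a aP] := key Re (fun u v => raddfD _ u v) erefl (fun i => Re_dotp_le _ _).
have [b bP] := key Im (fun u v => raddfD _ u v) erefl (fun i => Im_dotp_le _ _).
exists (a +i* b)%C => e e0; have e2 : 0 < e / 2 by rewrite divr_gt0.
have [n nP] := aP _ e2; have [m mP] := bP _ e2.
exists (maxn n m) => k; rewrite geq_max => /andP[/nP h1 /mP h2].
apply: le_lt_trans (normc_le _) _; rewrite [ltRHS]splitr.
by case: (pdot x y k) h1 h2 => u v /= *; apply: ltrD.
Qed.

(** The series of the scalar products, as a limit of partial sums; it converges
absolutely by [Re_dotp_le] and [Im_dotp_le]. *)
Definition l2dot (x y : l2) : C := xget 0 (is_lim (pdot x y)).

Lemma l2dotP (x y : l2) : is_lim (pdot x y) (l2dot x y).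
Proof. by apply: (xgetPex 0 (P := is_lim (pdot x y))); exact: pdot_cvg. Qed.

Lemma l2dot_eq (x y : l2) l : is_lim (pdot x y) l -> l2dot x y = l.
Proof. exact: is_lim_uniq (l2dotP x y). Qed.

Fact l2dotC (x y : l2) : l2dot x y = (-1) ^+ false * Num.conj (l2dot y x).
Proof.
rewrite expr0 mul1r; apply: l2dot_eq => e /(is_lim_conj (l2dotP y x))[n nP].
exists n => i /nP; congr (normc (_ - _) < _); rewrite /pdot rmorph_sum.
by apply: eq_bigr => j _; exact: dotpC.
Qed.

Lemma l2dot_linl (y : l2) (a : C) (u v : l2) : l2dot (a *: u + v) y = a * l2dot u y + l2dot v y.
Proof.
apply: l2dot_eq => e /(is_lim_lin a (l2dotP u y) (l2dotP v y))[n nP].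
exists n => i /nP; congr (normc (_ - _) < _); rewrite /pdot mulr_sumr -big_split /=.
by apply: eq_bigr => j _; rewrite [in RHS]linearPl.
Qed.

Fact l2dot_bilinear : bilinear_for *%R (Num.conj \; *%R) l2dot.
Proof.
split=> y a u v; first exact: l2dot_linl.
rewrite [LHS]l2dotC l2dot_linl expr0 mul1r rmorphD rmorphM /=.
by rewrite (l2dotC y u) (l2dotC y v) !expr0 !mul1r.
Qed.

HB.instance Definition _ := bilinear_isBilinear.Build R[i] l2 l2
  R[i] *%R (Num.conj \; *%R) l2dot l2dot_bilinear.

HB.instance Definition _ := isHermitianSesquilinear.Build R[i] l2
  false Num.conj l2dot l2dotC.

Lemma pdot_sqn (x : l2) n : pdot x x n = (\sum_(i < n) sqn (x i))%:C%C.
Proof. by rewrite /pdot rmorph_sum; apply: eq_bigr => i _; rewrite sqnE. Qed.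

Lemma sum_sqn_mono (x : l2) n m : (n <= m)%N ->
  \sum_(i < n) sqn (x i) <= \sum_(i < m) sqn (x i).
Proof.
move=> nm; rewrite -(subnKC nm) big_split_ord /= lerDl.
by apply: sumr_ge0 => i _; exact: sqn_ge0.
Qed.

(** The squared norm of [x] is the supremum of the partial sums, so bounds on
partial sums and bounds on norms can be exchanged. *)
Lemma l2dot_re (x : l2) : exists2 r : R, l2dot x x = r%:C%C &
  (forall n, \sum_(i < n) sqn (x i) <= r) /\
  (forall B : R, (forall n, \sum_(i < n) sqn (x i) <= B) -> r <= B).
Proof.
have xx := l2dotP x x.
have near (e : R) : 0 < e -> exists n0, forall n, (n0 <= n)%N ->
   `|\sum_(i < n) sqn (x i) - Re (l2dot x x)| < e /\ `|Im (l2dot x x)| < e.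
  move=> /xx[n0 n0P]; exists n0 => n /n0P; rewrite pdot_sqn => h.
  split; apply: le_lt_trans h.
    by have := normr_Re ((\sum_(i < n) sqn (x i))%:C%C - l2dot x x); case: (l2dot x x).
  have := normr_Im ((\sum_(i < n) sqn (x i))%:C%C - l2dot x x); case: (l2dot x x) => a b /=.
  by rewrite sub0r normrN.
exists (Re (l2dot x x)); last split.
- have -> : l2dot x x = (Re (l2dot x x) +i* Im (l2dot x x))%C by case: (l2dot x x).
  congr (_ +i* _)%C; apply/eqP; rewrite -normr_eq0 eq_le normr_ge0 andbT.
  apply/ler_addgt0Pr => e /near[n0 n0P]; rewrite add0r.
  by have [_ /ltW] := n0P _ (leqnn _).
- move=> n; apply/ler_addgt0Pr => e /near[n0 n0P].
  have [h _] := n0P _ (leq_maxr n n0); have h2 := sum_sqn_mono x (leq_maxl n n0).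
  by move: h; rewrite ltr_norml => /andP[_]; lra.
- move=> B xB; apply/ler_addgt0Pr => e /near[n0 n0P].
  have [h _] := n0P _ (leqnn _); have h2 := xB n0.
  by move: h; rewrite ltr_norml => /andP[]; lra.
Qed.

Fact l2dot_gt0 (x : l2) : x != 0 -> 0 < l2dot x x.
Proof.
move=> x0; have [r -> [rb _]] := l2dot_re x; rewrite ltcR.
have [i xi] : exists i, x i <> 0.
  apply: contrapT => /forallNP h; move/eqP: x0; apply; apply/l2_eqP => i.
  exact: contrapT (h i).
apply: lt_le_trans (rb i.+1); rewrite big_ord_recr /= ltr_wpDl//.
  by apply: sumr_ge0 => j _; exact: sqn_ge0.
by rewrite lt_def sqn_ge0 andbT; apply/eqP => /sqn_eq0.
Qed.

HB.instance Definition _ := isDotProduct.Build R[i] l2 l2dot l2dot_gt0.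

Lemma complex_gt0 (e : C) : 0 < e -> exists2 r : R, 0 < r & e = r%:C%C.
Proof.
by case: e => a b; rewrite ltcE /= => /andP[/eqP -> a0]; exists a.
Qed.

(** A Cauchy sequence converges in every coordinate; the Cauchy bounds on finite
partial sums pass to this limit, uniformly in the number of terms. *)
Fact l2_complete (u : nat -> l2) :
  (forall e : C, 0 < e -> exists n0, forall m n, (n0 <= m)%N ->
     (n0 <= n)%N -> l2dot (u m - u n) (u m - u n) < e) ->
  exists l : l2, forall e : C, 0 < e -> exists n0, forall n,
    (n0 <= n)%N -> l2dot (u n - l) (u n - l) < e.
Proof.
move=> uc.
have uc' (e : R) : 0 < e -> exists n0, forall m n, (n0 <= m)%N -> (n0 <= n)%N ->
    forall k, \sum_(i < k) sqn (u m i - u n i) <= e.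
  move=> e0; have : 0 < e%:C%C by rewrite ltcR.
  move=> /uc[n0 n0P]; exists n0 => m n m0 nn k; have := n0P m n m0 nn.
  have [r -> [rb _]] := l2dot_re (u m - u n); rewrite ltcR => re.
  exact: le_trans (rb k) (ltW re).
have /choice[l lP] i : exists l : H, forall e : C, 0 < e -> exists n0, forall n,
    (n0 <= n)%N -> dotp (u n i - l) (u n i - l) < e.
  apply: hilbert_seq_complete => e /complex_gt0[r r0 ->].
  have [n0 n0P] := uc' (r / 2) (divr_gt0 r0 (ltr0Sn _ 1)).
  exists n0 => m n m0 nn; rewrite sqnE ltcR.
  have := n0P m n m0 nn i.+1; rewrite big_ord_recr /=.
  have : 0 <= \sum_(j < i) sqn (u m j - u n j) by apply: sumr_ge0 => j _; exact: sqn_ge0.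
  lra.
have fin k (e : R) : 0 < e -> exists n0, forall n, (n0 <= n)%N ->
    \sum_(i < k) sqn (u n i - l i) <= e.
  elim: k e => [|k IH] e e0; first by exists 0%N => n _; rewrite big_ord0 ltW.
  have e2 : 0 < e / 2 by rewrite divr_gt0.
  have [n1 n1P] := IH _ e2.
  have [|n2 n2P] := lP k (e / 2)%:C%C; first by rewrite ltcR.
  exists (maxn n1 n2) => n; rewrite geq_max => /andP[/n1P h1 /n2P].
  by rewrite sqnE ltcR big_ord_recr /= => h2; lra.
have tail (e : R) : 0 < e -> exists n0, forall m, (n0 <= m)%N ->
    forall k, \sum_(i < k) sqn (u m i - l i) <= 4 * e.
  move=> e0; have [n0 n0P] := uc' _ e0; exists n0 => m m0 k.
  have [n1 n1P] := fin k _ e0.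
  have h1 := n0P m (maxn n0 n1) m0 (leq_maxl _ _) k; have h2 := n1P _ (leq_maxr n0 n1).
  apply: (@le_trans _ _ (\sum_(i < k) (2 * sqn (u m i - u (maxn n0 n1) i) +
     2 * sqn (u (maxn n0 n1) i - l i)))).
    apply: ler_sum => i _; rewrite -[u m i](subrK (u (maxn n0 n1) i)) -addrA addrK.
    exact: sqnD_le.
  by rewrite big_split /= -!mulr_sumr; lra.
have [n0 n0P] := tail 1 ltr01.
have ldS : (fun i => u n0 i - l i) \in sqsummable.
  by apply/asboolP; exists (4 * 1) => n; exact: n0P.
have lS : l \in sqsummable.
  have -> : l = val (u n0) - val (L2 ldS).
    by apply/funext => i; rewrite !fctE /= opprB addrC subrK.
  by apply: rpredB; apply: valP.
exists (L2 lS) => e /complex_gt0[r r0 ->].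
have [n1 n1P] := tail (r / 8) (divr_gt0 r0 (ltr0Sn _ 7)).
exists n1 => n /n1P h; have [s -> [_ sb]] := l2dot_re (u n - L2 lS); rewrite ltcR.
by have := sb _ h; lra.
Qed.

HB.instance Definition _ := Lmodule_isHilbert.Build R l2 l2_complete.

End L2.

(** * Operators on sequence spaces, and separability *)

Section Operators.
Variable R : realType.
Implicit Types H K : hilbertType R.
Local Notation C := R[i].

Lemma normr_sqn H (x : H) : `|x| = (Num.sqrt (sqn x))%:C%C.
Proof.
apply/eqP; rewrite -(@eqrXn2 _ 2) ?normr_ge0 ?lecR ?sqrtr_ge0//.
by rewrite norm_sqn -rmorphXn /= sqr_sqrtr ?sqn_ge0.
Qed.

Lemma sqn_bounded H K (f : H -> K) (c : R) : 0 <= c ->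
  (forall x, sqn (f x) <= c * sqn x) -> forall x, `|f x| <= (Num.sqrt c)%:C%C * `|x|.
Proof.
move=> c0 fc x; rewrite !normr_sqn -rmorphM lecR -sqrtrM//.
by rewrite ler_wsqrtr.
Qed.

Lemma op_addE H K (S T : 'L(H, K)) x : (S + T) x = S x + T x. Proof. by []. Qed.
Lemma op_oppE H K (T : 'L(H, K)) x : (- T) x = - T x. Proof. by []. Qed.
Lemma op_zeroE H K x : (0 : 'L(H, K)) x = 0. Proof. by []. Qed.
Lemma op_scaleE H K a (T : 'L(H, K)) x : (a *: T) x = a *: T x. Proof. by []. Qed.
Lemma op_sumE H K (I : Type) (r : seq I) (P : pred I) (T : I -> 'L(H, K)) x :
  (\sum_(i <- r | P i) T i) x = \sum_(i <- r | P i) T i x.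
Proof. by elim/big_rec2 : _ => // i y S _ <-. Qed.

Lemma l2_dotE H (x y : l2 H) : dotp x y = l2dot x y. Proof. by []. Qed.

Lemma l2_sqn_le H (x : l2 H) n : \sum_(i < n) sqn (x i) <= sqn x.
Proof. by have [r e [h _]] := l2dot_re x; rewrite [sqn x]/sqn l2_dotE e; exact: h. Qed.

Lemma l2_le_sqn H (x : l2 H) (B : R) :
  (forall n, \sum_(i < n) sqn (x i) <= B) -> sqn x <= B.
Proof. by move=> h; have [r e [_]] := l2dot_re x; rewrite [sqn x]/sqn l2_dotE e; apply. Qed.

Lemma l2_addE H (x y : l2 H) n : (x + y) n = x n + y n. Proof. by []. Qed.
Lemma l2_zeroE H n : (0 : l2 H) n = 0. Proof. by []. Qed.
Lemma l2_scaleE H a (x : l2 H) n : (a *: x) n = a *: x n. Proof. by []. Qed.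

Lemma l2_coord_le H (x : l2 H) n : sqn (x n) <= sqn x.
Proof.
apply: le_trans (l2_sqn_le x n.+1); rewrite big_ord_recr /= lerDr.
by apply: sumr_ge0 => i _; exact: sqn_ge0.
Qed.

Section L2ops.
Variables H K : hilbertType R.

(** An injective reindexing sums distinct terms of a nonnegative series. *)
Lemma reindex_le (f : nat -> R) (phi : nat -> nat) (p : pred nat) (B : R) :
  (forall i, 0 <= f i) -> (forall n, \sum_(i < n) f i <= B) ->
  {in p &, injective phi} -> forall n, \sum_(i < n | p i) f (phi i) <= B.
Proof.
move=> f0 fB phiI n.
pose s := [seq phi i | i <- iota 0 n & p i].
have su : uniq s.
  rewrite map_inj_in_uniq ?filter_uniq ?iota_uniq// => i j.
  by rewrite !mem_filter => /andP[pi _] /andP[pj _]; exact: phiI.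
pose m := (\max_(i <- s) i).+1.
have sm i : i \in s -> (i < m)%N by move=> si; rewrite ltnS; exact: leq_bigmax_seq.
have -> : \sum_(i < n | p i) f (phi i) = \sum_(j <- s) f j.
  by rewrite big_map big_filter -(big_mkord p (fun i => f (phi i))) /index_iota subn0.
have -> : \sum_(j <- s) f j = \sum_(j <- iota 0 m | j \in s) f j.
  rewrite -[RHS]big_filter; apply: perm_big; apply: uniq_perm => //.
    by rewrite filter_uniq// iota_uniq.
  move=> j; rewrite mem_filter mem_iota add0n /=.
  by case: (boolP (j \in s)) => // /sm ->.
apply: le_trans (fB m); rewrite -(big_mkord xpredT f) /index_iota subn0.
rewrite [leLHS]big_mkcond /=; apply: ler_sum => i _.
by case: ifP.
Qed.

Fact coord_bounded n (x : l2 H) : `|x n| <= 1 * `|x|.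
Proof. by rewrite mul1r !normr_sqn lecR ler_wsqrtr// l2_coord_le. Qed.

Definition coord (n : nat) : 'L(l2 H, H) :=
  @mk_boundedOp R (l2 H) H (fun x => x n) (fun a x y => erefl) 1 (coord_bounded n).

(** Total in [phi] and [T], so that it can be named without proofs: the bound and
the injectivity that make it the operator it should be appear in [wopE] only. *)
Definition wop (phi : nat -> nat) (T : nat -> 'L(H, K)) : 'L(l2 H, l2 K) :=
  xget 0 [set A : 'L(l2 H, l2 K) | forall x n, A x n = T n (x (phi n))].

(** Injectivity of [phi] is asked where [T] does not vanish, which allows the
forward shift, whose [predn] identifies 0 and 1. *)
Lemma wopE phi (T : nat -> 'L(H, K)) (p : pred nat) (c : R) : 0 <= c ->
  (forall n x, sqn (T n x) <= c * sqn x) -> (forall n, ~~ p n -> T n = 0) ->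
  {in p &, injective phi} -> forall x n, wop phi T x n = T n (x (phi n)).
Proof.
move=> c0 Tc Tp phiI.
suff [A AE] : exists A : 'L(l2 H, l2 K), forall x n, A x n = T n (x (phi n)).
  exact: (xgetPex 0 (P := [set A : 'L(l2 H, l2 K) | forall x n, A x n = T n (x (phi n))])
    (ex_intro _ A AE)).
have bnd (x : l2 H) n : \sum_(i < n) sqn (T i (x (phi i))) <= c * sqn x.
  apply: (@le_trans _ _ (\sum_(i < n | p i) c * sqn (x (phi i)))).
    rewrite [leRHS]big_mkcond /=; apply: ler_sum => i _; case: ifPn => // pi.
    by rewrite Tp// op_zeroE sqn0.
  rewrite -mulr_sumr; apply: ler_wpM2l => //.
  apply: (@reindex_le (fun i => sqn (x i)) phi p) => //; first by move=> i; exact: sqn_ge0.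
  exact: l2_sqn_le.
pose f (x : l2 H) := @mk_l2 _ _ (fun n => T n (x (phi n))) _ (bnd x).
have fl : linear f.
  by move=> a x y; apply/l2_eqP => n; rewrite l2_addE l2_scaleE /= linearP.
have fb x : sqn (f x) <= c * sqn x by apply: l2_le_sqn => n; exact: bnd.
by exists (mk_boundedOp fl (sqn_bounded c0 fb)).
Qed.

Definition colop (T : nat -> 'L(H, K)) : 'L(H, l2 K) :=
  xget 0 [set A : 'L(H, l2 K) | forall x n, A x n = T n x].

Lemma colopE (T : nat -> 'L(H, K)) (c : R) : 0 <= c ->
  (forall n x, \sum_(i < n) sqn (T i x) <= c * sqn x) ->
  forall x n, colop T x n = T n x.
Proof.
move=> c0 Tc.
suff [A AE] : exists A : 'L(H, l2 K), forall x n, A x n = T n x.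
  exact: (xgetPex 0 (P := [set A : 'L(H, l2 K) | forall x n, A x n = T n x])
    (ex_intro _ A AE)).
pose f (x : H) := @mk_l2 _ _ (fun n => T n x) _ (fun n => Tc n x).
have fl : linear f.
  by move=> a x y; apply/l2_eqP => n; rewrite l2_addE l2_scaleE /= linearP.
have fb x : sqn (f x) <= c * sqn x by apply: l2_le_sqn => n; exact: Tc.
by exists (mk_boundedOp fl (sqn_bounded c0 fb)).
Qed.

(** For operators that act on each coordinate by an isometry. *)
Lemma l2dot_ext (x y : l2 H) (x' y' : l2 K) : (forall n, dotp (x n) (y n) = dotp (x' n) (y' n)) ->
  dotp x y = dotp x' y'.
Proof.
move=> h; apply: l2dot_eq => e /(l2dotP x' y')[n0 n0P]; exists n0 => n /n0P.
by congr (normc (_ - _) < _); apply: eq_bigr => i _.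
Qed.

Lemma l2dot_recl (x y x' y' : l2 H) : (forall n, x n.+1 = x' n) -> (forall n, y n.+1 = y' n) ->
  dotp x y = dotp (x 0%N) (y 0%N) + dotp x' y'.
Proof.
move=> xx' yy'; apply: l2dot_eq => e /(l2dotP x' y')[n0 n0P]; exists n0.+1 => -[//|n].
rewrite ltnS => /n0P; congr (normc _ < _).
rewrite /pdot [in RHS]big_ord_recl opprD addrACA subrr add0r; congr (_ - _).
by apply: eq_bigr => i _; rewrite -xx' -yy'.
Qed.

End L2ops.

Lemma colop_delta_bound H (k : nat) (n : nat) (x : H) :
  \sum_(i < n) sqn ((if val i == k then idop H else 0) x) <= 1 * sqn x.
Proof.
rewrite mul1r; elim: n => [|n IH]; first by rewrite big_ord0 sqn_ge0.
have aux m : (m <= k)%N -> \sum_(i < m) sqn ((if val i == k then idop H else 0) x) = 0.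
  move=> mk; apply: big1 => i _; case: eqP => [ik|_]; last by rewrite op_zeroE sqn0.
  by have := ltn_ord i; rewrite [val i]ik ltnNge mk.
rewrite big_ord_recr /=; case: eqP => [->|_]; last by rewrite op_zeroE sqn0 addr0.
by rewrite aux// add0r.
Qed.

Definition injop H (k : nat) : 'L(H, l2 H) := colop (fun n => if n == k then idop H else 0).

Lemma injopE H k (x : H) n : injop H k x n = if n == k then x else 0.
Proof.
rewrite (colopE ler01 (fun m x => colop_delta_bound k m x)).
by case: eqP.
Qed.

End Operators.

Section Separability.
Variable R : realType.
Implicit Types H K : hilbertType R.

(** Density of a sequence in terms of squared norms, which are what direct sums
and l2 spaces add up. *)
Definition sepseq H := exists f : nat -> H, forall x (e : R), 0 < e ->
  exists n, sqn (x - f n) < e.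

Lemma separable_sepseq H : separable H -> sepseq H.
Proof.
move=> [D cD dD]; have [g gI] := countable_injP D cD.
pose f n := xget 0 [set d | D d /\ g d = n]; exists f => x e e0.
have s0 : 0 < (Num.sqrt e)%:C%C :> R[i] by rewrite ltcR sqrtr_gt0.
have [|d [dO dd]] := dD (ball x (Num.sqrt e)%:C%C)^° _ (open_interior _).
  exists x; exact: nbhsx_ballx.
have : ball x (Num.sqrt e)%:C%C d by exact: interior_subset dO.
rewrite -ball_normE /ball_ /= normr_sqn ltcR ltr_sqrt// => xd.
exists (g d); have [d1 d2] : D (f (g d)) /\ g (f (g d)) = g d.
  by apply: (xgetPex 0 (P := [set d' | D d' /\ g d' = g d])); exists d.
by have -> : f (g d) = d by apply: gI; rewrite ?inE.
Qed.

Lemma sepseq_separable H : sepseq H -> separable H.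
Proof.
move=> [f fD]; exists (range f); first exact: (sub_countable (card_image_le f setT) (countableP _)).
move=> O [x Ox] oO; have : nbhs x O by exact: open_nbhs_nbhs.
move=> /nbhs_ballP[e /complex_gt0[r r0 ->] bO].
have [n nP] := fD x (r ^+ 2) (exprn_gt0 2 r0).
exists (f n); split; last by exists n.
apply: bO; rewrite -ball_normE /ball_ /= normr_sqn ltcR.
by rewrite -[ltRHS]ger0_norm ?ltW// -sqrtr_sqr ltr_sqrt ?exprn_gt0.
Qed.

Lemma sepseq_hsum H K : sepseq H -> sepseq K -> sepseq (hsum H K).
Proof.
move=> [f fD] [g gD].
exists (fun n => if unpickle n is Some (a, b) then (f a, g b) : hsum H K else 0).
move=> [x y] e e0; have e2 : 0 < e / 2 by rewrite divr_gt0.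
have [a aP] := fD x _ e2; have [b bP] := gD y _ e2.
exists (pickle (a, b)); rewrite pickleK.
have -> : sqn ((x, y) - (f a, g b) : hsum H K) = sqn (x - f a) + sqn (y - g b).
  by apply: complexI; rewrite rmorphD /= -!sqnE.
by rewrite [ltRHS]splitr ltrD.
Qed.

(** Cut [x] off at an index where less than e/4 of its squared norm remains, and
approximate the finitely many remaining coordinates. *)
Lemma sepseq_l2 H : sepseq H -> sepseq (l2 H).
Proof.
move=> [f fD].
pose t (s : seq nat) (i : nat) : H := if (i < size s)%N then f (nth 0%N s i) else 0.
have tB s n : \sum_(i < n) sqn (t s i) <= \sum_(i < size s) sqn (t s i).
  have [ns|sn] := leqP n (size s).
    rewrite -(subnKC ns) big_split_ord /= lerDl.
    by apply: sumr_ge0 => i _; exact: sqn_ge0.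
  rewrite -(subnKC (ltnW sn)) big_split_ord /= gerDl big1// => i _.
  by rewrite /t ltnNge leq_addr /= sqn0.
pose g s := @mk_l2 _ _ (t s) _ (tB s).
exists (fun n => if unpickle n is Some s then g s else 0) => x e e0.
have e4 : 0 < e / 4 by rewrite divr_gt0.
have [r xr [rb rl]] := l2dot_re x.
have [k kP] : exists k, r - e / 4 < \sum_(i < k) sqn (x i).
  apply: contrapT => /forallNP h; have := rl (r - e / 4).
  rewrite leNgt ltrBlDr ltrDl e4 => /(_ _)/wrap[]// n.
  by rewrite leNgt; exact/negP/h.
have d0 : 0 < e / 4 / k.+1%:R by rewrite divr_gt0.
have /choice[c cP] i := fD (x i) _ d0.
pose s := mkseq c k; exists (pickle s); rewrite pickleK.
have ss : size s = k by rewrite size_mkseq.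
apply: (@le_lt_trans _ _ (e / 4 + e / 4)); last by lra.
have gE j : (l2_fun x - t s) j = x j - t s j by [].
apply: l2_le_sqn => n; apply: (@le_trans _ _ (\sum_(i < k + n) sqn ((x - g s) i))).
  by rewrite addnC big_split_ord /= lerDl; apply: sumr_ge0 => i _; exact: sqn_ge0.
rewrite big_split_ord /=; apply: lerD.
  apply: (@le_trans _ _ (\sum_(i < k) e / 4 / k.+1%:R)).
    apply: ler_sum => i _; rewrite gE /t ss /= ltn_ord nth_mkseq//.
    exact: ltW.
  rewrite sumr_const card_ord -[leLHS]mulr_natr [leLHS]mulrAC ler_pdivrMr//.
  by rewrite ler_wpM2l ?ler_nat// ltW.
apply: (@le_trans _ _ (\sum_(i < n) sqn (x (k + i)%N))).
  apply: ler_sum => i _; rewrite gE /t ss /= ltnNge leq_addr /=.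
  by rewrite subr0.
have := rb (k + n)%N; rewrite big_split_ord /=; lra.
Qed.

End Separability.

(** * Krein unitarity, transfer functions and Neumann series *)

Section Pairs.
Variable R : realType.
Implicit Types V W Z X U Y H K : hilbertType R.
Local Notation C := R[i].

Fact pr1_bounded V W (x : hsum V W) : `|x.1| <= 1 * `|x|.
Proof. by rewrite mul1r; exact: ler_hsum1. Qed.
Definition pr1 V W : 'L(hsum V W, V) :=
  @mk_boundedOp R (hsum V W) V fst (fun a x y => erefl) 1 (@pr1_bounded V W).

Fact pr2_bounded V W (x : hsum V W) : `|x.2| <= 1 * `|x|.
Proof. by rewrite mul1r; exact: ler_hsum2. Qed.
Definition pr2 V W : 'L(hsum V W, W) :=
  @mk_boundedOp R (hsum V W) W snd (fun a x y => erefl) 1 (@pr2_bounded V W).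

Definition pair_fun Z V W (A : 'L(Z, V)) (B : 'L(Z, W)) (z : Z) : hsum V W := (A z, B z).
Fact pair_linear Z V W (A : 'L(Z, V)) (B : 'L(Z, W)) : linear (pair_fun A B).
Proof. by move=> a x y; rewrite /pair_fun !linearP. Qed.
Fact pair_bounded Z V W (A : 'L(Z, V)) (B : 'L(Z, W)) z :
  `|pair_fun A B z| <= (opnorm A + opnorm B) * `|z|.
Proof.
by apply: le_trans (ler_hsumD _) _; rewrite mulrDl lerD// ler_opnorm.
Qed.
Definition pairop Z V W (A : 'L(Z, V)) (B : 'L(Z, W)) : 'L(Z, hsum V W) :=
  mk_boundedOp (pair_linear A B) (pair_bounded A B).

Lemma hsum_dotE V W (a b : hsum V W) : dotp a b = dotp a.1 b.1 + dotp a.2 b.2.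
Proof. by []. Qed.

Lemma pair_sum V W (I : Type) (r : seq I) (f : I -> V) (g : I -> W) :
  \sum_(i <- r) ((f i, g i) : hsum V W) = (\sum_(i <- r) f i, \sum_(i <- r) g i).
Proof. by elim: r => [|i r IH]; rewrite ?big_nil// !big_cons IH. Qed.

Lemma dotp_nondeg H (a b : H) : (forall v, dotp v a = dotp v b) -> a = b.
Proof.
move=> h; apply/eqP; rewrite -subr_eq0 -(dnorm_eq0 dotp); apply/eqP.
by rewrite linearBr /= h subrr.
Qed.

(** From the isometry, [W' J2 W = J1], with [W'] the adjoint. Every [k] is [J2 W h]
for some [h], and then [W J1 W' k = W J1 J1 h = W h = J2 k]. *)
Lemma krein_unitary H K (J1 : 'L(H, H)) (J2 : 'L(K, K)) (W : 'L(H, K)) :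
  J1 *o J1 = idop H -> J2 *o J2 = idop K ->
  (forall x y, dotp (J2 (W x)) (W y) = dotp (J1 x) y) ->
  (forall k, exists h, W h = k) ->
  adjoint W *o J2 *o W = J1 /\ W *o J1 *o adjoint W = J2.
Proof.
move=> J11 J22 Wiso Wsur.
have e1 x : adjoint W (J2 (W x)) = J1 x.
  by apply: dotp_nondeg => v; rewrite -adjointP -[LHS]dotpC Wiso dotpC.
split; first by apply/boundedOp_eqP => x; exact: e1.
have J1K x : J1 (J1 x) = x by have /boundedOp_eqP := J11; apply.
have J2K x : J2 (J2 x) = x by have /boundedOp_eqP := J22; apply.
apply/boundedOp_eqP => k /=.
have [h hk] := Wsur (J2 k).
by rewrite -{1}[k]J2K -hk e1 J1K.
Qed.

Lemma is_adjoint_eq H K (T : 'L(H, K)) (S : 'L(K, H)) : is_adjoint T S -> S = adjoint T.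
Proof. by move=> h; apply: is_adjoint_uniq h _ => x y; exact: adjointP. Qed.

Lemma symmetry_of H (J : 'L(H, H)) : (forall x y, dotp (J x) y = dotp x (J y)) ->
  (forall x, J (J x) = x) -> canonical_symmetry J.
Proof.
move=> Js JK; split; first exact: is_adjoint_eq.
by split; apply/boundedOp_eqP => x; exact: JK.
Qed.

Lemma symmetryP H (J : 'L(H, H)) : canonical_symmetry J ->
  (forall x y, dotp (J x) y = dotp x (J y)) /\ (forall x, J (J x) = x).
Proof.
move=> [e [h _]]; split; first by move=> x y; rewrite {2}e adjointP.
by have /boundedOp_eqP := h.
Qed.

Lemma block_diagE H K (J : 'L(H, H)) (J' : 'L(K, K)) (a : hsum H K) :
  block_op J 0 0 J' a = (J a.1, J' a.2).
Proof.
rewrite -[LHS]/((J a.1 + 0, 0 + J' a.2) : hsum H K).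
by rewrite addr0 add0r.
Qed.

Lemma symmetry_block H K (J : 'L(H, H)) (J' : 'L(K, K)) : canonical_symmetry J ->
  canonical_symmetry J' -> canonical_symmetry (block_op J 0 0 J').
Proof.
move=> /symmetryP[s1 k1] /symmetryP[s2 k2].
apply: symmetry_of => [x y|[a b]].
  by rewrite !block_diagE !hsum_dotE /= s1 s2.
by rewrite !block_diagE /= k1 k2.
Qed.

Lemma symmetry_id H : canonical_symmetry (idop H).
Proof. exact: symmetry_of. Qed.

Lemma symmetry_opp H : canonical_symmetry (- idop H).
Proof.
apply: symmetry_of => [x y|x]; rewrite !op_oppE /=; last by rewrite opprK.
by rewrite linearNl linearNr.
Qed.

Definition system_of N X U Y (G : 'I_N -> 'L(hsum X U, hsum X Y)) : lin_system N X U Y :=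
  LinSystem (fun k => pr1 X Y *o G k *o pairop (idop X) 0)
            (fun k => pr1 X Y *o G k *o pairop 0 (idop U))
            (fun k => pr2 X Y *o G k *o pairop (idop X) 0)
            (fun k => pr2 X Y *o G k *o pairop 0 (idop U)).

Lemma system_ofG N X U Y (G : 'I_N -> 'L(hsum X U, hsum X Y)) :
  sysG (system_of G) = G.
Proof.
apply/funext => k; apply/boundedOp_eqP => -[x u].
have -> : ((x, u) : hsum X U) = (x, 0) + (0, u).
  by rewrite -[RHS]/((x + 0, 0 + u) : hsum X U) addr0 add0r.
rewrite [RHS]linearD /= /block_fun /= /pair_fun /= addr0 add0r.
by case: (G k _) => a b; case: (G k _) => c d.
Qed.

Lemma pencilE N (V W : hilbertType R) (z : 'rV[C]_N) (T : 'I_N -> 'L(V, W)) x :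
  pencil z T x = \sum_(k < N) z 0 k *: T k x.
Proof. by rewrite /pencil op_sumE. Qed.

Lemma pencil_comp N V W Z Z' (A : 'L(W, Z')) (B : 'I_N -> 'L(V, W)) (D : 'L(Z, V)) z e :
  pencil z (fun k => A *o B k *o D) e = A (pencil z B (D e)).
Proof.
rewrite !pencilE; transitivity (\sum_(k < N) A (z 0 k *: B k (D e))).
  by apply: eq_bigr => k _; rewrite linearZ.
by apply: esym; exact: (linear_sum A).
Qed.

Lemma pencil_sysG N X U Y (alpha : lin_system N X U Y) z x u :
  pencil z (sysG alpha) (x, u) =
  (pencil z (sysA alpha) x + pencil z (sysB alpha) u,
   pencil z (sysC alpha) x + pencil z (sysD alpha) u).
Proof.
have e k : z 0 k *: sysG alpha k (x, u) =
    ((z 0 k *: sysA alpha k x + z 0 k *: sysB alpha k u,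
      z 0 k *: sysC alpha k x + z 0 k *: sysD alpha k u) : hsum X Y).
  by rewrite -!scalerDr.
rewrite !pencilE -!big_split; apply: (etrans (eq_bigr _ (fun k _ => e k))).
exact: pair_sum.
Qed.

(** As [I - zA] is invertible, the state [x] is determined by [u]. *)
Lemma transfer_eq N X U Y (alpha : lin_system N X U Y) z (T : 'L(U, Y)) :
  transfer_defined alpha z ->
  (forall u, exists x, pencil z (sysG alpha) (x, u) = (x, T u)) ->
  T = transfer alpha z.
Proof.
move=> /invopP[inv _] sol; apply/boundedOp_eqP => u; have [x] := sol u.
rewrite pencil_sysG => e.
have xE : pencil z (sysA alpha) x + pencil z (sysB alpha) u = x := congr1 fst e.
have TE : pencil z (sysC alpha) x + pencil z (sysD alpha) u = T u := congr1 snd e.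
have xB : (idop X - pencil z (sysA alpha)) x = pencil z (sysB alpha) u.
  rewrite op_addE op_oppE -[X in X - _ = _]xE.
  by rewrite addrAC subrr add0r.
have SE : invop (idop X - pencil z (sysA alpha)) (pencil z (sysB alpha) u) = x.
  by rewrite -xB; have /boundedOp_eqP := inv; apply.
by rewrite /transfer op_addE -TE addrC -[in LHS]SE.
Qed.

(** Both identities of conservativity follow, by [krein_unitary], from the
isometry and the surjectivity of the pencil on the torus. *)
Lemma conservative_of N X U Y (G : 'I_N -> 'L(hsum X U, hsum X Y)) (J : 'L(X, X)) :
  canonical_symmetry J ->
  (forall z : 'rV[C]_N, (forall k, `|z 0 k| = 1) -> forall x y,
    dotp (block_op J 0 0 (idop Y) (pencil z G x)) (pencil z G y) =
    dotp (block_op J 0 0 (idop U) x) y) ->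
  (forall z : 'rV[C]_N, (forall k, `|z 0 k| = 1) ->
    forall y, exists x, pencil z G x = y) ->
  J_conservative (system_of G) J.
Proof.
move=> JS Giso Gsur J1 J2 z z1; rewrite system_ofG /J1 /J2.
have [_ [j1 _]] := symmetry_block JS (symmetry_id U).
have [_ [j2 _]] := symmetry_block JS (symmetry_id Y).
have h := @krein_unitary _ _ _ _ (pencil z G) j1 j2.
by apply: h; [exact: Giso|exact: Gsur].
Qed.

Definition rnorm H (x : H) : R := Num.sqrt (sqn x).

Lemma rnormE H (x : H) : `|x| = (rnorm x)%:C%C.
Proof. exact: normr_sqn. Qed.

Lemma rnorm_ge0 H (x : H) : 0 <= rnorm x. Proof. exact: sqrtr_ge0. Qed.

Lemma rnormD H (x y : H) : rnorm (x + y) <= rnorm x + rnorm y.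
Proof. by rewrite -lecR rmorphD /= -!rnormE ler_normD. Qed.

Lemma rnormZ H (a : C) (x : H) : rnorm (a *: x) = normc a * rnorm x.
Proof. by apply: complexI; rewrite rmorphM /= -!rnormE normrZ. Qed.

Lemma rnormN H (x : H) : rnorm (- x) = rnorm x.
Proof. by rewrite /rnorm sqnN. Qed.

Lemma rnorm0 H : rnorm (0 : H) = 0.
Proof. by rewrite /rnorm sqn0 sqrtr0. Qed.

Lemma rnorm_eq0 H (x : H) : rnorm x = 0 -> x = 0.
Proof. by move=> h; apply/eqP; rewrite -normr_eq0 rnormE h. Qed.

Lemma sqr_rnorm H (x : H) : rnorm x ^+ 2 = sqn x.
Proof. by rewrite sqr_sqrtr ?sqn_ge0. Qed.

Lemma rnorm_sum H (I : Type) (r : seq I) (f : I -> H) :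
  rnorm (\sum_(i <- r) f i) <= \sum_(i <- r) rnorm (f i).
Proof.
elim: r => [|i r IH]; first by rewrite !big_nil rnorm0.
by rewrite !big_cons; apply: le_trans (rnormD _ _) _; rewrite lerD2l.
Qed.

Lemma rnorm_bounded H K (T : 'L(H, K)) : exists2 c : R, 0 <= c &
  forall x, rnorm (T x) <= c * rnorm x.
Proof.
have [M M0 TM] := boundedOp_bounded T; exists M => // x.
by have := TM x; rewrite !rnormE -rmorphM lecR.
Qed.

(** The inverse sends [y] to the limit of the iterates of [x |-> y + A x], which
contract with ratio 1/2. *)
Lemma neumann H (A : 'L(H, H)) : (forall x, rnorm (A x) <= 2^-1 * rnorm x) ->
  invertible_op (idop H - A).
Proof.
move=> Ah.
pose s (y : H) n := iter n (fun x => y + A x) 0.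
have sS y n : s y n.+1 = y + A (s y n) by [].
have d1 y n : rnorm (s y n.+1 - s y n) <= 2^-1 ^+ n * rnorm y.
  elim: n => [|n IH]; first by rewrite sS /= linear0 addr0 subr0 expr0 mul1r.
  rewrite (sS y n.+1) (sS y n) opprD addrACA subrr add0r -linearB.
  apply: le_trans (Ah _) _; rewrite exprS -mulrA.
  by rewrite ler_pM2l ?invr_gt0.
have d2 y n m : rnorm (s y (n + m)%N - s y n) <= 2 * (2^-1 ^+ n - 2^-1 ^+ (n + m)%N) * rnorm y.
  elim: m => [|m IH]; first by rewrite addn0 !subrr rnorm0 mulr0 mul0r.
  rewrite -[s y (n + m.+1)%N](subrK (s y (n + m)%N)) -addrA addnS.
  apply: le_trans (rnormD _ _) _; have := d1 y (n + m)%N; rewrite exprS => h.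
  have e : 2 * (2^-1 ^+ n - 2^-1 * 2^-1 ^+ (n + m)%N) * rnorm y =
    2^-1 ^+ (n + m)%N * rnorm y + 2 * (2^-1 ^+ n - 2^-1 ^+ (n + m)%N) * rnorm y by field.
  by rewrite e; apply: lerD.
have d3 y n m : rnorm (s y (n + m)%N - s y n) <= 2 * 2^-1 ^+ n * rnorm y.
  apply: le_trans (d2 y n m) _; apply: ler_wpM2r; first exact: rnorm_ge0.
  by rewrite ler_pM2l// gerBl exprn_ge0// invr_ge0.
have small (y : H) (e : R) : 0 < e -> exists n0, forall n, (n0 <= n)%N -> 2 * 2^-1 ^+ n * rnorm y < e.
  move=> e0; have [n0 n0P] := @geometric_small R (2 * rnorm y) e e0.
  exists n0 => n nn; apply: le_lt_trans n0P; rewrite mulrAC -exprVn.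
  apply: ler_wpM2l; first by rewrite mulr_ge0// rnorm_ge0.
  by apply: ler_wiXn2l => //; rewrite ?invr_ge0// invf_le1 ?ler1n.
have sol y : exists x, x = y + A x.
  have [|l lP] := @hilbert_seq_complete R H (s y).
    move=> e /complex_gt0[r r0 ->];
    have [|n0 n0P] := small y (Num.sqrt r / 2); first by rewrite divr_gt0 ?sqrtr_gt0.
    exists n0 => m n m0 nn; rewrite sqnE ltcR -sqr_rnorm -[ltRHS](sqr_sqrtr (ltW r0)).
    rewrite ltr_sqr ?nnegrE ?rnorm_ge0 ?sqrtr_ge0//.
    have h k : (n0 <= k)%N -> rnorm (s y k - s y n0) < Num.sqrt r / 2.
      by move=> nk; apply: le_lt_trans (n0P _ (leqnn _)); rewrite -(subnKC nk).
    rewrite -(subrK (s y n0) (s y m)) -addrA; apply: le_lt_trans (rnormD _ _) _.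
    by rewrite -[s y n0 - _]opprB rnormN [ltRHS]splitr ltrD ?h.
  exists l; apply/eqP; rewrite -subr_eq0; apply/eqP/rnorm_eq0/eqP.
  rewrite eq_le rnorm_ge0 andbT; apply/ler_addgt0Pr => e e0; rewrite add0r.
  have e2 : 0 < (e / 2) ^+ 2 by rewrite exprn_gt0// divr_gt0.
  have [|n nP] := lP ((e / 2) ^+ 2)%:C%C; first by rewrite ltcR.
  have h k : (n <= k)%N -> rnorm (s y k - l) < e / 2.
    move=> /nP; rewrite sqnE ltcR -sqr_rnorm ltr_sqr ?nnegrE ?rnorm_ge0//.
    by rewrite divr_ge0// ltW.
  have -> : l - (y + A l) = - (s y n.+1 - l) + A (s y n - l).
    rewrite sS (_ : A (s y n - l) = A (s y n) - A l); last exact: linearB.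
    by rewrite opprB !opprD !addrA subrK.
  apply: le_trans (rnormD _ _) _; rewrite rnormN [leRHS]splitr; apply: lerD.
    by apply: ltW; apply: h.
  apply: le_trans (Ah _) _; apply: (@le_trans _ _ (1 * rnorm (s y n - l))).
    by apply: ler_wpM2r; [exact: rnorm_ge0|rewrite invf_le1 ?ler1n].
  by rewrite mul1r ltW// h.
have bnd x : rnorm x <= 2 * rnorm (x - A x).
  have := rnormD (x - A x) (A x); rewrite subrK; have := Ah x; lra.
have /choice[S SP] := sol.
have SAE y : S y - A (S y) = y by rewrite {1}SP addrK.
(* linearity of the inverse follows from uniqueness of solutions *)
have uniq x y : x - A x = y - A y -> x = y.
  move=> e; apply/eqP; rewrite -subr_eq0; apply/eqP/rnorm_eq0/eqP.
  rewrite eq_le rnorm_ge0 andbT; apply: le_trans (bnd _) _.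
  rewrite (_ : A (x - y) = A x - A y); last exact: linearB.
  have -> : x - y - (A x - A y) = 0.
    by rewrite opprD addrACA e -opprD subrr.
  by rewrite rnorm0 mulr0.
have Sl : linear S.
  move=> a x y; apply: uniq; rewrite SAE linearP.
  by rewrite opprD addrACA -scalerBr !SAE.
have Sb x : `|S x| <= 2%:C%C * `|x|.
  by rewrite !rnormE -rmorphM lecR; have := bnd (S x); rewrite SAE.
exists (mk_boundedOp Sl Sb); split; apply/boundedOp_eqP => x.
  by apply: uniq; rewrite /= SAE.
exact: (SAE x).
Qed.

End Pairs.

(** * Conservative dilation of an arbitrary system *)

Section Eichler.
Variable R : realType.
Variables H K : hilbertType R.
Variable S : 'L(H, K).
Local Notation C := R[i].

(** The Eichler transvection of [S] maps [(x, p, m)] to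
[(eichler_h x d, p + eichler_s x d, m + eichler_s x d)], where [d = p - m] is
left invariant. *)
Definition eichler_h (x : H) (d : K) : H := x - adjoint S d.
Definition eichler_s (x : H) (d : K) : K := S x - 2^-1 *: S (adjoint S d).

Lemma eichler_s0 x : eichler_s x 0 = S x.
Proof. by rewrite /eichler_s !linear0 ?scaler0 ?subr0 addr0. Qed.

(** The change [x - S' d] of [x] creates the cross terms between [S x] and [d], and
a quadratic term in [S' d] that the factor 1/2 in [eichler_s] compensates. *)
Lemma eichler_form0 x d x' d' :
  dotp (eichler_h x d) (eichler_h x' d') +
  (dotp d (eichler_s x' d') + dotp (eichler_s x d) d') = dotp x x'.
Proof.
have e1 : dotp (S x) d' = dotp x (adjoint S d') := adjointP S x d'.
have e2 : dotp d (S x') = dotp (adjoint S d) x'.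
  by rewrite -[LHS]dotpC adjointP dotpC.
have e3 : dotp (S (adjoint S d)) d' = dotp (adjoint S d) (adjoint S d') := adjointP S _ d'.
have e4 : dotp d (S (adjoint S d')) = dotp (adjoint S d) (adjoint S d').
  by rewrite -[LHS]dotpC adjointP dotpC.
have h2 : (2^-1 : C)^* = 2^-1 by rewrite fmorphV rmorph_nat.
rewrite /eichler_s /eichler_h !linearDl !linearDr /= !linearNl !linearNr /=.
rewrite linearZl_LR linearZr_LR /= e1 e2 e3 e4 h2.
by field.
Qed.

(** [p] and [m] change by the same vector, so that the difference of their forms
is linear in it and [eichler_form0] applies. *)
Lemma eichler_form x p m x' p' m' :
  dotp (eichler_h x (p - m)) (eichler_h x' (p' - m')) +
  dotp (p + eichler_s x (p - m)) (p' + eichler_s x' (p' - m')) -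
  dotp (m + eichler_s x (p - m)) (m' + eichler_s x' (p' - m')) =
  dotp x x' + dotp p p' - dotp m m'.
Proof.
rewrite -(eichler_form0 x (p - m) x' (p' - m')).
move: (eichler_s x (p - m)) (eichler_s x' (p' - m')) => s s'.
move: (dotp (eichler_h _ _) _) => t.
rewrite !linearDl !linearDr /= !linearNl !linearNr /=; ring.
Qed.

Lemma eichler_formE x p m x' p' m' :
  dotp (eichler_h x (p - m)) (eichler_h x' (p' - m')) =
  dotp x x' + dotp p p' - dotp m m' -
  dotp (p + eichler_s x (p - m)) (p' + eichler_s x' (p' - m')) +
  dotp (m + eichler_s x (p - m)) (m' + eichler_s x' (p' - m')).
Proof. by rewrite -eichler_form; ring. Qed.

(** The invariant [p - m] is read off the image, and determines [x], hence the
common change of [p] and [m]. *)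
Lemma eichler_inv (x1 : H) (p1 m1 : K) : exists x p m,
  [/\ eichler_h x (p - m) = x1, p + eichler_s x (p - m) = p1 & m + eichler_s x (p - m) = m1].
Proof.
pose d := p1 - m1; pose x := x1 + adjoint S d.
have dE (s : K) : p1 - s - (m1 - s) = d by rewrite opprB addrA subrK.
exists x, (p1 - eichler_s x d), (m1 - eichler_s x d).
by rewrite dE !subrK /eichler_h addrK.
Qed.

End Eichler.

Section Shifts.
Variables (R : realType) (H : hilbertType R).

Lemma sqn_if (b : bool) (x : H) : sqn ((if b then idop H else 0) x) <= 1 * sqn x.
Proof. by rewrite mul1r; case: b => //; rewrite op_zeroE sqn0 sqn_ge0. Qed.

Definition tailop : 'L(l2 H, l2 H) := wop succn (fun=> idop H).

Lemma tailopE (x : l2 H) n : tailop x n = x n.+1.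
Proof.
rewrite /tailop (@wopE _ _ _ succn (fun=> idop H) predT 1)//.
- by move=> _ y; exact: (sqn_if true).
- by move=> i j _ _ [].
Qed.

Definition shiftop : 'L(l2 H, l2 H) := wop predn (fun n => if n != 0%N then idop H else 0).

Lemma shiftopE (x : l2 H) n : shiftop x n = if n is m.+1 then x m else 0.
Proof.
rewrite /shiftop (@wopE _ _ _ predn (fun n => if n != 0%N then idop H else 0) (fun n => n != 0%N) 1)//.
- by case: n.
- by move=> i y; exact: sqn_if.
- by move=> i /negbTE ->.
- by move=> [|i] [|j] // _ _ /= ->.
Qed.

Definition consl (d : H) (q : l2 H) : l2 H := injop H 0 d + shiftop q.

Lemma conslE d q n : consl d q n = if n is m.+1 then q m else d.
Proof.
rewrite /consl l2_addE injopE shiftopE.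
by case: n => [|n]; rewrite ?addr0 ?add0r.
Qed.

Lemma consl_tail (q : l2 H) : consl (q 0%N) (tailop q) = q.
Proof. by apply/l2_eqP => -[|n]; rewrite conslE// tailopE. Qed.

Lemma tail_consl d q : tailop (consl d q) = q.
Proof. by apply/l2_eqP => n; rewrite tailopE conslE. Qed.

Variable J : 'L(H, H).
Hypothesis JS : canonical_symmetry J.

Definition liftop : 'L(l2 H, l2 H) := wop id (fun=> J).

Lemma liftopE (x : l2 H) n : liftop x n = J (x n).
Proof.
have [Js JK] := symmetryP JS.
rewrite /liftop (@wopE _ _ _ id (fun=> J) predT 1)// => _ y.
by rewrite mul1r /sqn Js JK.
Qed.

Lemma symmetry_lift : canonical_symmetry liftop.
Proof.
have [Js JK] := symmetryP JS; apply: symmetry_of => [x y|x].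
  by apply: l2dot_ext => n; rewrite !liftopE Js.
by apply/l2_eqP => n; rewrite !liftopE JK.
Qed.

Lemma liftop_recl (x y : l2 H) : dotp (liftop x) y =
  dotp (J (x 0%N)) (y 0%N) + dotp (liftop (tailop x)) (tailop y).
Proof.
rewrite (@l2dot_recl _ _ _ _ (liftop (tailop x)) (tailop y)) ?liftopE// => n.
  by rewrite !liftopE tailopE.
by rewrite tailopE.
Qed.

End Shifts.

Lemma sum_delta (R : realType) (N : nat) (k0 : 'I_N) (z : 'rV[R[i]]_N) (W : lmodType R[i]) (w : W) :
  \sum_(k < N) z 0 k *: ((k == k0)%:R *: w) = z 0 k0 *: w.
Proof.
rewrite (bigD1 k0) //= eqxx scale1r big1 ?addr0// => k /negbTE ->.
by rewrite scale0r scaler0.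
Qed.

Lemma unimodular_dot (R : realType) (W : hilbertType R) (c : R[i]) (a b : W) : `|c| = 1 ->
  dotp (c *: a) (c *: b) = dotp a b.
Proof.
move=> c1; rewrite linearZl_LR linearZr_LR /= mulrA -normCK c1 expr1n.
by rewrite mul1r.
Qed.

Section Core.
Variables (R : realType) (N : nat) (k0 : 'I_N) (H1 V H2 : hilbertType R).
Variables (S1 : 'L(H1, V)) (S2 : 'L(V, H2)) (P : 'I_N -> 'L(V, V)).
Local Notation C := R[i].

(** The indefinite form [|a| ^ 2 - |b| ^ 2]. *)
Definition jpm (A B : hilbertType R) : 'L(hsum A B, hsum A B) :=
  block_op (idop A) 0 0 (- idop B).

Lemma symmetry_jpm (A B : hilbertType R) : canonical_symmetry (jpm A B).
Proof. exact: symmetry_block (symmetry_id A) (symmetry_opp B). Qed.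

Lemma jpm_form (A B : hilbertType R) (a b : hsum A B) :
  dotp (jpm A B a) b = dotp a.1 b.1 - dotp a.2 b.2.
Proof. by rewrite /jpm block_diagE hsum_dotE /= linearNl. Qed.

Local Notation Din := (hsum (hsum V V) (hsum H2 H2)).
Local Notation Dout := (hsum (hsum H1 V) (hsum V H2)).
Local Notation Mid := (hsum (hsum H1 V) (hsum V (hsum H2 H2))).

Definition jin : 'L(Din, Din) := block_op (jpm V V) 0 0 (jpm H2 H2).
Definition jout : 'L(Dout, Dout) := block_op (jpm H1 V) 0 0 (jpm V H2).

Lemma symmetry_jin : canonical_symmetry jin.
Proof. exact: symmetry_block (symmetry_jpm _ _) (symmetry_jpm _ _). Qed.
Lemma symmetry_jout : canonical_symmetry jout.
Proof. exact: symmetry_block (symmetry_jpm _ _) (symmetry_jpm _ _). Qed.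

(** The form between the transvections: + on [H1], - on the first [m] channel, + on
[V], and + and - on the two channels that only the second transvection moves. *)
Definition mid_form (a b : Mid) : C :=
  dotp a.1.1 b.1.1 - dotp a.1.2 b.1.2 + dotp a.2.1 b.2.1
  + (dotp a.2.2.1 b.2.2.1 - dotp a.2.2.2 b.2.2.2).

(** The transvection of [S1], with its three components sorted so that the [p]
channel, which carries [S1 h], meets [P]. *)
Definition core_in : 'L(hsum H1 Din, Mid) :=
  let p : 'L(hsum H1 Din, V) := pr1 _ _ *o pr1 _ _ *o pr2 _ _ in
  let m : 'L(hsum H1 Din, V) := pr2 _ _ *o pr1 _ _ *o pr2 _ _ in
  let s := S1 *o pr1 _ _ - 2^-1 *: (S1 *o adjoint S1 *o (p - m)) in
  pairop (pairop (pr1 _ _ - adjoint S1 *o (p - m)) (m + s))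
         (pairop (p + s) (pr2 _ _ *o pr2 _ _)).

Lemma core_inE h p m t : core_in (h, ((p, m), t)) =
  ((eichler_h S1 h (p - m), m + eichler_s S1 h (p - m)),
   (p + eichler_s S1 h (p - m), t)).
Proof. by []. Qed.

(** The transvection of [S2], applied to the channel that leaves [P]. *)
Definition core_out : 'L(Mid, hsum H2 Dout) :=
  let v : 'L(Mid, V) := pr1 _ _ *o pr2 _ _ in
  let p : 'L(Mid, H2) := pr1 _ _ *o pr2 _ _ *o pr2 _ _ in
  let m : 'L(Mid, H2) := pr2 _ _ *o pr2 _ _ *o pr2 _ _ in
  let s := S2 *o v - 2^-1 *: (S2 *o adjoint S2 *o (p - m)) in
  pairop (p + s) (pairop (pr1 _ _) (pairop (v - adjoint S2 *o (p - m)) (m + s))).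

Lemma core_outE h v p m : core_out (h, (v, (p, m))) =
  (p + eichler_s S2 v (p - m),
   (h, (eichler_h S2 v (p - m), m + eichler_s S2 v (p - m)))).
Proof. by []. Qed.

(** All channels other than [V] are multiplied by the coordinate [k0], which keeps
the pencil homogeneous of degree one in z. *)
Definition core_mid (k : 'I_N) : 'L(Mid, Mid) :=
  block_op ((k == k0)%:R *: idop _) 0 0 (block_op (P k) 0 0 ((k == k0)%:R *: idop _)).

Definition core (k : 'I_N) : 'L(hsum H1 Din, hsum H2 Dout) :=
  core_out *o core_mid k *o core_in.

Lemma core_midE k h v t : core_mid k (h, (v, t)) =
  ((k == k0)%:R *: h, (P k v, (k == k0)%:R *: t)).
Proof. by rewrite /core_mid !block_diagE. Qed.

Lemma pencil_mid (z : 'rV[C]_N) h v t : pencil z core_mid (h, (v, t)) =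
  (z 0 k0 *: h, (pencil z P v, z 0 k0 *: t)).
Proof.
have e k : z 0 k *: core_mid k (h, (v, t)) =
  ((z 0 k *: ((k == k0)%:R *: h), (z 0 k *: P k v, z 0 k *: ((k == k0)%:R *: t))) : Mid).
  by rewrite core_midE.
rewrite [LHS]pencilE; apply: (etrans (eq_bigr _ (fun k _ => e k))).
apply: (etrans (pair_sum _ _ _)); congr (_, _); first exact: sum_delta.
apply: (etrans (pair_sum _ _ _)); congr (_, _); last exact: sum_delta.
by rewrite pencilE.
Qed.

Opaque core_in core_out core_mid.

Lemma pencil_core (z : 'rV[C]_N) e :
  pencil z core e = core_out (pencil z core_mid (core_in e)).
Proof. exact: pencil_comp. Qed.

Lemma jin_form (a b : Din) : dotp (jin a) b =
  dotp a.1.1 b.1.1 - dotp a.1.2 b.1.2 + (dotp a.2.1 b.2.1 - dotp a.2.2 b.2.2).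
Proof. by rewrite /jin block_diagE hsum_dotE !jpm_form. Qed.

Lemma jout_form (a b : Dout) : dotp (jout a) b =
  dotp a.1.1 b.1.1 - dotp a.1.2 b.1.2 + (dotp a.2.1 b.2.1 - dotp a.2.2 b.2.2).
Proof. by rewrite /jout block_diagE hsum_dotE !jpm_form. Qed.

Lemma core_in_form e e' : mid_form (core_in e) (core_in e') =
  dotp e.1 e'.1 + dotp (jin e.2) e'.2.
Proof.
case: e e' => [h [[p m] t]] [h' [[p' m'] t']].
rewrite !core_inE jin_form /mid_form; cbn [fst snd].
rewrite eichler_formE.
move: (dotp (p + _) _) (dotp (m + _) _) => A B.
by ring.
Qed.

Lemma core_in_surj a : exists e, core_in e = a.
Proof.
case: a => [[h m] [p t]].
have [h' [p' [m' [e1 e2 e3]]]] := eichler_inv S1 h p m.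
by exists (h', ((p', m'), t)); rewrite core_inE e1 e2 e3.
Qed.

Lemma core_out_form a b : dotp (core_out a).1 (core_out b).1 +
  dotp (jout (core_out a).2) (core_out b).2 = mid_form a b.
Proof.
case: a b => [[h n] [v [p m]]] [[h' n'] [v' [p' m']]].
rewrite !core_outE jout_form /mid_form; cbn [fst snd].
rewrite eichler_formE.
move: (dotp (p + _) _) (dotp (m + _) _) => A B.
by ring.
Qed.

Lemma core_out_surj e : exists a, core_out a = e.
Proof.
case: e => [y [h [v m]]].
have [v' [p' [m' [e1 e2 e3]]]] := eichler_inv S2 v y m.
by exists (h, (v', (p', m'))); rewrite core_outE e1 e2 e3.
Qed.

Variable z : 'rV[C]_N.
Hypothesis z1 : `|z 0 k0| = 1.

Lemma core_iso e e' :
  (forall a b, dotp (pencil z P a) (pencil z P b) = dotp a b) ->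
  dotp (pencil z core e).1 (pencil z core e').1 +
  dotp (jout (pencil z core e).2) (pencil z core e').2 =
  dotp e.1 e'.1 + dotp (jin e.2) e'.2.
Proof.
move=> Piso; rewrite !pencil_core core_out_form -core_in_form.
case: (core_in e) (core_in e') => [[h n] [v [p m]]] [[h' n'] [v' [p' m']]].
rewrite !pencil_mid /mid_form; cbn [fst snd].
by rewrite Piso !unimodular_dot.
Qed.

Lemma core_surj y : (forall b, exists a, pencil z P a = b) -> exists x, pencil z core x = y.
Proof.
move=> Psur; have [[h [v t]] <-] := core_out_surj y.
have z0 : z 0 k0 != 0 by rewrite -normr_gt0 z1.
have [v' v'E] := Psur v.
have [e eE] := core_in_surj ((z 0 k0)^-1 *: h, (v', (z 0 k0)^-1 *: t)).
exists e; rewrite pencil_core eE pencil_mid v'E !scalerA divff// !scale1r.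
by [].
Qed.

End Core.

(** Without defect input the first [p] channel is [S1 h], and the second one ends
as [S2 (P(z) S1 h)]. *)
Lemma core_zero (R : realType) (N : nat) (k0 : 'I_N) (H1 V H2 : hilbertType R)
    (S1 : 'L(H1, V)) (S2 : 'L(V, H2)) (P : 'I_N -> 'L(V, V)) (z : 'rV[R[i]]_N) h :
  (pencil z (core k0 S1 S2 P) (h, 0)).1 = S2 (pencil z P (S1 h)).
Proof.
rewrite pencil_core core_inE pencil_mid.
have -> : z 0 k0 *: ((0, 0) : hsum H2 H2) = (0, 0).
  by rewrite -[LHS]/((z 0 k0 *: 0, z 0 k0 *: 0) : hsum H2 H2) scaler0.
rewrite core_outE; cbn [fst snd].
by rewrite !subrr !eichler_s0 !add0r.
Qed.

Section Feedback.
Variables (R : realType) (N : nat) (k0 : 'I_N) (X U Y D E : hilbertType R).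
Variable W : 'I_N -> 'L(hsum (hsum X U) D, hsum (hsum X Y) E).
Variables (jD : 'L(D, D)) (jE : 'L(E, E)).
Hypotheses (jDs : canonical_symmetry jD) (jEs : canonical_symmetry jE).
Local Notation C := R[i].
Local Notation Xd := (hsum X (hsum (l2 D) (l2 E))).

Definition fb_J : 'L(Xd, Xd) :=
  block_op (idop X) 0 0 (block_op (liftop jD) 0 0 (liftop jE)).

Lemma symmetry_fb : canonical_symmetry fb_J.
Proof.
apply: symmetry_block; first exact: symmetry_id.
by apply: symmetry_block; exact: symmetry_lift.
Qed.

Definition fb_in : 'L(hsum Xd U, hsum (hsum X U) D) :=
  pairop (pairop (pr1 _ _ *o pr1 _ _) (pr2 _ _))
         (coord D 0 *o pr1 _ _ *o pr2 _ _ *o pr1 _ _).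

(** The first coordinate of the [l2 D] state is the defect input of [W], the others
move one place towards 0; the defect output of [W] enters the [l2 E] state at
coordinate 0, and what was stored there moves one place away from 0. *)
Definition fb_G (k : 'I_N) : 'L(hsum Xd U, hsum Xd Y) :=
  let w := W k *o fb_in in
  let d : R[i] := (k == k0)%:R in
  pairop (pairop (pr1 _ _ *o pr1 _ _ *o w)
    (pairop (d *: (tailop D *o pr1 _ _ *o pr2 _ _ *o pr1 _ _))
       (injop E 0 *o pr2 _ _ *o w + d *: (shiftop E *o pr2 _ _ *o pr2 _ _ *o pr1 _ _))))
   (pr2 _ _ *o pr1 _ _ *o w).

Lemma fb_GE k x p q u : fb_G k ((x, (p, q)), u) =
  (((W k ((x, u), p 0%N)).1.1,
   ((k == k0)%:R *: tailop D p,
    injop E 0 (W k ((x, u), p 0%N)).2 + (k == k0)%:R *: shiftop E q)),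
   (W k ((x, u), p 0%N)).1.2).
Proof. by []. Qed.

Lemma fst_sum (A B : hilbertType R) (I : Type) (r : seq I) (f : I -> hsum A B) :
  (\sum_(i <- r) f i).1 = \sum_(i <- r) (f i).1.
Proof. by elim: r => [|i r IH]; rewrite ?big_nil// !big_cons -IH. Qed.

Lemma snd_sum (A B : hilbertType R) (I : Type) (r : seq I) (f : I -> hsum A B) :
  (\sum_(i <- r) f i).2 = \sum_(i <- r) (f i).2.
Proof. by elim: r => [|i r IH]; rewrite ?big_nil// !big_cons -IH. Qed.

Lemma pencil_fb (z : 'rV[C]_N) x p q u : pencil z fb_G ((x, (p, q)), u) =
  (((pencil z W ((x, u), p 0%N)).1.1,
    (z 0 k0 *: tailop D p, consl (pencil z W ((x, u), p 0%N)).2 (z 0 k0 *: q))),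
   (pencil z W ((x, u), p 0%N)).1.2).
Proof.
have e k : z 0 k *: fb_G k ((x, (p, q)), u) =
  ((((z 0 k *: W k ((x, u), p 0%N)).1.1,
   (z 0 k *: ((k == k0)%:R *: tailop D p),
    z 0 k *: (injop E 0 (W k ((x, u), p 0%N)).2 + (k == k0)%:R *: shiftop E q))),
   (z 0 k *: W k ((x, u), p 0%N)).1.2) : hsum Xd Y).
  by rewrite fb_GE.
rewrite [LHS]pencilE; apply: (etrans (eq_bigr _ (fun k _ => e k))).
apply: (etrans (pair_sum _ _ _)); congr (_, _); last first.
  by rewrite pencilE !fst_sum snd_sum.
apply: (etrans (pair_sum _ _ _)); congr (_, _).
  by rewrite pencilE !fst_sum.
apply: (etrans (pair_sum _ _ _)); congr (_, _); first exact: sum_delta.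
under eq_bigr => k _ do rewrite scalerDr.
rewrite big_split /= sum_delta /consl; congr (_ + _); last by rewrite linearZ.
rewrite pencilE snd_sum linear_sum; apply: eq_bigr => k _.
rewrite (_ : (z 0 k *: W k ((x, u), p 0%N)).2 = z 0 k *: (W k ((x, u), p 0%N)).2)//.
by rewrite linearZ.
Qed.

Opaque fb_G.

Hypothesis Wiso : forall z : 'rV[C]_N, (forall k, `|z 0 k| = 1) -> forall e e',
  dotp (pencil z W e).1 (pencil z W e').1 + dotp (jE (pencil z W e).2) (pencil z W e').2 =
  dotp e.1 e'.1 + dotp (jD e.2) e'.2.
Hypothesis Wsur : forall z : 'rV[C]_N, (forall k, `|z 0 k| = 1) -> forall y,
  exists x, pencil z W x = y.

(** [W(z)] consumes the first coordinate of the incoming sequence and produces the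
first coordinate of the outgoing one, at balanced forms; the tails are only
shifted and multiplied by the unimodular [z k0]. *)
Theorem feedback_conservative : J_conservative (system_of fb_G) fb_J.
Proof.
apply: (conservative_of symmetry_fb) => z z1.
  move=> [[x [p q]] u] [[x' [p' q']] u'].
  rewrite !pencil_fb !block_diagE !hsum_dotE [idop U _]/= [idop Y _]/=; cbn [fst snd].
  have := Wiso z1 ((x, u), p 0%N) ((x', u'), p' 0%N).
  rewrite !hsum_dotE; cbn [fst snd].
  move: (pencil z W ((x, u), p 0%N)) (pencil z W ((x', u'), p' 0%N)) => [[a b] c] [[a' b'] c'].
  cbn [fst snd] => h.
  have e1 : dotp (liftop jD (z 0 k0 *: tailop D p)) (z 0 k0 *: tailop D p') =
    dotp (liftop jD (tailop D p)) (tailop D p').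
    rewrite (_ : liftop jD (z 0 k0 *: tailop D p) = z 0 k0 *: liftop jD (tailop D p)).
      by rewrite unimodular_dot.
    by rewrite linearZ.
  have e2 : dotp (liftop jE (z 0 k0 *: q)) (z 0 k0 *: q') = dotp (liftop jE q) q'.
    rewrite (_ : liftop jE (z 0 k0 *: q) = z 0 k0 *: liftop jE q).
      by rewrite unimodular_dot.
    by rewrite linearZ.
  rewrite -[idop X a]/a -[idop X x]/x e1 (liftop_recl jEs) !tail_consl !conslE e2.
  rewrite (liftop_recl jDs p p').
  have -> : dotp (jE c) c' = dotp x x' + dotp u u' + dotp (jD (p 0%N)) (p' 0%N)
     - (dotp a a' + dotp b b') by rewrite -h; ring.
  by ring.
move=> [[a [t r]] b].
have z0 : z 0 k0 != 0 by rewrite -normr_gt0 z1.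
have [[[x u] d] xE] := Wsur z1 ((a, b), r 0%N).
exists ((x, (consl d ((z 0 k0)^-1 *: t), (z 0 k0)^-1 *: tailop E r)), u).
rewrite pencil_fb conslE tail_consl xE !scalerA divff// !scale1r.
by rewrite consl_tail.
Qed.

Lemma geometric_l2 (c : C) (d : E) : normc c <= 2^-1 ->
  exists q : l2 E, forall n, q n = c ^+ n *: d.
Proof.
move=> c2.
have B n : \sum_(i < n) sqn (c ^+ i *: d) <= 2 * sqn d.
  have key : \sum_(i < n) sqn (c ^+ i *: d) <= (2 - 2 * 2^-1 ^+ n) * sqn d.
    elim: n => [|n IH]; first by rewrite big_ord0 expr0 mulr1 subrr mul0r.
    rewrite big_ord_recr /=.
    apply: (@le_trans _ _ ((2 - 2 * 2^-1 ^+ n) * sqn d + 2^-1 ^+ n * sqn d)).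
      apply: lerD => //; rewrite sqnZ; apply: ler_wpM2r; first exact: sqn_ge0.
      rewrite normcX -exprM mulnC exprM.
      have n0 := normc_ge0 c.
      have h : normc c ^+ 2 <= 2^-1 by move: n0 c2; move: (normc c) => r; nra.
      by apply: lerXn2r; rewrite ?nnegrE ?exprn_ge0 ?invr_ge0.
    have -> : (2 - 2 * 2^-1 ^+ n.+1) = (2 - 2 * 2^-1 ^+ n) + 2^-1 ^+ n :> R.
      by rewrite exprS; field.
    by rewrite [leRHS]mulrDl.
  apply: le_trans key _; apply: ler_wpM2r; first exact: sqn_ge0.
  by rewrite gerBl mulr_ge0// exprn_ge0// invr_ge0.
by exists (@mk_l2 _ _ (fun n => c ^+ n *: d) _ B).
Qed.

(** With the incoming sequence equal to 0, the outgoing one must satisfy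
[q = (d, z_(k0) q)], whose solution is the geometric sequence. *)
Theorem feedback_solution (z : 'rV[C]_N) (x : X) (u : U) (y : Y) :
  normc (z 0 k0) <= 2^-1 -> (pencil z W ((x, u), 0)).1 = (x, y) ->
  exists xd, pencil z (sysG (system_of fb_G)) (xd, u) = (xd, y).
Proof.
move=> z2 sol; rewrite system_ofG.
have [q qE] := geometric_l2 (pencil z W ((x, u), 0)).2 z2.
exists (x, (0, q)); rewrite pencil_fb l2_zeroE sol linear0 scaler0; cbn [fst snd].
have -> // : consl (pencil z W ((x, u), 0)).2 (z 0 k0 *: q) = q.
apply/l2_eqP => -[|n]; rewrite conslE qE ?expr0 ?scale1r//.
by rewrite l2_scaleE qE scalerA -exprS.
Qed.

End Feedback.

Section Fan.
Variables (R : realType) (N : nat) (k0 : 'I_N) (H1 H2 : hilbertType R).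
Variable T : 'I_N -> 'L(H1, H2).
Local Notation C := R[i].
Local Notation V := (l2 H1).

(** Coordinates beyond the first N are multiplied by [z k0] as well, so that the
diagonal operator is unitary on all of l2. *)
Definition sel (i : nat) : 'I_N := insubd k0 i.

Lemma sel_ord (k : 'I_N) : sel k = k.
Proof. by apply/val_inj; rewrite /sel val_insubd ltn_ord. Qed.

Definition fanout : 'L(H1, V) := \sum_(k < N) injop H1 k.
Definition fanin : 'L(V, H2) := \sum_(k < N) T k *o coord H1 k.
Definition selop (k : 'I_N) : 'L(V, V) :=
  wop id (fun i => if sel i == k then idop H1 else 0).

Lemma fanoutE h i : fanout h i = if (i < N)%N then h else 0.
Proof.
rewrite /fanout op_sumE -[LHS]/(coord H1 i (\sum_(k < N) injop H1 k h)).
rewrite linear_sum /=.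
case: ltnP => iN.
  rewrite (bigD1 (Ordinal iN)) //= injopE eqxx big1 ?addr0// => k ki.
  by rewrite injopE; case: eqP => // e; case/eqP: ki; apply/val_inj.
by apply: big1 => k _; rewrite injopE; case: eqP => // e; move: iN; rewrite e leqNgt ltn_ord.
Qed.

Lemma selopE k v i : selop k v i = if sel i == k then v i else 0.
Proof.
rewrite /selop (@wopE _ _ _ id (fun i => if sel i == k then idop H1 else 0) predT 1)//.
- by case: eqP.
- by move=> j y; exact: sqn_if.
Qed.

Lemma pencil_selop (z : 'rV[C]_N) v i : pencil z selop v i = z 0 (sel i) *: v i.
Proof.
have cE k : coord H1 i (z 0 k *: selop k v) = z 0 k *: (if sel i == k then v i else 0).
  by rewrite -selopE.
rewrite pencilE; transitivity (\sum_(k < N) coord H1 i (z 0 k *: selop k v)).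
  exact: (linear_sum (coord H1 i)).
rewrite (eq_bigr _ (fun k _ => cE k)) (bigD1 (sel i)) //= eqxx big1 ?addr0// => k.
by rewrite eq_sym => /negbTE ->; rewrite scaler0.
Qed.

(** Only the first N coordinates carry a copy of [h], and each is multiplied by its
own [z k] before [T k] is applied. *)
Lemma fan_pencil (z : 'rV[C]_N) h : fanin (pencil z selop (fanout h)) = pencil z T h.
Proof.
rewrite /fanin op_sumE [RHS]pencilE; apply: eq_bigr => k _.
rewrite /= pencil_selop fanoutE ltn_ord sel_ord.
by rewrite linearZ.
Qed.

Lemma selop_iso (z : 'rV[C]_N) a b : (forall k, `|z 0 k| = 1) ->
  dotp (pencil z selop a) (pencil z selop b) = dotp a b.
Proof.
by move=> z1; apply: l2dot_ext => i; rewrite !pencil_selop unimodular_dot.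
Qed.

Lemma selop_surj (z : 'rV[C]_N) b : (forall k, `|z 0 k| = 1) ->
  exists a, pencil z selop a = b.
Proof.
move=> z1; have z0 k : z 0 k != 0 by rewrite -normr_gt0 z1.
exists (pencil (\row_k (z 0 k)^-1) selop b).
by apply/l2_eqP => i; rewrite !pencil_selop mxE scalerA divff// scale1r.
Qed.

End Fan.

Section Dilation.
Variables (R : realType) (N : nat) (k0 : 'I_N) (X U Y : hilbertType R).
Variable alpha : lin_system N X U Y.
Hypotheses (sX : sepseq X) (sU : sepseq U) (sY : sepseq Y).

(** The transfer functions are compared through solutions of the state equation,
which extend to the dilation when states for the defect channels are adjoined. *)
Theorem conservative_dilation : exists (Xd : hilbertType R) (beta : lin_system N Xd U Y)
    (J : 'L(Xd, Xd)),
  [/\ sepseq Xd, canonical_symmetry J, J_conservative beta J &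
    forall (z : 'rV[R[i]]_N) x u y, normc (z 0 k0) <= 2^-1 ->
      pencil z (sysG alpha) (x, u) = (x, y) ->
      exists xd, pencil z (sysG beta) (xd, u) = (xd, y)].
Proof.
pose W := core k0 (fanout N (hsum X U)) (fanin (sysG alpha)) (@selop R N k0 (hsum X U)).
have js1 := @symmetry_jin R (l2 (hsum X U)) (hsum X Y).
have js2 := @symmetry_jout R (hsum X U) (l2 (hsum X U)) (hsum X Y).
exists _, (system_of (fb_G k0 W)), (fb_J X (jin (l2 (hsum X U)) (hsum X Y))
   (jout (hsum X U) (l2 (hsum X U)) (hsum X Y))); split.
- have s1 := sepseq_hsum sX sU; have s2 := sepseq_hsum sX sY; have s3 := sepseq_l2 s1.
  apply: sepseq_hsum => //; apply: sepseq_hsum; apply: sepseq_l2; apply: sepseq_hsum;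
   by apply: sepseq_hsum.
- exact: symmetry_fb.
- apply: feedback_conservative => // z z1.
  + by move=> e e'; apply: core_iso => // a b; exact: selop_iso.
  + by move=> y; apply: core_surj => // b; exact: selop_surj.
- move=> z x u y z2 sol; apply: feedback_solution z2 _.
  by rewrite core_zero fan_pencil; exact: sol.
Qed.

End Dilation.

(** * Words, sesquilinear forms and complex slices *)

Section Words.
Variables (N : nat) (k0 : 'I_N).

(** Words in ['I_N] are numbered as the nodes of the N-ary heap: the children of
[n] are [N n + 1, ..., N n + N]. The empty word is 0. The argument [fuel] only
serves termination. *)
Fixpoint heap_word (fuel n : nat) : seq 'I_N :=
  if fuel is f.+1 then
    if n is m.+1 then rcons (heap_word f (m %/ N)) (insubd k0 (m %% N)%N) else [::]
  else [::].

Definition word n := heap_word n n.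
Definition child (n : nat) (k : 'I_N) := (N * n + k).+1.

Lemma heap_wordE f n : (n <= f)%N -> heap_word f n = word n.
Proof.
have Np : (0 < N)%N := leq_ltn_trans (leq0n _) (ltn_ord k0).
suff h m : forall f n, (n <= m)%N -> (n <= f)%N -> heap_word f n = word n by exact: (h n).
elim: m => [|m IH] [|f'] [|n'] //= nm nf.
have h1 : (n' %/ N <= n')%N by exact: leq_div.
rewrite /word /= (IH f')//; last 2 first.
- exact: leq_trans h1 nm.
- exact: leq_trans h1 nf.
by rewrite (IH n')//; exact: leq_trans h1 nm.
Qed.

Lemma word_child n k : word (child n k) = rcons (word n) k.
Proof.
have Np : (0 < N)%N := leq_ltn_trans (leq0n _) (ltn_ord k0).
rewrite /child {1}/word /= mulnC divnMDl// divn_small ?ltn_ord// addn0.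
rewrite modnMDl modn_small ?ltn_ord//.
rewrite heap_wordE; last by apply: leq_trans (leq_addr _ _); rewrite leq_pmulr.
by congr rcons; apply/val_inj; rewrite val_insubd ltn_ord.
Qed.

Lemma child_inj k : injective (child^~ k).
Proof.
have Np : (0 < N)%N := leq_ltn_trans (leq0n _) (ltn_ord k0).
by move=> m n [] /addIn /eqP; rewrite eqn_pmul2l// => /eqP.
Qed.

(** The first [N m + 1] nodes are the root and the children of the first [m]
nodes, so the partial sums satisfy [t (N m + 1) = 1 + N r t(m)]. *)
Lemma word_weight_sum (R : realType) (r : R) : 0 <= r -> N%:R * r <= 2^-1 ->
  forall m, \sum_(i < m) r ^+ size (word i) <= 2.
Proof.
have Np : (0 < N)%N := leq_ltn_trans (leq0n _) (ltn_ord k0).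
move=> r0 Nr.
have step m : \sum_(i < (N * m).+1) r ^+ size (word i) =
    1 + N%:R * r * \sum_(i < m) r ^+ size (word i).
  elim: m => [|m IH]; first by rewrite muln0 big_ord1 big_ord0 mulr0 addr0.
  rewrite mulnS addnC -addSn big_split_ord /= IH big_ord_recr /= mulrDr addrA; congr (_ + _).
  rewrite (eq_bigr (fun=> r * r ^+ size (word m))).
    by rewrite sumr_const card_ord -[LHS]mulr_natl mulrA.
  move=> k _; rewrite -exprS -(size_rcons (word m) k) -word_child.
  by rewrite /child addSn.
elim=> [|m IH]; first by rewrite big_ord0.
apply: (@le_trans _ _ (\sum_(i < (N * m).+1) r ^+ size (word i))).
  have h : (m.+1 <= (N * m).+1)%N by rewrite ltnS leq_pmull.
  rewrite -(subnKC h) big_split_ord /= lerDl; apply: sumr_ge0 => i _.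
  exact: exprn_ge0.
rewrite step; have h0 : 0 <= \sum_(i < m) r ^+ size (word i).
  by apply: sumr_ge0 => i _; exact: exprn_ge0.
have h1 : 0 <= N%:R * r by rewrite mulr_ge0.
move: h0 h1 IH Nr; move: (\sum_(i < m) _) (N%:R * r) => s t; nra.
Qed.

End Words.

Section Forms.
Variables (R : realType) (U Y : hilbertType R).
Local Notation C := R[i].

Lemma rnorm_CS (x y : Y) : normc (dotp x y) <= rnorm x * rnorm y.
Proof. by rewrite -lecR rmorphM /= -!rnormE -normCE dotp_CauchySchwarz. Qed.

(** Riesz representation in the second variable. *)
Lemma form_op (b : U -> Y -> C) (K : R) : 0 <= K ->
  (forall a u v y, b (a *: u + v) y = a * b u y + b v y) ->
  (forall a u y y', b u (a *: y + y') = a^* * b u y + b u y') ->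
  (forall u y, normc (b u y) <= K * (rnorm u * rnorm y)) ->
  exists T : 'L(U, Y), (forall u y, dotp (T u) y = b u y) /\
    forall u, rnorm (T u) <= K * rnorm u.
Proof.
move=> K0 bl br bK.
have /choice[t tP] u : exists v : Y, forall y, dotp v y = b u y.
  have [|y|v vP] := @riesz R Y (fun y => (b u y)^*) (K * rnorm u)%:C%C.
  - by move=> a y y'; rewrite br rmorphD rmorphM /= conjCK.
  - rewrite norm_conjC normCE rnormE -rmorphM lecR.
    by apply: le_trans (bK u y) _; rewrite mulrA.
  by exists v => y; rewrite -dotpC -vP conjCK.
have tl : linear t.
  move=> a u v; apply: dotp_nondeg => y.
  rewrite -[LHS]dotpC -[RHS]dotpC; congr (_^*).
  by rewrite tP bl linearPl /= !tP.
have tb u : rnorm (t u) <= K * rnorm u.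
  have [->|t0] := eqVneq (rnorm (t u)) 0; first by rewrite mulr_ge0// rnorm_ge0.
  have tp : 0 < rnorm (t u) by rewrite lt_def t0 rnorm_ge0.
  rewrite -(ler_pM2r tp) -expr2 sqr_rnorm -mulrA.
  apply: le_trans (bK u (t u)); rewrite -tP sqnE normc_real//; exact: sqn_ge0.
have tB u : `|t u| <= K%:C%C * `|u| by rewrite !rnormE -rmorphM lecR.
by exists (mk_boundedOp tl tB).
Qed.

Lemma op_form_eq (S T : 'L(U, Y)) : (forall u y, dotp (S u) y = dotp (T u) y) -> S = T.
Proof.
move=> h; apply/boundedOp_eqP => u; apply: dotp_nondeg => y.
by rewrite -[LHS]dotpC -[RHS]dotpC h.
Qed.

Lemma rnorm_opnorm (T : 'L(U, Y)) (c : R) u : `|T| <= c%:C%C -> rnorm (T u) <= c * rnorm u.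
Proof.
move=> Tc; rewrite -lecR rmorphM /= -!rnormE.
apply: le_trans (ler_opnorm T u) _; apply: ler_wpM2r => //.
Qed.

End Forms.

Section Slices.
Variables (R : realType) (N : nat) (U Y : hilbertType R).
Local Notation C := R[i].
Implicit Types (theta : 'rV[C]_N -> 'L(U, Y)).

(** The directional derivative along [v], tested against [u] and [y]. *)
Lemma diff_cdiff theta (a v : 'rV[C]_N) (u : U) (y : Y) (l : C) :
  differentiable theta (a + l *: v) -> cdiff (fun m => dotp (theta (a + m *: v) u) y) l.
Proof.
move=> h; have hv : derivable theta (a + l *: v) v by exact: diff_derivable.
move: hv => /cvg_ex[D /cvgrPdist_lt DP] {h}.
pose f m := dotp (theta (a + m *: v) u) y.
pose phi m := if m == l then dotp (D u) y else (f m - f l) / (m - l).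
exists phi; last first.
  move=> m; rewrite /phi; case: eqVneq => [->|ml]; first by rewrite subrr mulr0 addr0.
  by rewrite divfK ?subr_eq0// -[dotp _ y in RHS]/(f l) [RHS]addrC subrK.
apply/ccontP => e e0; pose K := rnorm u * rnorm y + 1.
have K0 : 0 < K by rewrite ltr_wpDl// mulr_ge0 ?rnorm_ge0.
have eK : 0 < (e / K)%:C%C :> C by rewrite ltcR divr_gt0.
have := DP _ eK; rewrite /dnbhs /within /= => /nbhs_ballP[d0 /= /complex_gt0[d dp ->] dP].
exists d => // m ml; rewrite /phi eqxx; case: eqVneq => [_|nml].
  by rewrite subrr normc0.
have ml0 : m - l != 0 by rewrite subr_eq0.
have := dP (m - l); rewrite -ball_normE /ball_ /= sub0r normrN normCE ltcR => /(_ ml ml0).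
have -> : (m - l) *: v + (a + l *: v) = a + m *: v.
  by rewrite addrCA scalerBl subrK.
move=> h; pose Q : 'L(U, Y) := D - (m - l)^-1 *: (theta (a + m *: v) - theta (a + l *: v)).
have QE : dotp (Q u) y = dotp (D u) y - (f m - f l) / (m - l).
  rewrite /Q op_addE op_oppE op_scaleE op_addE op_oppE linearBl /= linearZl_LR /=.
  by rewrite linearBl /= mulrC.
rewrite normcB -QE; apply: le_lt_trans (rnorm_CS _ _) _.
have Qe := @rnorm_opnorm _ _ _ Q (e / K) u (ltW h).
apply: (@le_lt_trans _ _ (e / K * (rnorm u * rnorm y))).
  by rewrite mulrA ler_wpM2r ?rnorm_ge0.
rewrite mulrAC ltr_pdivrMr// ltr_pM2l//.
by rewrite /K ltrDl.
Qed.

(** [theta] is continuous at 0, hence bounded by 1 on a small ball. *)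
Lemma small_ball theta (Gamma : set 'rV[C]_N) :
  open_nbhs (0 : 'rV[C]_N) Gamma -> holomorphic_on Gamma theta -> theta 0 = 0 ->
  exists2 r : R, 0 < r & forall z : 'rV[C]_N, (forall k, normc (z 0 k) < r) ->
    differentiable theta z /\ forall u, rnorm (theta z u) <= rnorm u.
Proof.
move=> [oG G0] hol t0.
have nG : nbhs (0 : 'rV[C]_N) Gamma by exact: open_nbhs_nbhs.
have c0 : theta z @[z --> (0 : 'rV[C]_N)] --> theta 0.
  exact: differentiable_continuous (hol _ G0).
have n1 : \forall z \near (0 : 'rV[C]_N), `|theta 0 - theta z| < 1.
  by move/cvgrPdist_lt : c0; apply.
have n2 : nbhs (0 : 'rV[C]_N) (Gamma `&` [set z | `|theta 0 - theta z| < 1]).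
  exact: filterI.
move/nbhs_ballP : n2 => [e /= /complex_gt0[r r0 ->] rP].
exists r => // z zr.
have [Gz tz] : (Gamma `&` [set z | `|theta 0 - theta z| < 1]) z.
  apply: rP; split; first by rewrite ltcR.
  move=> i j; rewrite (ord1 i) mxE -ball_normE /ball_ /= sub0r normrN normCE ltcR.
  exact: zr.
split; first exact: hol.
move=> u; rewrite -[leRHS]mul1r; apply: rnorm_opnorm.
by move: tz => /=; rewrite t0 sub0r normrN => /ltW.
Qed.

End Slices.

(** * Realization by weighted shifts along words *)

Section Realization.
Variables (R : realType) (N : nat) (k0 : 'I_N) (U Y : hilbertType R).
Local Notation C := R[i].
Variables (theta : 'rV[C]_N -> 'L(U, Y)) (r : R).
Hypotheses (r0 : 0 < r) (theta0 : theta 0 = 0).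
Hypothesis theta_hol : forall z : 'rV[C]_N, (forall k, normc (z 0 k) < r) ->
  differentiable theta z /\ forall u, rnorm (theta z u) <= rnorm u.
Implicit Types (w : 'I_N -> C) (u : U) (y : Y) (k : 'I_N).

(** Brings the polydisc of radius [r] to the unit polydisc. *)
Definition scaled w : 'rV[C]_N := \row_k (r%:C%C * w k).

Lemma scaled_small w k : polydisc w -> normc (scaled w 0 k) < r.
Proof.
by move=> wD; rewrite mxE normcM normc_real ?ltW// gtr_pMr.
Qed.

Definition entry u y w : C := dotp (theta (scaled w) u) y.

Lemma entry_hol u y : hol_poly (entry u y) (rnorm u * rnorm y).
Proof.
split=> [w wD|w wD k l l1].
  have [_ h] := theta_hol (fun k => scaled_small k wD).
  apply: le_trans (rnorm_CS _ _) _; apply: ler_wpM2r; first exact: rnorm_ge0.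
  exact: h.
pose a := scaled (upd w k 0); pose v : 'rV[C]_N := r%:C%C *: delta_mx 0 k.
have e m : scaled (upd w k m) = a + m *: v.
  apply/rowP => j; rewrite !mxE /upd eqxx /=.
  by case: (eqVneq j k) => _; rewrite ?mulr0 ?mulr1 ?addr0 ?add0r// mulrC.
rewrite (_ : (fun l => entry u y (upd w k l)) = fun m => dotp (theta (a + m *: v) u) y).
  apply: diff_cdiff; rewrite -e.
  by have [] := theta_hol (fun j => scaled_small j (upd_polydisc k wD l1)).
by apply/funext => m; rewrite /entry e.
Qed.

Local Notation L := (@dquot_const R).

Let L0 : 0 < L. Proof. exact: dquot_const_gt0. Qed.
Local Notation word := (word k0).

(** The operator F_v(w) of the word v = [word n], recovered from its entries. *)
Definition coef n w : 'L(U, Y) := xget 0 [set T : 'L(U, Y) |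
  (forall u y, dotp (T u) y = shifts (word n) (entry u y) w) /\
  forall u, rnorm (T u) <= L ^+ size (word n) * rnorm u].

Lemma coefP n w : polydisc w ->
  (forall u y, dotp (coef n w u) y = shifts (word n) (entry u y) w) /\
  forall u, rnorm (coef n w u) <= L ^+ size (word n) * rnorm u.
Proof.
move=> wD; apply: (xgetPex 0 (P := [set T : 'L(U, Y) |
  (forall u y, dotp (T u) y = shifts (word n) (entry u y) w) /\
  forall u, rnorm (T u) <= L ^+ size (word n) * rnorm u])).
apply: form_op.
- by rewrite exprn_ge0// ltW.
- move=> a u v y; rewrite -(shifts_lin _ a (entry_hol u y) (entry_hol v y) wD).
  by congr (shifts _ _ w); apply/funext => w'; rewrite /entry linearP linearPl.
- move=> a u y y'; rewrite -(shifts_lin _ (a^*) (entry_hol u y) (entry_hol u y') wD).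
  by congr (shifts _ _ w); apply/funext => w'; rewrite /entry linearPr.
- by move=> u y; have [h _] := shifts_hol (word n) (entry_hol u y); exact: h.
Qed.

Definition origin : 'I_N -> C := fun=> 0.

Lemma origin_polydisc : polydisc origin.
Proof. by move=> i; rewrite /origin normc0 ltr01. Qed.

Lemma coef_gleason n w : polydisc w ->
  coef n w = coef n origin + \sum_(k < N) w k *: coef (child n k) w.
Proof.
move=> wD; apply: op_form_eq => u y.
have [h _] := coefP n wD; have [h0 _] := coefP n origin_polydisc.
rewrite h (shifts_gleason _ (entry_hol u y) wD) op_addE linearDl /= h0; congr (_ + _).
rewrite op_sumE dotp_suml; apply: eq_bigr => k _.
have [hk _] := coefP (child n k) wD.
by rewrite op_scaleE linearZl_LR /= hk word_child.
Qed.

Lemma coef0 w : polydisc w -> coef 0 w = theta (scaled w).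
Proof.
by move=> wD; apply: op_form_eq => u y; have [h _] := coefP 0 wD; rewrite h.
Qed.

Local Notation s := (2 * N%:R * L).
(** With [s = 2 N L], the bound [L ^ |v|] of the coefficients becomes
[(1 / 2N) ^ |v|], whose squares are summable over the [N ^ m] words of every
length m. *)
Definition weight n : C := (s^-1 ^+ size (word n))%:C%C.

Let N0 : 0 < N%:R :> R.
Proof. by rewrite ltr0n (leq_ltn_trans (leq0n _) (ltn_ord k0)). Qed.

Let s0 : 0 < s.
Proof. by apply: (mulr_gt0 _ L0); apply: (mulr_gt0 _ N0); rewrite ltr0n. Qed.

Let rho := (L / s) ^+ 2.

Lemma rho_small : 0 <= rho /\ N%:R * rho <= 2^-1.
Proof.
have N1 : 1 <= N%:R :> R by rewrite ler1n (leq_ltn_trans (leq0n _) (ltn_ord k0)).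
have nL : L != 0 by rewrite gt_eqF.
have nN : N%:R != 0 :> R by rewrite gt_eqF.
have -> : rho = (4 * N%:R ^+ 2)^-1 by rewrite /rho; field; rewrite nN nL.
split; first by rewrite invr_ge0 mulr_ge0// exprn_ge0// ltW.
have -> : N%:R * (4 * N%:R ^+ 2)^-1 = (4 * N%:R)^-1 :> R by field.
by rewrite lef_pV2 ?posrE ?mulr_gt0//; lra.
Qed.

Lemma weight_sqn n (c : R) u (v : Y) : 0 <= c ->
  rnorm v <= c * L ^+ size (word n) * rnorm u ->
  sqn (weight n *: v) <= c ^+ 2 * sqn u * rho ^+ size (word n).
Proof.
move=> c0 vc; rewrite sqnZ /weight normc_real; last by rewrite exprn_ge0// invr_ge0 ltW.
set m := size _; rewrite -(sqr_rnorm v) -(sqr_rnorm u) -exprMn.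
have -> : c ^+ 2 * rnorm u ^+ 2 * rho ^+ m = (s^-1 ^+ m * (c * L ^+ m * rnorm u)) ^+ 2.
  have -> : rho ^+ m = (s^-1 ^+ m * L ^+ m) ^+ 2.
    by rewrite /rho -exprM mulnC exprM expr_div_n mulrC exprVn.
  by move: (s^-1 ^+ m) (L ^+ m) (rnorm u) => a b d; ring.
have p0 : 0 <= s^-1 ^+ m by apply: exprn_ge0; rewrite invr_ge0 ltW.
have q0 : 0 <= c * L ^+ m * rnorm u := le_trans (rnorm_ge0 v) vc.
rewrite ler_sqr ?nnegrE; last exact: mulr_ge0.
  exact: ler_wpM2l.
exact: mulr_ge0 p0 (rnorm_ge0 _).
Qed.

Lemma weight_sum (c : R) u m : 0 <= c ->
  \sum_(i < m) (c * sqn u * rho ^+ size (word i)) <= c * 2 * sqn u.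
Proof.
move=> c0; have [h1 h2] := rho_small; rewrite -mulr_sumr [leRHS]mulrAC.
by apply: ler_wpM2l; [rewrite mulr_ge0// sqn_ge0|exact: word_weight_sum].
Qed.

Lemma weight_child n k : weight n = s%:C%C * weight (child n k).
Proof.
rewrite /weight word_child size_rcons exprS.
have e : s^-1 ^+ size (word n) = s * (s^-1 * s^-1 ^+ size (word n)).
  by rewrite mulVKf ?gt_eqF.
by rewrite [in LHS]e [in LHS]rmorphM.
Qed.

(** The factor [s] undoes the quotient of consecutive weights, and [1 / r] undoes
the rescaling of the polydisc. *)
Definition realA k : 'L(l2 Y, l2 Y) := wop (fun n => child n k) (fun=> (s / r)%:C%C *: idop Y).
Definition realB k : 'L(U, l2 Y) :=
  colop (fun n => (weight n * (r^-1)%:C%C) *: coef (child n k) origin).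
Definition realC k : 'L(l2 Y, Y) := (s / r)%:C%C *: coord Y (child 0 k).
Definition realD k : 'L(U, Y) := (r^-1)%:C%C *: coef (child 0 k) origin.

Definition realization : lin_system N (l2 Y) U Y := LinSystem realA realB realC realD.

Lemma realAE k x n : realA k x n = (s / r)%:C%C *: x (child n k).
Proof.
rewrite /realA (@wopE _ _ _ (fun n => child n k) (fun=> (s / r)%:C%C *: idop Y) predT
  (normc (s / r)%:C%C ^+ 2))//.
- by rewrite exprn_ge0// normc_ge0.
- by move=> _ y; rewrite op_scaleE sqnZ.
- by move=> i j _ _; exact: child_inj.
Qed.

Lemma realBE k u n : realB k u n = (weight n * (r^-1)%:C%C) *: coef (child n k) origin u.
Proof.
have rV0 : 0 < r^-1 by rewrite invr_gt0.
have c0 : 0 <= r^-1 * L by exact: mulr_ge0 (ltW rV0) (ltW L0).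
have c2 : 0 <= (r^-1 * L) ^+ 2 by exact: exprn_ge0.
have c3 : 0 <= (r^-1 * L) ^+ 2 * 2 by exact: mulr_ge0.
rewrite /realB (colopE c3)// => m v; apply: le_trans (weight_sum v m c2).
apply: ler_sum => i _; rewrite op_scaleE -scalerA; apply: (weight_sqn c0).
rewrite rnormZ (normc_real (ltW rV0)) -!mulrA ler_pM2l//.
have [_ h] := coefP (child i k) origin_polydisc.
by apply: le_trans (h v) _; rewrite word_child size_rcons exprS -!mulrA.
Qed.

Lemma state_exists w u : polydisc w -> exists x : l2 Y,
  forall n, x n = weight n *: (coef n w u - coef n origin u).
Proof.
move=> wD.
have B m : \sum_(i < m) sqn (weight i *: (coef i w u - coef i origin u)) <= 2 ^+ 2 * 2 * sqn u.
  apply: le_trans (weight_sum u m _); last by rewrite exprn_ge0.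
  apply: ler_sum => i _; apply: weight_sqn => //.
  have [_ h1] := coefP i wD; have [_ h2] := coefP i origin_polydisc.
  apply: le_trans (rnormD _ _) _; rewrite rnormN -mulrA mulr_natl mulr2n.
  by apply: lerD.
by exists (@mk_l2 _ _ (fun n => weight n *: (coef n w u - coef n origin u)) _ B).
Qed.

(** The state and the output equations are the identity [coef_gleason] at the word
[n], respectively at the empty word, where the constant term vanishes because
[theta 0 = 0]. *)
Theorem realization_solution (z : 'rV[C]_N) u : (forall k, normc (z 0 k) < r) ->
  exists x, pencil z (sysG realization) (x, u) = (x, theta z u).
Proof.
move=> zr; pose w k : C := z 0 k / r%:C%C.
have rC : r%:C%C != 0 :> C by rewrite -normc_gt0 normc_real// ltW.
have wD : polydisc w.
  by move=> k; rewrite /w normcM normcV (normc_real (ltW r0)) ltr_pdivrMr// mul1r.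
have zE : scaled w = z by apply/rowP => k; rewrite mxE /w mulrC divfK.
have [x xE] := state_exists u wD; exists x; rewrite pencil_sysG.
have gl n : \sum_(k < N) w k *: coef (child n k) w u = coef n w u - coef n origin u.
  rewrite [in RHS](coef_gleason n wD) op_addE op_sumE addrAC subrr add0r.
  by apply: eq_bigr.
have rV : (r^-1)%:C%C = r%:C%C^-1 :> C by rewrite fmorphV.
have sr : (s / r)%:C%C = s%:C%C * r%:C%C^-1 :> C by rewrite -rV [LHS]rmorphM.
congr (_, _).
  apply/l2_eqP => n; rewrite xE -gl scaler_sumr !pencilE -big_split /=.
  rewrite -[LHS]/(coord Y n (\sum_(k < N) (z 0 k *: realA k x + z 0 k *: realB k u))).
  rewrite linear_sum; apply: eq_bigr => k _.
  rewrite -scalerDr -[LHS]/(z 0 k *: (realA k x n + realB k u n)) realAE realBE xE.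
  rewrite [X in X + _]scalerA rV (_ : (s / r)%:C%C * weight (child n k) = weight n * r%:C%C^-1); last first.
    by rewrite sr (weight_child n k) mulrAC.
  by rewrite -scalerDr subrK !scalerA; congr (_ *: _); rewrite /w; ring.
rewrite !pencilE -big_split /= -zE -(coef0 wD).
have c00 : coef 0 origin = 0.
  rewrite (coef0 origin_polydisc) (_ : scaled origin = 0)//.
  by apply/rowP => k; rewrite !mxE mulr0.
have := gl 0%N; rewrite c00 op_zeroE subr0 => <-; apply: eq_bigr => k _.
rewrite zE -scalerDr.
rewrite (_ : _ + _ = (s / r)%:C%C *: x (child 0 k) +
  (r^-1)%:C%C *: coef (child 0 k) origin u)// xE [X in X + _]scalerA rV.
rewrite (_ : (s / r)%:C%C * weight (child 0 k) = r%:C%C^-1).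
  by rewrite -scalerDr subrK scalerA.
by rewrite sr mulrAC -(weight_child 0 k) /weight expr0 mul1r.
Qed.

End Realization.

(** * The conservative realization *)

Lemma pencil_small (R : realType) (N : nat) (H : hilbertType R) (A : 'I_N -> 'L(H, H)) :
  exists2 d : R, 0 < d & forall z : 'rV[R[i]]_N, (forall k, normc (z 0 k) < d) ->
    forall x, rnorm (pencil z A x) <= 2^-1 * rnorm x.
Proof.
have /choice[c cP] k : exists c : R, 0 <= c /\ forall x, rnorm (A k x) <= c * rnorm x.
  by have [c c0 cA] := rnorm_bounded (A k); exists c.
pose S := \sum_(k < N) c k.
have S0 : 0 <= S by apply: sumr_ge0 => k _; have [] := cP k.
have d0 : 0 < 2^-1 / (S + 1) by rewrite divr_gt0 ?invr_gt0 ?ltr_wpDl.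
exists (2^-1 / (S + 1)) => // z zd x.
rewrite pencilE; apply: le_trans (rnorm_sum _ _) _.
apply: (@le_trans _ _ (\sum_(k < N) 2^-1 / (S + 1) * c k * rnorm x)).
  apply: ler_sum => k _; rewrite rnormZ -mulrA; have [c0 cA] := cP k.
  apply: ler_pM; rewrite ?normc_ge0 ?rnorm_ge0//.
  exact: ltW.
rewrite -mulr_suml -mulr_sumr -/S; apply: ler_wpM2r; first exact: rnorm_ge0.
rewrite -mulrA ger_pMr ?invr_gt0// mulrC ler_pdivrMr ?ltr_wpDl// mul1r lerDl.
by [].
Qed.

Theorem theorem2p4 (R : realType) (N : nat) (U Y : hilbertType R)
    (Gamma : set 'rV[R[i]]_N) (theta : 'rV[R[i]]_N -> 'L(U, Y)) :
  (0 < N)%N -> separable U -> separable Y ->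
  open_nbhs (0 : 'rV[R[i]]_N) Gamma -> holomorphic_on Gamma theta -> theta 0 = 0 ->
  exists (X : hilbertType R) (alpha : lin_system N X U Y) (J : 'L(X, X)),
    [/\ separable X, canonical_symmetry J, J_conservative alpha J &
      \forall z \near (0 : 'rV[R[i]]_N),
        transfer_defined alpha z /\ theta z = transfer alpha z].
Proof.
move=> N0 /separable_sepseq sU /separable_sepseq sY nG hol t0.
have [r r0 rP] := small_ball nG hol t0.
pose k0 : 'I_N := Ordinal N0.
have [X [alpha [J [sX Js Jc sol]]]] :=
  conservative_dilation k0 (realization k0 theta r) (sepseq_l2 sY) sU sY.
exists X, alpha, J; split => //; first exact: sepseq_separable.
have [d d0 dP] := pencil_small (sysA alpha).
pose e := Num.min r (Num.min (2^-1) d).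
have e0 : 0 < e by rewrite !lt_min r0 invr_gt0 ltr0n d0.
apply/nbhs_ballP; exists e%:C%C; first by rewrite /= ltcR.
move=> z [_ ze].
have {}ze k : normc (z 0 k) < e.
  by have := ze 0 k; rewrite mxE -ball_normE /ball_ /= sub0r normrN normCE ltcR.
have zr k : normc (z 0 k) < r by apply: lt_le_trans (ze k) _; rewrite /e ge_min lexx.
have zh k : normc (z 0 k) <= 2^-1.
  by apply: ltW; apply: lt_le_trans (ze k) _; rewrite /e !ge_min lexx orbT.
have zd k : normc (z 0 k) < d.
  by apply: lt_le_trans (ze k) _; rewrite /e !ge_min lexx !orbT.
have tz : transfer_defined alpha z by apply: neumann; exact: dP.
split=> //; apply: transfer_eq => // u.
have [x xE] := realization_solution k0 r0 t0 rP u zr.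
exact: (sol z x u (theta z u) (zh k0) xE).
Qed.
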